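(* Let $p>2$ and let $(X_t)_{t\ge1}$ be a mean-zero process of the form $X_t=g_t(\mathcal F_t)$ as in the context, with $\Theta_{0,p}<\infty$ and $\sup_{i\ge0}(i+1)^A\Theta_{i,p}<\infty$ for some $A>1$. For a general block length $m=m_n\in\mathbb N$, let $\mathcal T_i$, $1\le i\le n$, be the block-based running variance estimator defined in the context. Then $$\max_{1\le i\le n}\big|\mathcal T_i-\mathbb E(S_i^2)\big|=O_{\mathbb P}\big(n^{\max\{2/p,1/2\}}m^{1/2}+nm^{-A}\big).$$ In particular, with $m\asymp n^{\zeta_1}$, where $\zeta_1=\min\{1,2-4/p\}/(1+2A)$, $$\max_{1\le i\le n}\big|\mathbb W(\mathcal T_i)-\mathbb B_1(\mathbb E(S_i^2))\big|=O_{\mathbb P^*}\big(n^{(1-A\zeta_1)/2}\sqrt{\log n}\big),$$ where $\mathbb P^*$ is the conditional distribution after observing $X_1,\ldots,X_n$, and $\mathbb B_1$ is the same Brownian motion that defines the positive half-line of the two-sided Brownian motion $\mathbb W$.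
   Context: Let $(\varepsilon_i)_{i\in\mathbb Z}$ be i.i.d., $\mathcal F_t=(\ldots,\varepsilon_{t-1},\varepsilon_t)$, and $X_t=g_t(\mathcal F_t)$ with measurable real-valued functions $g_t$ that may differ with $t$; $\mathbb E(X_t)=0$. Write $\|Z\|_p=(\mathbb E|Z|^p)^{1/p}$. Let $(\varepsilon_i')$ be an i.i.d. copy of $(\varepsilon_i)$ and, for $k\ge0$, $X_{i,\{i-k\}}=g_i(\ldots,\varepsilon_{i-k-1},\varepsilon'_{i-k},\varepsilon_{i-k+1},\ldots,\varepsilon_i)$. Put $\delta_p(k)=\sup_i\|X_i-X_{i,\{i-k\}}\|_p$, $\Theta_{i,p}=\sum_{k=i}^\infty\delta_p(k)$, $S_i=\sum_{j=1}^iX_j$. Block-based running variance: for $1\le a,k\le\lceil n/m\rceil$ and $1\le j\le n$, $$B_a=\sum_{i=(a-1)m+1}^{am\wedge n}X_i,\quad T_k=\sum_{a=1}^kB_a^2+2\sum_{a=1}^{k-1}B_aB_{a+1},\quad R_j=\mathbb I\{j/m\notin\mathbb N\}\sum_{i=\lfloor j/m\rfloor m+1}^jX_i,$$ with $T_0=B_0=0$, and $\mathcal T_j=T_{\lfloor j/m\rfloor}+R_j^2+2B_{\lfloor j/m\rfloor}R_j$ for $1\le j\le n$. Two-sided Brownian motion: $\mathbb W(t)=\mathbb B_1(t)\mathbf 1_{t\ge0}+\mathbb B_2(-t)\mathbf 1_{t<0}$ with $\mathbb B_1,\mathbb B_2$ independent standard Brownian motions started at $0$, here independent of $(X_i)$.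 $m\asymp n^{\zeta_1}$ means the ratio is bounded away from $0$ and $\infty$. $Z_n=O_{\mathbb P^*}(r_n)$ means stochastic boundedness of $Z_n/r_n$ under the conditional law $\mathbb P^*$, in probability with respect to the data: for every $\epsilon>0$ there is $M$ with $\limsup_n\mathbb P(\mathbb P^*(|Z_n|>Mr_n)>\epsilon)\le\epsilon$. *)

(* Defs.v *)
From HB Require Import structures.
From mathcomp Require Import all_boot all_order all_algebra.
From mathcomp Require Import all_classical all_reals all_analysis.
Set Implicit Arguments.
Unset Strict Implicit.
Unset Printing Implicit Defensive.
Import Order.TTheory GRing.Theory Num.Theory.
Import numFieldNormedType.Exports.
Local Open Scope classical_set_scope.
Local Open Scope ring_scope.

(** * Independence *)

Definition mutually_independent {d d' : measure_display}
    {Omega : measurableType d} {E : measurableType d'} {R : realType}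
    {I : eqType} (P : probability Omega R) (Y : I -> Omega -> E) : Prop :=
  forall (s : seq I) (A : I -> set E), uniq s -> (forall i, measurable (A i)) ->
    P (\bigcap_(i in [set` s]) (Y i @^-1` A i)) =
    (\prod_(i <- s) P (Y i @^-1` A i))%E.

Definition iid {d d' : measure_display}
    {Omega : measurableType d} {E : measurableType d'} {R : realType}
    {I : eqType} (P : probability Omega R) (Y : I -> Omega -> E) : Prop :=
  [/\ forall i, measurable_fun setT (Y i),
      forall i j A, measurable A -> P (Y i @^-1` A) = P (Y j @^-1` A)
    & mutually_independent P Y].

(* Generators of the sigma-algebra sigma(Y i : i in D). *)
Definition process_events {d' : measure_display} {Omega : Type}
    {E : measurableType d'} {I : Type} (D : set I) (Y : I -> Omega -> E)
    : set_system Omega :=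
  \bigcup_(i in D) preimage_set_system setT (Y i) measurable.

Definition independent_systems {d : measure_display} {Omega : measurableType d}
    {R : realType} (P : probability Omega R) (F G : set_system Omega) : Prop :=
  forall A B, F A -> G B -> P (A `&` B) = (P A * P B)%E.

(** * Causal processes and the physical dependence measure *)

(* The product sigma-algebra on the space of one-sided sequences. *)
Notation past_space E :=
  (g_sigma_algebraType
     (process_events setT (fun (k : nat) (x : nat -> E) => x k))).

Section causal.
Context {d d' : measure_display} {Omega : measurableType d}
  {E : measurableType d'} {R : realType}.
Implicit Types (P : probability Omega R) (g : nat -> past_space E -> R).
Implicit Types (e : int -> Omega -> E).

(* (..., e_{t-1}, e_t) is listed backwards: coordinate k is e_{t-k}. *)
Definition past e (t : nat) (w : Omega) : past_space E :=
  fun k : nat => e (t%:Z - k%:Z) w.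

Definition causal g e (t : nat) (w : Omega) : R := g t (past e t w).

Definition coupled g e e' (i k : nat) (w : Omega) : R :=
  g i (fun j : nat => if j == k then e' (i%:Z - k%:Z) w
                      else e (i%:Z - j%:Z) w).

Definition delta P g e e' (p : R) (k : nat) : \bar R :=
  ereal_sup [set 'N[P]_(p%:E)[EFin \o (causal g e i \- coupled g e e' i k)%R]%E
            | i in [set i : nat | (1 <= i)%N]].

Definition Theta P g e e' (p : R) (i : nat) : \bar R :=
  (\sum_(i <= k <oo) delta P g e e' p k)%E.

End causal.

(** * Block-based running variance *)

Section running_variance.
Context {Omega : Type} {R : realType} (X : nat -> Omega -> R).

Definition partial_sum (i : nat) (w : Omega) : R :=
  \sum_(1 <= j < i.+1) X j w.

(* At a = 0 the range is empty, so that B_0 = 0. *)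
Definition block (m n a : nat) (w : Omega) : R :=
  \sum_((a.-1 * m).+1 <= i < (minn (a * m) n).+1) X i w.

Definition block_var (m n k : nat) (w : Omega) : R :=
  \sum_(1 <= a < k.+1) block m n a w ^+ 2 +
  2 * \sum_(1 <= a < k) block m n a w * block m n a.+1 w.

Definition remainder (m j : nat) (w : Omega) : R :=
  if (m %| j)%N then 0 else \sum_((j %/ m * m).+1 <= i < j.+1) X i w.

Definition running_var (m n j : nat) (w : Omega) : R :=
  block_var m n (j %/ m) w + remainder m j w ^+ 2 +
  2 * block m n (j %/ m) w * remainder m j w.

End running_variance.

(** * Brownian motion *)

Definition brownian {d : measure_display} {Omega : measurableType d}
    {R : realType} (P : probability Omega R) (B : R -> Omega -> R) : Prop :=
  [/\ forall t, 0 <= t -> measurable_fun setT (B t),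
      forall w, B 0 w = 0 /\ {within `[0, +oo[, continuous (fun t => B t w)},
      forall s t, 0 <= s -> s < t -> forall A, measurable A ->
        P ((B t \- B s) @^-1` A) = normal_prob 0 (Num.sqrt (t - s)) A
    & forall t : nat -> R, 0 <= t 0%N -> (forall k, t k <= t k.+1) ->
        mutually_independent P (fun k => B (t k.+1) \- B (t k))].

Definition two_sided {Omega : Type} {R : realType} (B1 B2 : R -> Omega -> R)
    (t : R) (w : Omega) : R :=
  if 0 <= t then B1 t w else B2 (- t) w.

(** * Stochastic orders *)

Section stochastic_orders.
Context {d : measure_display} {Omega : measurableType d} {R : realType}
  (P : probability Omega R).

Definition bigO_prob (Z : nat -> Omega -> R) (r : nat -> R) : Prop :=
  forall eps : R, 0 < eps -> exists M : R,
    (limn_esup (fun n => P [set w | M * r n < `|Z n w|]%R) <= eps%:E)%E.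

(* q is a version of the conditional probability of A given sigma(F). *)
Definition is_cond_prob (F : set_system Omega) (A : set Omega)
    (q : Omega -> R) : Prop :=
  [/\ measurable_fun setT (q : g_sigma_algebraType F -> R),
      P.-integrable setT (EFin \o q)
    & forall C, <<s F >> C -> (\int[P]_(w in C) (q w)%:E = P (A `&` C))%E].

(* Versions of a conditional probability agree almost surely, so the choice of
   q is immaterial; q n is P^*(|Z_n| > M r_n) when the data available at stage
   n generate sigma(F n). *)
Definition bigO_cond_prob (F : nat -> set_system Omega)
    (Z : nat -> Omega -> R) (r : nat -> R) : Prop :=
  forall eps : R, 0 < eps -> exists (M : R) (q : nat -> Omega -> R),
    (forall n, is_cond_prob (F n) [set w | M * r n < `|Z n w|] (q n)) /\
    (limn_esup (fun n => P [set w | eps < q n w]%R) <= eps%:E)%E.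

End stochastic_orders.

(* Ratio eventually bounded away from 0 and infinity. *)
Definition same_order {R : realType} (a b : nat -> R) : Prop :=
  exists c C : R, [/\ 0 < c, 0 < C &
    \forall n \near \oo, c <= a n / b n <= C].

(* Main.v *)
Require Import Defs.
From HB Require Import structures.
From mathcomp Require Import all_boot all_order all_algebra.
From mathcomp Require Import all_classical all_reals all_analysis.
From mathcomp Require Import measurable_realfun.
From mathcomp Require Import ring lra zify.
Set Implicit Arguments.
Unset Strict Implicit.
Unset Printing Implicit Defensive.
Import Order.TTheory GRing.Theory Num.Theory.
Import numFieldNormedType.Exports.
Local Open Scope classical_set_scope.
Local Open Scope ring_scope.

(** The running variance is a quadratic form in the process, and the proof
    treats its fluctuation and its bias separately.

    Replacing innovations by independent copies is what the physical dependence
    measure controls. Averaging over the innovations after a given time defines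
    conditional means everywhere, and a function of the past splits into its
    projections on single layers of innovations plus a remote part. For a fixed
    lag the projections form martingale differences, so that the maximum of
    their partial sums is controlled by an L^r maximal inequality, derived from
    a two-point inequality for |x + y|^r and the pathwise form of Doob's
    inequality; summing over the lags gives [projective_max]. The remote part is
    small because replacing the whole remote past costs no more than replacing
    its innovations one at a time ([coupling_remote]), a limit that rests on the
    approximation of events by cylinders.

    [projective_max] is used twice. Applied to the process it bounds the maximal
    partial sums over k consecutive times by O(sqrt k) in L^p. Applied to the
    centred block products B_a^2 + 2 B_(a-1) B_a, in L^(p/2), it bounds the
    fluctuation: the first lags cost O(m) each and the later ones a summable
    sequence, whence O((n/m)^(2/p) m) for exponents p <= 4, to which one may
    reduce ([blk_dev_max]). This is at most O(n^(2/p) m^(1/2)). The bias consists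
    of the products of non-adjacent blocks; their covariances are O(m^(-A)) per
    time because projections on distinct layers are orthogonal ([bias_le]).
    Both are collected in [running_var_max], and Markov's inequality gives the
    first claim.

    For the second claim, the exponent of m balances the two terms of the rate,
    so that the random times are within h = O(n^(1 - A zeta_1)) of the
    variances, uniformly. Dyadic chaining with Gaussian tails shows that
    Brownian motion moves by at most O(sqrt(h log n)) over distance h up to a
    horizon of order n, off an event of probability O(1/n) ([bad_path_le],
    [brownian_modulus]). This bounds the unconditional probability of a large
    gap. Versions of the conditional probability exist by the Radon-Nikodym theorem,
    and Markov's inequality transfers the bound to them. *)

(** * Real powers *)

Section real_powers.
Context {R : realType}.
Implicit Types (a b x y u v r s p : R).

(** Young's inequality for the conjugate exponents p and p/(p - 1). *)
Lemma young_tangent p a b : 1 < p -> 0 <= a -> 0 <= b ->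
  p * (a `^ (p - 1) * b) <= (p - 1) * a `^ p + b `^ p.
Proof.
move=> p1 a0 b0; have p0 : 0 < p by lra.
have pm : 0 < p - 1 by lra.
have := @conjugate_powR R b (a `^ (p - 1)) p (p / (p - 1)) b0 (powR_ge0 _ _) p0.
have -> : (a `^ (p - 1)) `^ (p / (p - 1)) = a `^ p.
  by rewrite -powRrM; congr (_ `^ _); field; lra.
move=> /(_ (divr_gt0 p0 pm)) H.
have /H {H} : p^-1 + (p / (p - 1))^-1 = 1 by field; lra.
rewrite invf_div => H.
rewrite mulrC [_ * b]mulrC.
rewrite -ler_pdivlMr// (le_trans H)// le_eqVlt; apply/orP; left; apply/eqP.
by field; lra.
Qed.

(** The derivative of |x|^(s+1)/(s+1). *)
Definition signed_powR s x : R := Num.sg x * `|x| `^ s.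

Lemma normr_signed_powR s x : `|signed_powR s x| <= `|x| `^ s.
Proof.
rewrite /signed_powR normrM (ger0_norm (powR_ge0 _ _)).
by rewrite ler_piMl ?powR_ge0// normr_sg lern1 leq_b1.
Qed.

Lemma signed_powRM s x : 0 < s -> signed_powR s x * x = `|x| `^ (s + 1).
Proof.
move=> s0; rewrite /signed_powR mulrAC -normrEsg.
by rewrite -(@mulr_powRB1 _ _ (s + 1)) ?addrK//; lra.
Qed.

(** Convexity: the graph of |.|^p lies above its tangents. *)
Lemma powR_tangent p a b : 1 < p ->
  `|a| `^ p + p * signed_powR (p - 1) a * (b - a) <= `|b| `^ p.
Proof.
move=> p1.
rewrite mulrBr -2!(mulrA p) (@signed_powRM (p - 1) a) ?subrK; last lra.
have := @young_tangent p `|a| `|b| p1 (normr_ge0 _) (normr_ge0 _).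
have : signed_powR (p - 1) a * b <= `|a| `^ (p - 1) * `|b|.
  rewrite (le_trans (ler_norm _))// normrM ler_wpM2r//.
  exact: normr_signed_powR.
move=> H; have : p * (signed_powR (p - 1) a * b) <= p * (`|a| `^ (p - 1) * `|b|).
  by rewrite ler_pM2l//; lra.
lra.
Qed.

Lemma powR_subadd s a b : 0 < s <= 1 -> 0 <= a -> 0 <= b ->
  (a + b) `^ s <= a `^ s + b `^ s.
Proof.
move=> /andP[s0 s1] a0 b0.
have [->|an0] := eqVneq (a + b) 0.
  by rewrite powR0 ?gt_eqF// addr_ge0 ?powR_ge0.
have ab : 0 < a + b by rewrite lt_def an0 addr_ge0.
have key c : 0 <= c -> c <= a + b -> c / (a + b) * (a + b) `^ s <= c `^ s.
  move=> c0 cab; have [->|cn] := eqVneq c 0; first by rewrite !mul0r powR_ge0.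
  have cp : 0 < c by rewrite lt_def cn.
  have {2}-> : c = c / (a + b) * (a + b) by rewrite divfK ?gt_eqF.
  have ab0 := ltW ab; rewrite powRM ?divr_ge0// ler_wpM2r ?powR_ge0//.
  by rewrite ger1_powR// divr_gt0//= ler_pdivrMr// mul1r.
have := key a a0; have := key b b0.
rewrite lerDl lerDr => /(_ a0) H1 /(_ b0) H2.
rewrite -[leLHS]mul1r.
have -> : 1 = a / (a + b) + b / (a + b) by rewrite -mulrDl divff ?gt_eqF.
by rewrite mulrDl lerD.
Qed.

Lemma signed_powRN s x : signed_powR s (- x) = - signed_powR s x.
Proof. by rewrite /signed_powR normrN sgrN mulNr. Qed.

Lemma signed_powR_ge0 s x : 0 <= x -> 0 < s -> signed_powR s x = x `^ s.
Proof.
move=> x0 s0; rewrite /signed_powR ger0_norm//.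
have [->|xn] := eqVneq x 0; first by rewrite sgr0 mul0r powR0// gt_eqF.
by rewrite gtr0_sg ?mul1r// lt_def xn.
Qed.

(** Both bounds on the increments of the derivative reduce, by symmetry, to
    arguments of the same sign in increasing order or of opposite signs. *)
Lemma signed_pair_ind (Q : R -> R -> Prop) :
  (forall u v, Q u v -> Q v u) -> (forall u v, Q u v -> Q (- u) (- v)) ->
  (forall u v, 0 <= u -> u <= v -> Q u v) ->
  (forall u v, 0 <= u -> 0 <= v -> Q (- u) v) -> forall u v, Q u v.
Proof.
move=> Qs Qn Qp Qm u v.
have [u0|u0] := leP 0 u; have [v0|v0] := leP 0 v.
- by have [uv|uv] := leP u v; [apply: Qp|apply/Qs/Qp => //; exact: ltW].
- by rewrite -(opprK v); apply/Qs/Qm => //; lra.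
- by rewrite -(opprK u); apply/Qm => //; lra.
- rewrite -(opprK u) -(opprK v); apply: Qn.
  have [uv|uv] := leP (- u) (- v); first by apply: Qp => //; lra.
  by apply/Qs/Qp; lra.
Qed.

Lemma signed_powR_holder s u v : 0 < s <= 1 ->
  `|signed_powR s u - signed_powR s v| <= 2 * `|u - v| `^ s.
Proof.
move=> /andP[s0 s1]; move: u v; apply: signed_pair_ind.
- by move=> u v; rewrite distrC (distrC u).
- by move=> u v; rewrite !signed_powRN -!opprD !normrN.
- move=> u v u0 uv; have v0 : 0 <= v by lra.
  rewrite !signed_powR_ge0// !(distrC u) (distrC (u `^ _)).
  rewrite !ger0_norm ?subr_ge0//; last by apply: ge0_ler_powR => //; exact: ltW.
  have := @powR_subadd s (v - u) u; rewrite s0 s1 subrK subr_ge0 => /(_ isT uv u0).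
  by have := powR_ge0 (v - u) s; lra.
- move=> u v u0 v0; rewrite signed_powRN !signed_powR_ge0//.
  rewrite -opprD normrN (_ : - u - v = - (u + v)); last by rewrite opprD.
  rewrite normrN !ger0_norm ?addr_ge0 ?powR_ge0//.
  have H w : 0 <= w -> w <= u + v -> w `^ s <= (u + v) `^ s.
    by move=> w0 wuv; apply: ge0_ler_powR; rewrite ?nnegrE ?addr_ge0// ltW.
  by have := H u u0; have := H v v0; rewrite lerDl lerDr => /(_ u0) + /(_ v0); lra.
Qed.

Lemma signed_powR_lip s u v : 1 < s ->
  `|signed_powR s u - signed_powR s v| <=
  s * (`|u| + `|u - v|) `^ (s - 1) * `|u - v|.
Proof.
move=> s1; have s0 : 0 < s by lra.
suff H : `|signed_powR s u - signed_powR s v| <=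
    s * (Num.max `|u| `|v|) `^ (s - 1) * `|u - v|.
  apply: (le_trans H); rewrite ler_wpM2r// ler_pM2l//; apply: ge0_ler_powR.
  - lra.
  - by rewrite nnegrE le_max normr_ge0.
  - by rewrite nnegrE addr_ge0.
  - rewrite ge_max lerDl normr_ge0/= distrC.
    by rewrite -{1}(subrK u v) addrC ler_normD.
move: u v; apply: signed_pair_ind.
- by move=> u v; rewrite maxC distrC (distrC u).
- by move=> u v; rewrite !signed_powRN -!opprD !normrN.
- move=> u v u0 uv; have v0 : 0 <= v by lra.
  rewrite !signed_powR_ge0// !(distrC u) (distrC (u `^ _)).
  rewrite !ger0_norm ?subr_ge0//; last by apply: ge0_ler_powR => //; exact: ltW.
  rewrite (max_idPr uv).
  have := @powR_tangent s v u s1; rewrite !ger0_norm//.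
  by rewrite signed_powR_ge0//; lra.
- move=> u v u0 v0; rewrite signed_powRN !signed_powR_ge0//.
  rewrite -opprD normrN (_ : - u - v = - (u + v)); last by rewrite opprD.
  rewrite !normrN !ger0_norm ?addr_ge0 ?powR_ge0//.
  have sm : 0 < s - 1 by lra.
  have H w : 0 <= w -> w <= Num.max u v ->
      w `^ s <= (Num.max u v) `^ (s - 1) * w.
    move=> w0 wuv; rewrite -(mulr_powRB1 w0 s0) mulrC ler_wpM2r//.
    by apply: ge0_ler_powR; rewrite ?nnegrE ?(le_trans w0 wuv)// ltW.
  have := H u u0; have := H v v0; rewrite !le_max !lexx orbT/= => /(_ isT) + /(_ isT).
  move=> H1 H2; rewrite (le_trans (lerD H2 H1))// -mulrDr -mulrA.
  by rewrite ler_peMl ?mulr_ge0 ?powR_ge0 ?addr_ge0// ltW.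
Qed.

(** Convexity bounds |x + y|^r by the tangent at x + y; replacing the slope
    there by the slope at x leaves an error governed by the modulus of
    continuity of the derivative. *)
Lemma powR_increment r x y : 1 < r ->
  `|x + y| `^ r <= `|x| `^ r + r * signed_powR (r - 1) x * y +
    r * (`|signed_powR (r - 1) x - signed_powR (r - 1) (x + y)| * `|y|).
Proof.
move=> r1; have := @powR_tangent r (x + y) x r1.
rewrite (_ : x - (x + y) = - y); last by ring.
move=> H.
have := ler_norm ((signed_powR (r - 1) (x + y) - signed_powR (r - 1) x) * y).
rewrite normrM distrC => H2.
have : r * ((signed_powR (r - 1) (x + y) - signed_powR (r - 1) x) * y) <=
  r * (`|signed_powR (r - 1) x - signed_powR (r - 1) (x + y)| * `|y|).
  by rewrite ler_pM2l//; lra.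
lra.
Qed.

(** The middle term is linear in y: it has mean zero when y is a martingale
    difference and x the sum of the earlier ones. *)
Lemma two_point_le2 r x y : 1 < r <= 2 ->
  `|x + y| `^ r <= `|x| `^ r + r * signed_powR (r - 1) x * y + 2 * r * `|y| `^ r.
Proof.
move=> /andP[r1 r2]; apply: (le_trans (powR_increment _ _ r1)).
rewrite lerD2l [2 * r]mulrC -mulrA ler_pM2l; last lra.
have r01 : 0 < r - 1 <= 1 by lra.
apply: le_trans (ler_wpM2r (normr_ge0 _) (signed_powR_holder _ _ r01)) _.
rewrite (_ : x - (x + y) = - y); last by ring.
by rewrite normrN -mulrA [_ * `|y|]mulrC mulr_powRB1//; lra.
Qed.

Lemma powRD_le s a b : 0 <= s -> 0 <= a -> 0 <= b ->
  (a + b) `^ s <= 2 `^ s * (a `^ s + b `^ s).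
Proof.
move=> s0 a0 b0; wlog ab : a b a0 b0 / a <= b.
  move=> W; have [ab|ab] := leP a b; first exact: W.
  by rewrite addrC [a `^ _ + _]addrC; apply: W => //; exact: ltW.
apply: (@le_trans _ _ ((2 * b) `^ s)).
  by apply: ge0_ler_powR => //; rewrite ?nnegrE; lra.
by rewrite powRM// ler_wpM2l ?powR_ge0// lerDr powR_ge0.
Qed.

(** For r > 2 the derivative of |x|^r is only locally Lipschitz, whence the
    mixed term |x|^(r-2) y^2, which carries the second moment of y. *)
Lemma two_point_gt2 r x y : 2 < r ->
  `|x + y| `^ r <= `|x| `^ r + r * signed_powR (r - 1) x * y +
    r * (r - 1) * 2 `^ (r - 2) * (`|x| `^ (r - 2) * `|y| ^+ 2 + `|y| `^ r).
Proof.
move=> r2; have r1 : 1 < r by lra.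
apply: (le_trans (powR_increment _ _ r1)).
have rm : 1 < r - 1 by lra.
rewrite lerD2l -2!mulrA ler_pM2l; last lra.
apply: le_trans (ler_wpM2r (normr_ge0 _) (signed_powR_lip _ _ rm)) _.
rewrite (_ : x - (x + y) = - y); last by ring.
rewrite normrN (_ : r - 1 - 1 = r - 2); last by ring.
rewrite -!mulrA ler_pM2l; last lra.
rewrite -expr2.
have r20 : 0 <= r - 2 by lra.
have y2 : 0 <= `|y| ^+ 2 by rewrite exprn_ge0.
apply: le_trans (ler_wpM2r y2 (powRD_le r20 (normr_ge0 _) (normr_ge0 _))) _.
rewrite -mulrA ler_pM2l ?powR_gt0// mulrDl lerD2l.
by rewrite -powR_mulrn// -powRD ?subrK//; apply/implyP => /eqP; lra.
Qed.

End real_powers.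

(** * Norm bounds *)

Section norm_bounds.
Context {d : measure_display} {T : measurableType d} {R : realType}.
Variable mu : probability T R.
Implicit Types (f g h : T -> R) (r s p a b c : R).

(** The finite upper bound c is carried along with measurability, so that the
    triangle and Hoelder inequalities can be chained over the reals. *)
Record norm_le r f c : Prop := NormLe {
  norm_le_measurable : measurable_fun setT f ;
  norm_le_ge0 : 0 <= c ;
  norm_le_int : (\int[mu]_x (`|f x| `^ r)%:E <= (c `^ r)%:E)%E }.

Lemma measurable_normr_gt t f : measurable_fun setT f ->
  measurable [set x | t < `|f x|].
Proof.
move=> mf; rewrite -[X in measurable X]setTI; apply: measurable_fun_ltr => //.
exact: measurableT_comp.
Qed.

Lemma measurable_normr_powR r f : measurable_fun setT f ->
  measurable_fun setT (fun x => `|f x| `^ r).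
Proof.
move=> mf; apply: (@measurableT_comp _ _ _ _ _ _ (@powR R ^~ r)) => //.
exact: measurableT_comp.
Qed.

Lemma measurable_EFin_powR r f : measurable_fun setT f ->
  measurable_fun setT (fun x => (`|f x| `^ r)%:E).
Proof. by move=> mf; apply/measurable_EFinP; exact: measurable_normr_powR. Qed.

Lemma norm_leP r f c : 0 < r -> measurable_fun setT f -> 0 <= c ->
  norm_le r f c <-> ('N[mu]_(r%:E)[EFin \o f] <= c%:E)%E.
Proof.
move=> r0 mf c0.
have H : ('N[mu]_(r%:E)[EFin \o f] `^ r = \int[mu]_x (`|f x| `^ r)%:E)%E.
  by rewrite poweR_Lnorm ?gt_eqF.
split=> [[_ _]|Nc].
- rewrite -H -poweR_EFin => Nc; rewrite leNgt; apply/negP => cN.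
  have [fN|] := boolP ('N[mu]_(r%:E)[EFin \o f] \is a fin_num)%E; last first.
    rewrite ge0_fin_numE ?Lnorm_ge0// -leNgt leye_eq => /eqP Noo.
    by move: Nc; rewrite Noo poweRyr ?gt_eqF// poweR_EFin leye_eq.
  move: Nc cN; rewrite -(fineK fN) !poweR_EFin lee_fin lte_fin => Nc cN.
  have : c `^ r < fine 'N[mu]_(r%:E)[EFin \o f] `^ r.
    by apply: gt0_ltr_powR => //; rewrite nnegrE// (le_trans c0)// ltW.
  by rewrite ltNge Nc.
- split=> //; rewrite -H -poweR_EFin gt0_ler_poweR ?(ltW r0)// ?in_itv/= ?leey ?andbT.
  + exact: Lnorm_ge0.
  + by rewrite lee_fin.
Qed.

Lemma norm_leW r f c c' : 0 < r -> c <= c' -> norm_le r f c -> norm_le r f c'.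
Proof.
move=> r0 cc' [mf c0 H]; split => //; first exact: le_trans cc'.
apply: (le_trans H); rewrite lee_fin.
by apply: ge0_ler_powR; rewrite ?(ltW r0)// nnegrE// (le_trans c0).
Qed.

Lemma norm_le_ae r f g c : measurable_fun setT f ->
  0 < r -> {ae mu, forall x, `|f x| <= `|g x|} ->
  norm_le r g c -> norm_le r f c.
Proof.
move=> mf r0 fg [mg c0 H]; split; [exact: mf|exact: c0|].
apply: le_trans H.
apply: (ae_ge0_le_integral measurableT).
- by move=> x _; rewrite lee_fin powR_ge0.
- exact: measurable_EFin_powR.
- by move=> x _; rewrite lee_fin powR_ge0.
- exact: measurable_EFin_powR.
- by apply: filterS fg => x Hx _; rewrite lee_fin ge0_ler_powR ?nnegrE// ltW.
Qed.

Lemma norm_le_dom r f g c : measurable_fun setT f ->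
  0 < r -> (forall x, `|f x| <= `|g x|) ->
  norm_le r g c -> norm_le r f c.
Proof. by move=> mf r0 fg; apply: norm_le_ae => //; exact: aeW. Qed.

Lemma norm_le_eq r f g c : f =1 g -> norm_le r g c -> norm_le r f c.
Proof. by move=> /funext ->. Qed.

Lemma norm_leD r f g a b : 1 <= r -> norm_le r f a -> norm_le r g b ->
  norm_le r (fun x => f x + g x) (a + b).
Proof.
move=> r1 nf ng; have r0 : 0 < r by lra.
have [mf a0 _] := nf; have [mg b0 _] := ng.
apply/norm_leP => //; [exact: measurable_funD|exact: addr_ge0|].
apply: (le_trans (minkowski _ mf mg r1)).
by rewrite EFinD leeD//; apply/norm_leP.
Qed.

Lemma norm_leN r f a : norm_le r f a -> norm_le r (fun x => - f x) a.
Proof.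
move=> [mf a0 H]; split; [exact: measurable_funN|exact: a0|].
by under eq_integral do rewrite normrN.
Qed.

Lemma norm_leB r f g a b : 1 <= r -> norm_le r f a -> norm_le r g b ->
  norm_le r (fun x => f x - g x) (a + b).
Proof. by move=> r1 nf ng; apply: norm_leD => //; exact: norm_leN. Qed.

Lemma norm_le0 r : 0 < r -> norm_le r (fun=> 0) 0.
Proof.
move=> r0; split => //.
under eq_integral do rewrite normr0 powR0 ?gt_eqF//.
by rewrite integral0 powR0 ?gt_eqF.
Qed.

Lemma norm_le_sum r (I : eqType) (l : seq I) (F : I -> T -> R) (C : I -> R) :
  1 <= r -> {in l, forall i, norm_le r (F i) (C i)} ->
  norm_le r (fun x => \sum_(i <- l) F i x) (\sum_(i <- l) C i).
Proof.
move=> r1; elim: l => [_|i l IH H].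
  rewrite big_nil; apply: (@norm_le_eq _ _ (fun=> 0)).
    by move=> x; rewrite big_nil.
  by apply: norm_le0; lra.
rewrite big_cons; apply: (@norm_le_eq _ _ (fun x => F i x + \sum_(j <- l) F j x)).
  by move=> x; rewrite big_cons.
apply: norm_leD => //; first by apply: H; rewrite mem_head.
by apply: IH => j jl; apply: H; rewrite in_cons jl orbT.
Qed.

Lemma norm_leZ r f a k : norm_le r f a ->
  norm_le r (fun x => k * f x) (`|k| * a).
Proof.
move=> [mf a0 H]; split; [exact: measurable_funM|exact: mulr_ge0|].
under eq_integral do rewrite normrM powRM// EFinM.
rewrite ge0_integralZl//.
- by rewrite powRM// EFinM; apply: lee_wpmul2l => //; rewrite lee_fin powR_ge0.
- exact: measurable_EFin_powR.
Qed.

Lemma norm_le_cst r k : norm_le r (fun=> k) `|k|.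
Proof.
split => //; rewrite integral_cst//= probability_setT.
by rewrite mule1.
Qed.

Lemma norm_le_abs r f a : norm_le r f a -> norm_le r (fun x => `|f x|) a.
Proof.
move=> [mf a0 H]; split; [exact: measurableT_comp|exact: a0|].
by under eq_integral do rewrite normr_id.
Qed.

Lemma norm_le_powR r s f a : 0 < s -> norm_le r f a ->
  norm_le (r / s) (fun x => `|f x| `^ s) (a `^ s).
Proof.
move=> s0 [mf a0 H]; split; [exact: measurable_normr_powR|exact: powR_ge0|].
have E b : 0 <= b -> (`|b `^ s|) `^ (r / s) = b `^ r.
  by move=> b0; rewrite ger0_norm ?powR_ge0// -powRrM mulrC divfK ?gt_eqF.
under eq_integral do rewrite E//.
by rewrite -{1}(ger0_norm (powR_ge0 a s)) E.
Qed.

Lemma norm_le_root r s f a : 0 < s -> measurable_fun setT f -> 0 <= a ->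
  norm_le r (fun x => `|f x| `^ s) (a `^ s) -> norm_le (s * r) f a.
Proof.
move=> s0 mf a0 [_ _]; under eq_integral do rewrite ger0_norm ?powR_ge0// -powRrM.
by rewrite -powRrM.
Qed.

Lemma norm_le_hoelder p r f g a b : 0 < p -> 0 < r -> p^-1 + r^-1 = 1 ->
  norm_le p f a -> norm_le r g b -> norm_le 1 (fun x => f x * g x) (a * b).
Proof.
move=> p0 r0 pr nf ng; have [mf a0 _] := nf; have [mg b0 _] := ng.
apply/norm_leP => //; [exact: measurable_funM|exact: mulr_ge0|].
apply: (le_trans (hoelder mu mf mg p0 r0 pr)).
by rewrite EFinM; apply: lee_pmul; rewrite ?Lnorm_ge0//; apply/norm_leP.
Qed.

Lemma norm_leM p f g a b : 0 < p -> norm_le p f a -> norm_le p g b ->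
  norm_le (p / 2) (fun x => f x * g x) (a * b).
Proof.
move=> p0 nf ng; have [mf a0 _] := nf; have [mg b0 _] := ng.
have p2 : 0 < p / 2 by lra.
rewrite -(mulr1 (p / 2)); apply: norm_le_root => //.
- exact: measurable_funM.
- exact: mulr_ge0.
rewrite powRM//; apply: (@norm_le_eq _ _ (fun x =>
  `|f x| `^ (p / 2) * `|g x| `^ (p / 2))).
  by move=> x; rewrite normrM powRM.
have E : p / (p / 2) = 2 by field; lra.
have nf' := norm_le_powR p2 nf; have ng' := norm_le_powR p2 ng.
rewrite E in nf' ng'.
by apply: norm_le_hoelder nf' ng' => //; lra.
Qed.

Lemma norm_le_exp r s f a : 0 < s -> s <= r -> norm_le r f a -> norm_le s f a.
Proof.
move=> s0; rewrite le_eqVlt => /predU1P[->//|sr] nf.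
have [mf a0 _] := nf.
rewrite -(mulr1 s); apply: norm_le_root => //.
have rs : 1 < r / s by rewrite ltr_pdivlMr// mul1r.
have H := norm_le_hoelder (a := a `^ s) (b := 1) (p := r / s)
   (r := (r / s) / (r / s - 1)) (f := fun x => `|f x| `^ s) (g := fun=> 1).
rewrite mulr1 in H; apply: (norm_le_eq _ (H _ _ _ _ _)) => //.
- by move=> x; rewrite mulr1.
- lra.
- by rewrite divr_gt0//; lra.
- by move: (r / s) rs => k k1; field; lra.
- exact: norm_le_powR.
- by have := norm_le_cst (r / s / (r / s - 1)) 1; rewrite normr1.
Qed.

Lemma measurable_bigmaxr (I : eqType) (l : seq I) (F : I -> T -> R) :
  {in l, forall i, measurable_fun setT (F i)} ->
  measurable_fun setT (fun x => \big[Num.max/0]_(i <- l) `|F i x|).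
Proof.
elim: l => [_|i l IH H].
  by rewrite (_ : (fun _ => _) = cst 0)//; apply/funext => x; rewrite big_nil.
rewrite (_ : (fun _ => _) = (fun x => `|F i x|) \max
    (fun x => \big[Num.max/0]_(j <- l) `|F j x|)); last first.
  by apply/funext => x; rewrite big_cons.
apply: measurable_maxr.
  by apply: measurableT_comp => //; apply: H; rewrite mem_head.
by apply: IH => j jl; apply: H; rewrite in_cons jl orbT.
Qed.

(** A maximum is at most the l^r norm of its terms, which costs only the r-th
    root of their number. *)
Lemma norm_le_max r (I : eqType) (l : seq I) (F : I -> T -> R) (C : I -> R) :
  0 < r -> {in l, forall i, norm_le r (F i) (C i)} ->
  norm_le r (fun x => \big[Num.max/0]_(i <- l) `|F i x|)
    ((\sum_(i <- l) C i `^ r) `^ r^-1).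
Proof.
move=> r0 H; have Cs : 0 <= \sum_(i <- l) C i `^ r.
  by rewrite sumr_ge0// => i _; exact: powR_ge0.
split; [by apply: measurable_bigmaxr => i /H[]|exact: powR_ge0|].
rewrite -powRrM mulVf ?gt_eqF// powRr1//.
elim: l {Cs} H => [_|i l IH H].
  under eq_integral do rewrite big_nil normr0 powR0 ?gt_eqF//.
  by rewrite integral0 big_nil.
have mF : {in i :: l, forall i, measurable_fun setT (F i)} by move=> j /H[].
have mM : measurable_fun setT (fun x => \big[Num.max/0]_(j <- l) `|F j x|).
  by apply: measurable_bigmaxr => j jl; apply: mF; rewrite in_cons jl orbT.
have mFi : measurable_fun setT (F i) by apply: mF; rewrite mem_head.
rewrite big_cons EFinD.
have Hi : (\int[mu]_x (`|F i x| `^ r)%:E <= (C i `^ r)%:E)%E.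
  by have [] := H i (mem_head _ _).
have Hl : {in l, forall i, norm_le r (F i) (C i)}.
  by move=> j jl; apply: H; rewrite in_cons jl orbT.
apply: (le_trans _ (leeD Hi (IH Hl))).
have n0 g x : [set: T] x -> (0 <= (`|g x| `^ r)%:E)%E by rewrite lee_fin powR_ge0.
have mp g : measurable_fun setT g -> measurable_fun setT (fun x => (`|g x| `^ r)%:E).
  exact: measurable_EFin_powR.
rewrite -(ge0_integralD mu measurableT (n0 _) (mp _ mFi) (n0 _) (mp _ mM)).
apply: (ge0_le_integral _ measurableT).
- by move=> x _; rewrite lee_fin powR_ge0.
- exact/mp/measurable_bigmaxr.
- by apply: emeasurable_funD; apply: mp.
- move=> x _; rewrite -EFinD lee_fin big_cons.
  have [_|_] := leP `|F i x| (\big[Num.max/0]_(j <- l) `|F j x|).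
    by rewrite lerDr powR_ge0.
  by rewrite normr_id lerDl powR_ge0.
Qed.

Lemma norm_le_integrable r f a : 1 <= r -> norm_le r f a ->
  mu.-integrable setT (EFin \o f).
Proof.
move=> r1 nf; have [] := norm_le_exp ltr01 r1 nf.
move=> mf a0 H; apply/integrableP; split; first exact/measurable_EFinP.
apply: le_lt_trans (ltry (a `^ 1)); apply: le_trans H.
by under [leRHS]eq_integral do rewrite powRr1//.
Qed.

Lemma norm_le_Rintegral r f a : 1 <= r -> norm_le r f a ->
  `|\int[mu]_x f x| <= a.
Proof.
move=> r1 nf; have fi := norm_le_integrable r1 nf.
rewrite (le_trans (le_normr_Rintegral measurableT fi))//.
have [_ a0] := norm_le_exp ltr01 r1 nf.
rewrite powRr1// -lee_fin; apply: le_trans.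
rewrite /Rintegral fineK; last first.
  apply: integrable_fin_num => //; exact: (integrable_norm fi).
by under [leRHS]eq_integral do rewrite powRr1//.
Qed.

Lemma norm_le_markov r f a t : 0 < r -> 0 < t -> norm_le r f a ->
  (mu [set x | t < `|f x|]%R <= ((a / t) `^ r)%:E)%E.
Proof.
move=> r0 t0 [mf a0 H].
have mA := measurable_normr_gt t mf.
have t0' := ltW t0; rewrite powRM ?invr_ge0// EFinM.
rewrite (_ : t^-1 `^ r = (t `^ r)^-1); last first.
  by rewrite -(powR_inv1 t0') -powRrM mulN1r powRN.
rewrite muleC -lee_pdivrMl ?invr_gt0 ?powR_gt0// invrK.
apply: le_trans H; rewrite -[X in mu X]setIT -integral_indic//.
rewrite -ge0_integralZl//; last 2 first.
- exact/measurable_EFinP.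
- by rewrite lee_fin powR_ge0.
apply: (ge0_le_integral _ measurableT).
- by move=> x _; rewrite mule_ge0// lee_fin ?powR_ge0.
- by apply: emeasurable_funM => //; exact/measurable_EFinP.
- exact: measurable_EFin_powR.
- move=> x _; rewrite -EFinM lee_fin indicE; have [|_] := boolP (x \in _).
    by rewrite inE/= => tf; rewrite mulr1 ge0_ler_powR ?nnegrE// ltW.
  by rewrite mulr0 powR_ge0.
Qed.

Lemma Rintegral_sum_ord (F : nat -> T -> R) n :
  (forall k, (k < n)%N -> mu.-integrable setT (EFin \o F k)) ->
  mu.-integrable setT (EFin \o (fun x => \sum_(k < n) F k x)) /\
  \int[mu]_x (\sum_(k < n) F k x) = \sum_(k < n) \int[mu]_x F k x.
Proof.
elim: n => [_|n IH iF].
  rewrite (_ : (fun x => _) = cst 0); last by apply/funext => x; rewrite big_ord0.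
  split; first exact: finite_measure_integrable_cst.
  by rewrite Rintegral_cst// mul0r big_ord0.
have [|IH1 IH2] := IH; first by move=> k /ltnW; exact: iF.
rewrite (_ : (fun x => _) = fun x => (\sum_(k < n) F k x) + F n x); last first.
  by apply/funext => x; rewrite big_ord_recr.
split; first exact: (integrableD measurableT IH1 (iF n (ltnSn n))).
by rewrite (RintegralD measurableT IH1 (iF n (ltnSn n))) IH2 big_ord_recr.
Qed.

End norm_bounds.

(** * Moments of martingales *)

Section martingales.
Context {d : measure_display} {T : measurableType d} {R : realType}.
Variable mu : probability T R.
Implicit Types (D : nat -> T -> R) (r s a b c sigma : R).

(** Martingale differences with respect to their own past: a function of the
    past is encoded as one that does not separate two points with the same
    past, which spares any sub-sigma-algebra. Testing against functions in the
    dual space of L^r keeps all products integrable. *)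
Definition martingale_diff r D : Prop := forall k (h : T -> R) c,
  norm_le mu (r / (r - 1)) h c ->
  (forall x y, (forall i, (i < k)%N -> D i x = D i y) -> h x = h y) ->
  \int[mu]_x (h x * D k x) = 0.

Definition psum D n x : R := \sum_(i < n) D i x.

Lemma psumS D n x : psum D n.+1 x = psum D n x + D n x.
Proof. by rewrite /psum big_ord_recr. Qed.

Lemma psum_past D n x y : (forall i, (i < n)%N -> D i x = D i y) ->
  forall k, (k <= n)%N -> psum D k x = psum D k y.
Proof.
by move=> H k kn; apply: eq_bigr => i _; apply/H/(leq_trans _ kn)/ltn_ord.
Qed.

Lemma measurable_signed_powR s (f : T -> R) :
  measurable_fun setT f -> measurable_fun setT (fun x => signed_powR s (f x)).
Proof.
move=> mf; rewrite /signed_powR; apply: measurable_funM; last first.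
  exact: measurable_normr_powR.
rewrite (_ : (fun x => Num.sg (f x)) =
   fun x => (0 < f x)%R%:R - (f x < 0)%R%:R); last first.
  apply/funext => x; case: (ltgtP (f x) 0) => [fx|fx|->].
  - by rewrite ltr0_sg// sub0r.
  - by rewrite gtr0_sg// subr0.
  - by rewrite sgr0 subrr.
have mi (b : T -> bool) : measurable_fun setT b ->
    measurable_fun setT (fun x => (b x)%:R : R).
  move=> mb; rewrite (_ : (fun _ => _) = \1_[set x | b x]).
    apply: measurable_indic; rewrite -[X in measurable X]setTI.
    exact: (mb measurableT [set true]).
  by apply/funext => x; rewrite indicE; congr (_%:R); rewrite mem_setE.
by apply: measurable_funB; apply: mi; apply: measurable_fun_ltr.
Qed.

Lemma norm_le_psum r D N sigma : 1 <= r ->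
  (forall i, (i < N)%N -> norm_le mu r (D i) sigma) ->
  forall k, (k <= N)%N -> norm_le mu r (psum D k) (k%:R * sigma).
Proof.
move=> r1 H; elim=> [_|k IH kN].
  rewrite mul0r; apply: (@norm_le_eq _ _ _ _ _ _ (fun=> 0)).
    by move=> x; rewrite /psum big_ord0.
  by apply: norm_le0; lra.
rewrite -natr1 mulrDl mul1r; apply: (@norm_le_eq _ _ _ _ _ _ _ _ (psumS D k)).
by apply: (norm_leD r1); [apply: IH; exact: ltnW|exact: H].
Qed.

Lemma norm_le_signed r (f : T -> R) a : 1 < r -> norm_le mu r f a ->
  norm_le mu (r / (r - 1)) (fun x => signed_powR (r - 1) (f x)) (a `^ (r - 1)).
Proof.
move=> r1 nf; have rm : 0 < r - 1 by lra.
apply: norm_le_dom (norm_le_powR rm nf).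
- by apply: measurable_signed_powR; have [] := nf.
- by apply: divr_gt0; lra.
- by move=> x; rewrite [leRHS]ger0_norm ?powR_ge0//; exact: normr_signed_powR.
Qed.

Lemma martingale_diff_signed0 r D N sigma : 1 < r -> martingale_diff r D ->
  (forall i, (i < N)%N -> norm_le mu r (D i) sigma) -> forall k, (k < N)%N ->
  mu.-integrable setT (EFin \o
    (fun x => signed_powR (r - 1) (psum D k x) * D k x)) /\
  \int[mu]_x (signed_powR (r - 1) (psum D k x) * D k x) = 0.
Proof.
move=> r1 mD H k kN; have r0 : 0 < r by lra.
have nM := norm_le_psum (ltW r1) H (ltnW kN).
have nS := norm_le_signed r1 nM.
have HI : mu.-integrable setT (EFin \o
    (fun x => signed_powR (r - 1) (psum D k x) * D k x)).
  apply: (norm_le_integrable (lexx 1)).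
  apply: norm_le_hoelder nS (H k kN) => //; first by apply: divr_gt0; lra.
  by field; lra.
by split => //; apply: (mD _ _ _ nS) => x y /psum_past ->.
Qed.

Lemma powR_nat_succ s k : 1 < s ->
  k%:R `^ s + k%:R `^ (s - 1) <= k.+1%:R `^ s :> R.
Proof.
move=> s1; have s0 : 0 < s by lra.
rewrite -(@mulr_powRB1 _ k%:R s)// -(@mulr_powRB1 _ k.+1%:R s)// -{2}[_ `^ _]mul1r.
rewrite -mulrDl natr1 ler_wpM2l// ge0_ler_powR ?nnegrE ?ler_nat//; lra.
Qed.

Lemma Rint_powR_le r (f : T -> R) a : 0 < r -> norm_le mu r f a ->
  mu.-integrable setT (EFin \o (fun x => `|f x| `^ r)) /\
  \int[mu]_x (`|f x| `^ r) <= a `^ r.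
Proof.
move=> r0 nf; have := norm_le_powR r0 nf; rewrite divff ?gt_eqF// => nf1.
split; first exact: norm_le_integrable nf1.
by apply: le_trans (norm_le_Rintegral (lexx 1) nf1); exact: ler_norm.
Qed.

Lemma norm_leR r (f : T -> R) a : 0 < r -> measurable_fun setT f -> 0 <= a ->
  mu.-integrable setT (EFin \o (fun x => `|f x| `^ r)) ->
  \int[mu]_x (`|f x| `^ r) <= a `^ r -> norm_le mu r f a.
Proof.
move=> r0 mf a0 fi H; split; [exact: mf|exact: a0|].
rewrite -[leLHS]fineK; first by rewrite lee_fin.
exact: integrable_fin_num fi.
Qed.

(** For 1 < r <= 2 the cross term r sgn(M_k)|M_k|^(r-1) D_k has mean zero, so
    that E|M_k|^r grows at most linearly. *)
Lemma martingale_moment_le2 r D N sigma : 1 < r <= 2 -> martingale_diff r D ->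
  (forall i, (i < N)%N -> norm_le mu r (D i) sigma) -> forall k, (k <= N)%N ->
  norm_le mu r (psum D k) (2 * r * (k%:R `^ r^-1 * sigma)).
Proof.
move=> /andP[r1 r2] mD H.
have r0 : 0 < r by lra.
have r20 : 0 <= 2 * r by lra.
have r12 : 1 < r <= 2 by rewrite r1 r2.
have [N0|N0] := posnP N.
  move=> k; rewrite N0 leqn0 => /eqP ->.
  by rewrite powR0 ?invr_neq0 ?gt_eqF// mul0r mulr0 -(mul0r sigma);
    apply: (norm_le_psum (ltW r1) H).
have s0 : 0 <= sigma by have [] := H 0%N N0.
suff S' k : (k <= N)%N -> \int[mu]_x (`|psum D k x| `^ r) <= 2 * r * k%:R * sigma `^ r.
  move=> k kN; have nM := norm_le_psum (ltW r1) H kN.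
  have [M1 _] := Rint_powR_le r0 nM.
  apply: norm_leR => //; first by have [] := nM.
    by rewrite !mulr_ge0 ?powR_ge0// ltW.
  apply: (le_trans (S' k kN)).
  rewrite powRM ?mulr_ge0 ?powR_ge0//; last lra.
  rewrite (powRM _ (powR_ge0 _ _) s0) -(powRrM k%:R) mulVf ?gt_eqF// powRr1// mulrA.
  rewrite ler_wpM2r ?powR_ge0// ler_wpM2r//.
  by apply: le1r_powR; nra.
elim: k => [_|k IH kN].
  rewrite mulr0 mul0r; under eq_Rintegral do rewrite /psum big_ord0 normr0 powR0 ?gt_eqF//.
  by rewrite Rintegral_cst// mul0r.
have [i1 _] := Rint_powR_le r0 (norm_le_psum (ltW r1) H (ltnW kN)).
have [i1' _] := Rint_powR_le r0 (norm_le_psum (ltW r1) H kN).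
have [i2 z2] := martingale_diff_signed0 r1 mD H kN.
have [i3 l3] := Rint_powR_le r0 (H k kN).
have i2' := integrableZl measurableT r i2.
have i3' := integrableZl measurableT (2 * r) i3.
have i12 := integrableD measurableT i1 i2'.
have i123 := integrableD measurableT i12 i3'.
have := le_Rintegral measurableT i1' i123.
rewrite (RintegralD measurableT i12 i3') (RintegralD measurableT i1 i2').
rewrite (RintegralZl r measurableT i2) (RintegralZl (2 * r) measurableT i3).
rewrite z2 mulr0 addr0.
have IHk := IH (ltnW kN).
have l3' : 2 * r * \int[mu]_x `|D k x| `^ r <= 2 * r * sigma `^ r.
  exact: ler_wpM2l.
have L : forall x, [set: T] x ->
  `|psum D k.+1 x| `^ r <= `|psum D k x| `^ r + r * (signed_powR (r - 1) (psum D k x) * D k x)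
     + 2 * r * `|D k x| `^ r.
  by move=> x _; rewrite psumS (mulrA r); exact: two_point_le2.
move=> /(_ L) /le_trans; apply; apply: (le_trans (lerD IHk l3')).
by rewrite -[k.+1%:R]natr1 mulrDr mulrDl mulr1.
Qed.

(** Hoelder's inequality bounds the mean of the mixed term by
    sigma^2 ||M_k||^(r-2), so that the bound K sqrt(k) sigma on ||M_k||
    propagates from k to k + 1 once K is large enough. *)
Lemma martingale_moment_gt2 r : 2 < r -> exists2 C, 0 < C &
  forall D N sigma, martingale_diff r D ->
  (forall i, (i < N)%N -> norm_le mu r (D i) sigma) -> forall k, (k <= N)%N ->
  norm_le mu r (psum D k) (C * (k%:R `^ 2^-1 * sigma)).
Proof.
move=> r2; have r0 : 0 < r by lra.
have r1 : 1 < r by lra.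
have rm2 : 0 < r - 2 by lra.
have rr2 : 0 < r / (r - 2) by exact: divr_gt0.
have r20 : 0 < r / 2 by lra.
have r21 : 1 < r / 2 by lra.
have rc : (r / (r - 2))^-1 + (r / 2)^-1 = 1 by field; lra.
have re : (r - 2) / 2 = r / 2 - 1 by field.
have rn : r / 2 != 0 by lra.
have rn1 : r / 2 - 1 != 0 by lra.
have [C0 C00 L] : exists2 C0, 0 < C0 & forall x y, `|x + y| `^ r <=
    `|x| `^ r + r * signed_powR (r - 1) x * y +
    C0 * (`|x| `^ (r - 2) * `|y| ^+ 2 + `|y| `^ r).
  exists (r * (r - 1) * 2 `^ (r - 2)); last by move=> x y; exact: two_point_gt2.
  by rewrite pmulr_lgt0 ?powR_gt0//; nra.
(* K^r = K^2 K^(r-2) dominates C0 (K^(r-2) + 1) because K >= 1, K >= 2 C0. *)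
have [K K1 KE] : exists2 K, 1 < K & C0 * (K `^ (r - 2) + 1) <= K `^ r.
  exists (2 * C0 + 1); first lra.
  set K := 2 * C0 + 1; have KE : K = 2 * C0 + 1 by [].
  move: K KE => K KE.
  have K1 : 1 < K by lra.
  have P1 : 1 <= K `^ (r - 2) by rewrite -[leLHS](powRr0 K) ler_powR//; lra.
  have -> : K `^ r = K ^+ 2 * K `^ (r - 2).
    rewrite -powR_mulrn; last lra.
    rewrite -powRD; first by congr (_ `^ _); ring.
    by apply/implyP => /eqP; lra.
  have : 2 * C0 <= K ^+ 2 by nra.
  nra.
have K0 : 0 <= K by lra.
exists K; first exact: lt_trans K1.
move=> D N sigma mD H.
have [N0|N0] := posnP N.
  move=> k; rewrite N0 leqn0 => /eqP ->.
  by rewrite powR0 ?invr_neq0 ?gt_eqF// mul0r mulr0 -(mul0r sigma);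
    apply: (norm_le_psum (ltW r1) H).
have s0 : 0 <= sigma by have [] := H 0%N N0.
have B0 k : 0 <= K * (k%:R `^ 2^-1 * sigma).
  by rewrite !mulr_ge0 ?powR_ge0.
have BE k t : (K * (k%:R `^ 2^-1 * sigma)) `^ t = K `^ t * (k%:R `^ (t / 2) * sigma `^ t).
  rewrite (powRM _ K0 (mulr_ge0 (powR_ge0 _ _) s0)) (powRM _ (powR_ge0 _ _) s0).
  by rewrite -(powRrM k%:R) [t / 2]mulrC.
elim=> [_|k IH kN].
  by rewrite powR0 ?invr_neq0 ?gt_eqF// mul0r mulr0 -(mul0r sigma);
    apply: (norm_le_psum (ltW r1) H).
have nk := IH (ltnW kN).
have [i1 l1] := Rint_powR_le r0 nk.
have nk' := norm_le_psum (ltW r1) H kN.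
have [i1' _] := Rint_powR_le r0 nk'.
have [i2 z2] := martingale_diff_signed0 r1 mD H kN.
have [i3 l3] := Rint_powR_le r0 (H k kN).
have [i4 l4] : mu.-integrable setT (EFin \o
    (fun x => `|psum D k x| `^ (r - 2) * `|D k x| ^+ 2)) /\
    \int[mu]_x (`|psum D k x| `^ (r - 2) * `|D k x| ^+ 2) <=
    (K * (k%:R `^ 2^-1 * sigma)) `^ (r - 2) * sigma `^ 2.
  have n1 : norm_le mu (r / (r - 2)) (fun x => `|psum D k x| `^ (r - 2))
      ((K * (k%:R `^ 2^-1 * sigma)) `^ (r - 2)) by exact: norm_le_powR.
  have n2 : norm_le mu (r / 2) (fun x => `|D k x| ^+ 2) (sigma `^ 2).
    apply: (@norm_le_eq _ _ _ _ _ _ (fun x => `|D k x| `^ 2)).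
      by move=> x; rewrite powR_mulrn.
    exact: norm_le_powR (H k kN).
  have n3 : norm_le mu 1 (fun x => `|psum D k x| `^ (r - 2) * `|D k x| ^+ 2)
      ((K * (k%:R `^ 2^-1 * sigma)) `^ (r - 2) * sigma `^ 2).
    exact: norm_le_hoelder n1 n2.
  split; first exact: norm_le_integrable n3.
  by apply: le_trans (norm_le_Rintegral (lexx 1) n3); exact: ler_norm.
apply: (norm_leR r0 (norm_le_measurable nk') (B0 _) i1').
have i2' := integrableZl measurableT r i2.
have i12 := integrableD measurableT i1 i2'.
have i43 := integrableD measurableT i4 i3.
have i43' := integrableZl measurableT C0 i43.
have i123 := integrableD measurableT i12 i43'.
have := le_Rintegral measurableT i1' i123.
rewrite (RintegralD measurableT i12 i43') (RintegralD measurableT i1 i2').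
rewrite (RintegralZl r measurableT i2) (RintegralZl C0 measurableT i43).
rewrite (RintegralD measurableT i4 i3) z2 mulr0 addr0.
have L' : forall x, [set: T] x ->
  `|psum D k.+1 x| `^ r <= `|psum D k x| `^ r + r * (signed_powR (r - 1) (psum D k x) * D k x)
     + C0 * (`|psum D k x| `^ (r - 2) * `|D k x| ^+ 2 + `|D k x| `^ r).
  by move=> x _; rewrite psumS (mulrA r); exact: L.
move=> /(_ L') /le_trans; apply.
have l5 : C0 * (\int[mu]_x (`|psum D k x| `^ (r - 2) * `|D k x| ^+ 2) +
                \int[mu]_x `|D k x| `^ r) <=
  C0 * ((K * (k%:R `^ 2^-1 * sigma)) `^ (r - 2) * sigma `^ 2 + sigma `^ r).
  by rewrite ler_pM2l//; exact: lerD.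
apply: (le_trans (lerD l1 l5)); rewrite !BE.
have -> : K `^ (r - 2) * (k%:R `^ ((r - 2) / 2) * sigma `^ (r - 2)) * sigma `^ 2 =
   K `^ (r - 2) * k%:R `^ (r / 2 - 1) * sigma `^ r.
  rewrite re.
  have -> : sigma `^ r = sigma `^ (r - 2) * sigma `^ 2.
    by rewrite -powRD ?subrK// (gt_eqF r0).
  by ring.
set S := sigma `^ r; set a := k%:R `^ (r / 2); set b := k%:R `^ (r / 2 - 1).
have -> : K `^ r * (a * S) + C0 * (K `^ (r - 2) * b * S + S) =
  (K `^ r * a + C0 * (K `^ (r - 2) * b + 1)) * S by ring.
rewrite (mulrA (K `^ r)) ler_wpM2r ?powR_ge0//.
have [k0|k0] := posnP k.
  rewrite /a /b k0 !powR0//.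
  rewrite !mulr0 !add0r powR1 !mulr1; apply: le_trans KE.
  by rewrite ler_peMr ?lerDr ?powR_ge0// ltW.
have b1 : 1 <= b.
  by rewrite -[leLHS](powRr0 k%:R) ler_powR ?ler1n// subr_ge0 ltW.
apply: le_trans (ler_wpM2l (powR_ge0 _ _) (powR_nat_succ k r21)).
rewrite -/a -/b [leRHS]mulrDr lerD2l.
have : C0 * (K `^ (r - 2) * b + 1) <= C0 * (K `^ (r - 2) + 1) * b.
  by rewrite -mulrA ler_pM2l// mulrDl mul1r lerD2l.
move=> /le_trans; apply.
by rewrite ler_wpM2r// powR_ge0.
Qed.

(** The square root rate holds only when second moments are available; below
    that the exponent is 1/r. *)
Lemma martingale_moment r : 1 < r -> exists2 C, 0 < C &
  forall D N sigma, martingale_diff r D ->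
  (forall i, (i < N)%N -> norm_le mu r (D i) sigma) ->
  norm_le mu r (psum D N) (C * (N%:R `^ Num.max 2^-1 r^-1 * sigma)).
Proof.
move=> r1; have [r2|r2] := leP r 2.
  exists (2 * r); first lra.
  move=> D N sigma mD H.
  rewrite (max_idPr _); last by rewrite lef_pV2// posrE; lra.
  by apply: (martingale_moment_le2 _ mD H) => //; lra.
have [C C0 HC] := martingale_moment_gt2 r2; exists C => // D N sigma mD H.
rewrite (max_idPl _); last by rewrite lef_pV2 ?posrE//; lra.
exact: (HC _ _ _ mD H).
Qed.

End martingales.

(** * Maximal inequality for martingales *)

Section doob.
Context {d : measure_display} {T : measurableType d} {R : realType}.
Variable mu : probability T R.
Implicit Types (D : nat -> T -> R) (r c sigma : R).

Definition runmax D n x : R := \big[Num.max/0]_(0 <= i < n.+1) `|psum D i x|.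

Lemma runmax_ge0 D n x : 0 <= runmax D n x.
Proof. by rewrite /runmax; elim/big_ind: _ => // a b a0 b0; rewrite le_max a0. Qed.

Lemma runmax0 D x : runmax D 0 x = 0.
Proof. by rewrite /runmax big_nat_recl// big_geq// /psum big_ord0 normr0 maxxx. Qed.

Lemma runmaxS D n x : runmax D n.+1 x = Num.max (runmax D n x) `|psum D n.+1 x|.
Proof.
rewrite /runmax /index_iota !subn0 -[n.+2]addn1 iotaD cats1 add0n.
elim: (iota 0 n.+1) => [|i l IH] /=; first by rewrite big_cons !big_nil maxC.
by rewrite !big_cons IH maxA.
Qed.

(** With u = s^(r-1), the increment of s^r at a new maximum y is at most
    r/(r-1) y times the increment of u, by the tangent inequality. *)
Lemma powR_max_increment r s y : 1 < r -> 0 <= s -> 0 <= y ->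
  (Num.max s y) `^ r <=
  s `^ r + r / (r - 1) * (y * ((Num.max s y) `^ (r - 1) - s `^ (r - 1))).
Proof.
move=> r1 s0 y0; have r0 : 0 < r by lra.
have [sy|_] := leP s y; last by rewrite subrr !mulr0 addr0.
have H := young_tangent r1 s0 y0.
rewrite mulrBr mulr_powRB1//.
have rm : 0 < r - 1 by lra.
rewrite -(ler_pM2l rm) mulrDr mulrA (mulrCA (r - 1)) divff ?mulr1 ?gt_eqF//.
by rewrite mulrBr (mulrC y); nra.
Qed.

(** The pathwise form of Doob's inequality: summing the previous bound by parts
    leaves a martingale transform of D. *)
Lemma runmax_pathwise r D n x : 1 < r ->
  runmax D n x `^ r <= r / (r - 1) *
    (`|psum D n x| * runmax D n x `^ (r - 1) -
     \sum_(k < n) runmax D k x `^ (r - 1) * Num.sg (psum D k x) * D k x).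
Proof.
move=> r1; have r0 : 0 < r by lra. 
have rm : 0 < r - 1 by lra.
have c0 : 0 < r / (r - 1) by exact: divr_gt0.
elim: n => [|n IH].
  by rewrite runmax0 big_ord0 /psum big_ord0 normr0 powR0 ?gt_eqF// mul0r subrr mulr0.
have H := powR_max_increment r1 (runmax_ge0 D n x) (normr_ge0 (psum D n.+1 x)).
rewrite -runmaxS in H; apply: (le_trans H); move: {H} IH.
rewrite -(lerD2r (r / (r - 1) * (`|psum D n.+1 x| *
  (runmax D n.+1 x `^ (r - 1) - runmax D n x `^ (r - 1))))) => /le_trans; apply.
rewrite -mulrDr ler_pM2l// big_ord_recr/=.
have G : runmax D n x `^ (r - 1) * Num.sg (psum D n x) * D n x <=
  runmax D n x `^ (r - 1) * (`|psum D n.+1 x| - `|psum D n x|).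
  rewrite -mulrA ler_wpM2l ?powR_ge0// lerBrDr (normrEsg (psum D n x)) -mulrDr.
  rewrite addrC -psumS (le_trans (ler_norm _))// normrM ler_piMl//.
  by rewrite normr_sg lern1 leq_b1.
by move: G; rewrite !mulrBr; nra.
Qed.

Lemma runmax_past D n x y : (forall i, (i < n)%N -> D i x = D i y) ->
  runmax D n x = runmax D n y.
Proof.
move=> H; apply: eq_big_nat => i /andP[_ ilt].
by rewrite (psum_past H).
Qed.

Lemma norm_le_runmax r D N sigma : 1 <= r ->
  (forall i, (i < N)%N -> norm_le mu r (D i) sigma) -> forall k, (k <= N)%N ->
  exists c, norm_le mu r (runmax D k) c.
Proof.
move=> r1 H k kN; eexists; apply: norm_le_max; first by lra.
move=> i; rewrite mem_index_iota => /andP[_ ik].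
by apply: (norm_le_psum r1 H); apply: leq_trans kN.
Qed.

(** The martingale transform has mean zero, and Hoelder's inequality leaves
    Z^r <= r/(r-1) c Z^(r-1) for the norm Z of the maximum. *)
Lemma doob r D N sigma c : 1 < r -> martingale_diff mu r D ->
  (forall i, (i < N)%N -> norm_le mu r (D i) sigma) ->
  norm_le mu r (psum D N) c -> norm_le mu r (runmax D N) (r / (r - 1) * c).
Proof.
move=> r1 mD H nM; have r0 : 0 < r by lra.
have rm : 0 < r - 1 by lra.
have rr0 : 0 < r / (r - 1) by exact: divr_gt0.
have rc : r^-1 + (r / (r - 1))^-1 = 1 by field; lra.
have cc : (r / (r - 1))^-1 + r^-1 = 1 by rewrite addrC.
have rn : r != 0 by rewrite gt_eqF.
have [c' nc'] := norm_le_runmax (ltW r1) H (leqnn N).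
have c0 : 0 <= c by have [] := nM.
have [i1 _] := Rint_powR_le r0 nc'.
have E0 : 0 <= \int[mu]_x (`|runmax D N x| `^ r).
  by apply: Rintegral_ge0 => x _; exact: powR_ge0.
set Z := (\int[mu]_x (`|runmax D N x| `^ r)) `^ r^-1.
have Z0 : 0 <= Z by exact: powR_ge0.
have Zr : Z `^ r = \int[mu]_x (`|runmax D N x| `^ r).
  by rewrite /Z -powRrM mulVf// powRr1.
have nZ : norm_le mu r (runmax D N) Z.
  by apply: (norm_leR r0 (norm_le_measurable nc') Z0 i1); rewrite Zr.
suff ZC : Z <= r / (r - 1) * c by exact: norm_leW ZC nZ.
have nZ1 : norm_le mu (r / (r - 1)) (fun x => runmax D N x `^ (r - 1)) (Z `^ (r - 1)).
  apply: norm_le_eq (norm_le_powR rm nZ) => x.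
  by rewrite (ger0_norm (runmax_ge0 _ _ _)).
have n1 := norm_le_hoelder r0 rr0 rc (norm_le_abs nM) nZ1.
have i2 := norm_le_integrable (lexx 1) n1.
have l2 := le_trans (ler_norm _) (norm_le_Rintegral (lexx 1) n1).
pose F k x := runmax D k x `^ (r - 1) * Num.sg (psum D k x) * D k x.
have FI k : (k < N)%N -> mu.-integrable setT (EFin \o F k) /\ \int[mu]_x F k x = 0.
  move=> kN; have [ck nk] := norm_le_runmax (ltW r1) H (ltnW kN).
  have nk1 := norm_le_powR rm nk.
  have mS : measurable_fun setT (fun x => Num.sg (psum D k x)).
    have := measurable_signed_powR 0 (norm_le_measurable (norm_le_psum (ltW r1) H (ltnW kN))).
    congr measurable_fun; apply/funext => x.
    by rewrite /signed_powR powRr0 mulr1.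
  have mRS : measurable_fun setT (fun x => runmax D k x `^ (r - 1) * Num.sg (psum D k x)).
    apply: measurable_funM => //.
    have := norm_le_measurable nk1; congr measurable_fun; apply/funext => x.
    by rewrite (ger0_norm (runmax_ge0 _ _ _)).
  have nk2 : norm_le mu (r / (r - 1))
      (fun x => runmax D k x `^ (r - 1) * Num.sg (psum D k x)) (ck `^ (r - 1)).
    apply: (norm_le_dom mRS rr0 _ nk1) => x.
    rewrite (ger0_norm (runmax_ge0 _ _ _)) normrM ler_piMr//.
    by rewrite normr_sg lern1 leq_b1.
  have nF := norm_le_hoelder rr0 r0 cc nk2 (H k kN).
  have iF := norm_le_integrable (lexx 1) nF.
  split; first exact: iF.
  by apply: (mD _ _ _ nk2) => x y xy; rewrite (runmax_past xy) (psum_past xy).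
have [iS eS] := Rintegral_sum_ord (fun k kN => (FI k kN).1).
have zS : \int[mu]_x \sum_(k < N) F k x = 0.
  by rewrite eS big1// => k _; have [] := FI k (ltn_ord k).
have i3 := integrableB measurableT i2 iS.
have i3' := integrableZl measurableT (r / (r - 1)) i3.
have PW : forall x, [set: T] x -> `|runmax D N x| `^ r <= r / (r - 1) *
    (`|psum D N x| * runmax D N x `^ (r - 1) - \sum_(k < N) F k x).
  by move=> x _; rewrite (ger0_norm (runmax_ge0 _ _ _)); exact: runmax_pathwise.
have := le_Rintegral measurableT i1 i3' PW.
rewrite (RintegralZl _ measurableT i3) (RintegralB measurableT i2 iS) zS subr0 -Zr.
move=> Zle; have {Zle} : Z `^ r <= r / (r - 1) * (c * Z `^ (r - 1)).
  by apply: (le_trans Zle); rewrite ler_pM2l.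
have [->|Zn] := eqVneq Z 0; first by rewrite mulr_ge0// ltW.
have Zp : 0 < Z by rewrite lt_def Zn.
by rewrite -(mulr_powRB1 Z0 r0) mulrA ler_pM2r// powR_gt0.
Qed.

(** The constant depends on r only, so that the bound can be summed over the
    lags of a projective decomposition. *)
Lemma martingale_max r : 1 < r -> exists2 C, 0 < C &
  forall D N sigma, martingale_diff mu r D ->
  (forall i, (i < N)%N -> norm_le mu r (D i) sigma) ->
  norm_le mu r (runmax D N) (C * (N%:R `^ Num.max 2^-1 r^-1 * sigma)).
Proof.
move=> r1; have [C C0 HC] := martingale_moment mu r1.
have rr0 : 0 < r / (r - 1) by apply: divr_gt0; lra.
exists (r / (r - 1) * C); first exact: mulr_gt0.
move=> D N sigma mD H; rewrite -(mulrA (r / (r - 1))).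
exact: doob r1 mD H (HC _ _ _ mD H).
Qed.

End doob.

(** * Two independent copies of the innovations *)

Notation prod_space I E :=
  (g_sigma_algebraType
     (process_events setT (fun (i : I) (x : I -> E) => x i))).

Section product_space.
Context {d d' : measure_display} {T : measurableType d} {E : measurableType d'}.

Lemma measurable_coord (I : Type) (i : I) :
  measurable_fun setT (fun x : prod_space I E => x i).
Proof.
move=> _ A mA; apply: sub_sigma_algebra; exists i => //.
by exists A.
Qed.

Lemma measurable_to_prod (I : Type) (f : T -> prod_space I E) :
  (forall i, measurable_fun setT (fun w => f w i)) -> measurable_fun setT f.
Proof.
move=> mf.
apply: (@measurability _ _ _ (prod_space I E) setT f
  (process_events setT (fun (i : I) (x : I -> E) => x i)) erefl).
move=> _ [B [i _ [A mA <-]] <-]; rewrite !setTI.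
by have := mf i measurableT A mA; rewrite setTI.
Qed.

End product_space.

Section mixing.
Context {d' : measure_display} {E : measurableType d'} {R : realType}.
Notation S := (prod_space int E).
Implicit Types (B : int -> bool) (x y : S).

Definition mix B x y : S := fun i => if B i then x i else y i.

Definition mix_pair B (z : S * S) : S * S := (mix B z.1 z.2, mix B z.2 z.1).

Definition depends_on B (f : S -> R) : Prop :=
  forall x y, (forall i, B i -> x i = y i) -> f x = f y.

Lemma measurable_mix B : measurable_fun setT (fun z : S * S => mix B z.1 z.2).
Proof.
apply: measurable_to_prod => i; rewrite /mix; case: (B i).
  exact: measurableT_comp (measurable_coord i) measurable_fst.
exact: measurableT_comp (measurable_coord i) measurable_snd.
Qed.

Lemma measurable_mix_swap B : measurable_fun setT (fun z : S * S => mix B z.2 z.1).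
Proof.
apply: measurable_to_prod => i; rewrite /mix; case: (B i).
  exact: measurableT_comp (measurable_coord i) measurable_snd.
exact: measurableT_comp (measurable_coord i) measurable_fst.
Qed.

Lemma measurable_mix_pair B : measurable_fun setT (mix_pair B).
Proof. by apply/measurable_fun_pair; [exact: measurable_mix|exact: measurable_mix_swap]. Qed.

Lemma depends_on_mixl B f x y : depends_on B f -> f (mix B x y) = f x.
Proof. by apply => i Bi; rewrite /mix Bi. Qed.

Lemma mix_pred0 x y : mix pred0 x y = y.
Proof. by []. Qed.

Lemma sub_depends_on B B' f : (forall i, B i -> B' i) ->
  depends_on B f -> depends_on B' f.
Proof. by move=> BB' fB x y xy; apply: fB => i /BB'; exact: xy. Qed.

Variable nu : probability S R.

(** Two independent copies of an i.i.d. sequence may be exchanged on any set of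
    coordinates: the form in which the i.i.d. assumption enters. *)
Definition mix_invariant := forall B (F : S * S -> \bar R),
  measurable_fun setT F -> (forall z, 0 <= F z)%E ->
  (\int[nu \x nu]_z F (mix_pair B z) = \int[nu \x nu]_z F z)%E.

Hypothesis inv : mix_invariant.
Implicit Types (f g h : S -> R) (r c : R).

Lemma norm_le_mix_pair B r (F : S * S -> R) c :
  norm_le (nu \x nu)%E r F c -> norm_le (nu \x nu)%E r (F \o mix_pair B) c.
Proof.
move=> [mF c0 H]; split; [|exact: c0|].
  exact: measurableT_comp mF (measurable_mix_pair B).
rewrite (inv B (F := fun z => (`|F z| `^ r)%:E))//.
exact: measurable_EFin_powR.
Qed.

Lemma norm_le_fst r f c :
  norm_le nu r f c <-> norm_le (nu \x nu)%E r (fun z => f z.1) c.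
Proof.
have H : measurable_fun setT f ->
    (\int[nu \x nu]_z (`|f z.1| `^ r)%:E = \int[nu]_x (`|f x| `^ r)%:E)%E.
  move=> mf; rewrite fubini_tonelli1//; last 1 first.
  - by apply: (measurable_EFin_powR r (f := fun z : S * S => f z.1)); exact: measurableT_comp.
  rewrite /fubini_F/=; apply: eq_integral => x _.
  by rewrite integral_cst//= probability_setT mule1.
split=> -[mf c0 Hc].
  by split; [exact: measurableT_comp|exact: c0|rewrite H].
have mf' : measurable_fun setT f.
  by apply: (measurableT_comp (g := fun x => (x, x)) mf); exact: measurable_fun_pair.
by split; [exact: mf'|exact: c0|rewrite -H].
Qed.

Lemma norm_le_mix B r f c : norm_le nu r f c ->
  norm_le (nu \x nu)%E r (fun z => f (mix B z.1 z.2)) c.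
Proof. by move=> /norm_le_fst; exact: norm_le_mix_pair. Qed.

Lemma integrable_mix B f : nu.-integrable setT (EFin \o f) ->
  (nu \x nu)%E.-integrable setT (fun z => (f (mix B z.1 z.2))%:E).
Proof.
move=> /integrableP[/measurable_EFinP mf H]; apply/integrableP; split.
  apply/measurable_EFinP; exact: measurableT_comp mf (measurable_mix B).
have n1 : norm_le nu 1 f (fine (\int[nu]_x `|(f x)%:E|)%E).
  split; [exact: mf|by apply: fine_ge0; exact: integral_ge0|].
  rewrite powRr1; last by apply: fine_ge0; exact: integral_ge0.
  rewrite fineK ?ge0_fin_numE//; last exact: integral_ge0.
  by under eq_integral do rewrite powRr1//.
have [_ _] := norm_le_mix B n1.
under eq_integral do rewrite powRr1//.
by move=> /le_lt_trans; apply; exact: ltry.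
Qed.

Lemma Rintegral_mix B f : nu.-integrable setT (EFin \o f) ->
  \int[(nu \x nu)%E]_z f (mix B z.1 z.2) = \int[nu]_x f x.
Proof.
move=> fi; have /integrableP[/measurable_EFinP mf _] := fi.
have G (g : S -> \bar R) : measurable_fun setT g -> (forall x, 0 <= g x)%E ->
    (\int[nu \x nu]_z g (mix B z.1 z.2) = \int[nu]_x g x)%E.
  move=> mg g0.
  rewrite (inv B (F := fun z => g z.1))//; last exact: measurableT_comp.
  rewrite fubini_tonelli1//; last exact: measurableT_comp.
  rewrite /fubini_F/=; apply: eq_integral => x _.
  by rewrite integral_cst//= probability_setT mule1.
congr fine; rewrite integralE [RHS]integralE; congr (_ - _)%E.
  rewrite -(G (EFin \o f)^\+%E)//; last exact/measurable_funepos/measurable_EFinP.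
  by apply: eq_integral => z _; rewrite !funeposE.
rewrite -(G (EFin \o f)^\-%E)//; last exact/measurable_funeneg/measurable_EFinP.
by apply: eq_integral => z _; rewrite !funenegE.
Qed.

(** Averaging over the coordinates outside B: a version of the conditional
    expectation given the coordinates in B that is defined everywhere. *)
Definition cond_mean B f x : R := \int[nu]_y f (mix B x y).

Lemma cond_mean_depends_on B f : depends_on B (cond_mean B f).
Proof.
move=> x x' xx'; apply: eq_Rintegral => y _; congr f.
by apply/funext => i; rewrite /mix; case: ifPn => // /xx'.
Qed.

Lemma cond_mean_id B f : depends_on B f -> cond_mean B f = f.
Proof.
move=> fB; apply/funext => x; rewrite /cond_mean.
under eq_Rintegral do rewrite depends_on_mixl//.
rewrite Rintegral_cst// (_ : fine (nu setT) = 1) ?mulr1//.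
by rewrite probability_setT.
Qed.

Lemma cond_mean_pred0 f x : cond_mean pred0 f x = \int[nu]_y f y.
Proof. by []. Qed.

Lemma measurable_cond_mean B f : nu.-integrable setT (EFin \o f) ->
  measurable_fun setT (cond_mean B f).
Proof.
move=> fi; apply: measurableT_comp; first exact: fine_measurable.
exact: (measurable_fubini_F (integrable_mix B fi)).
Qed.

(** Jensen's inequality, applied on almost every fibre. *)
Lemma norm_le_fubini r (G : S * S -> R) g c : 1 <= r ->
  measurable_fun setT g ->
  {ae nu, forall x, `|g x| <= `|\int[nu]_y G (x, y)|} ->
  norm_le (nu \x nu)%E r G c -> norm_le nu r g c.
Proof.
move=> r1 mg gG [mG c0 H]; have r0 : 0 < r by lra.
have mG1 x : measurable_fun setT (fun y => G (x, y)) by exact: measurableT_comp.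
pose F z := (`|G z| `^ r)%:E.
have mF : measurable_fun setT F by exact: measurable_EFin_powR.
have F0 z : (0 <= F z)%E by rewrite lee_fin powR_ge0.
move: H; rewrite (fubini_tonelli1 F mF F0) => H.
split; [exact: mg|exact: c0|apply: le_trans H].
apply: (ae_ge0_le_integral measurableT).
- by move=> x _; rewrite lee_fin powR_ge0.
- exact: measurable_EFin_powR.
- by move=> x _; apply: integral_ge0 => y _; exact: F0.
- exact: measurable_fun_fubini_tonelli_F.
apply: filterS gG => x gx _; rewrite /fubini_F.
have [I0|] := boolP ((\int[nu]_y F (x, y))%E \is a fin_num); last first.
  rewrite ge0_fin_numE; last by apply: integral_ge0 => y _; exact: F0.
  by rewrite -leNgt leye_eq => /eqP ->; exact: leey.
have J0 : 0 <= fine (\int[nu]_y F (x, y))%E.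
  by apply: fine_ge0; apply: integral_ge0 => y _; exact: F0.
have nG : norm_le nu r (fun y => G (x, y)) (fine (\int[nu]_y F (x, y))%E `^ r^-1).
  split; [exact: mG1|exact: powR_ge0|].
  by rewrite -powRrM mulVf ?gt_eqF// powRr1// fineK.
rewrite -(fineK I0) lee_fin.
have := le_trans gx (norm_le_Rintegral r1 nG) => le1.
have : `|g x| `^ r <= (fine (\int[nu]_y F (x, y))%E `^ r^-1) `^ r.
  by apply: ge0_ler_powR; rewrite ?nnegrE ?powR_ge0// ltW.
by rewrite -powRrM mulVf ?gt_eqF// powRr1.
Qed.

Lemma norm_le_cond_meanB B B' r f c : 1 <= r ->
  nu.-integrable setT (EFin \o f) ->
  norm_le (nu \x nu)%E r (fun z => f (mix B z.1 z.2) - f (mix B' z.1 z.2)) c ->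
  norm_le nu r (fun x => cond_mean B f x - cond_mean B' f x) c.
Proof.
move=> r1 fi; apply: norm_le_fubini => //.
  by apply: measurable_funB; exact: measurable_cond_mean.
have h := ae_integrable1 (integrable_mix B fi).
have h' := ae_integrable1 (integrable_mix B' fi).
apply: filterS2 h h' => x h h' /=.
by rewrite (RintegralB measurableT h h').
Qed.

Lemma norm_le_cond_mean B r f c : 1 <= r -> norm_le nu r f c ->
  norm_le nu r (cond_mean B f) c.
Proof.
move=> r1 nf; have fi := norm_le_integrable r1 nf.
apply: norm_le_fubini (norm_le_mix B nf) => //; first exact: measurable_cond_mean.
exact: aeW.
Qed.

(** The mean of f is its average over the second copy, so that for centred f
    the conditional mean is the averaged effect of giving the coordinates in B
    their actual values. *)
Lemma norm_le_cond_mean0 B r f c : 1 <= r ->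
  nu.-integrable setT (EFin \o f) -> \int[nu]_x f x = 0 ->
  norm_le (nu \x nu)%E r (fun z => f (mix B z.1 z.2) - f z.2) c ->
  norm_le nu r (cond_mean B f) c.
Proof.
move=> r1 fi f0 H; have := @norm_le_cond_meanB B pred0 r f c r1 fi H.
by apply: norm_le_eq => x; rewrite cond_mean_pred0 f0 subr0.
Qed.

(** The defining property of conditional expectations, tested against functions
    of the coordinates in B. *)
Lemma cond_mean_orth B f h : measurable_fun setT h -> depends_on B h ->
  nu.-integrable setT (EFin \o f) ->
  nu.-integrable setT (EFin \o (fun x => h x * f x)) ->
  \int[nu]_x (h x * cond_mean B f x) = \int[nu]_x (h x * f x).
Proof.
move=> mh hB fi hfi; rewrite -(Rintegral_mix B hfi) /Rintegral; congr fine.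
rewrite -(integral12_prod_meas1 (integrable_mix B hfi)).
apply: ae_eq_integral => //=.
- apply/measurable_EFinP; apply: measurable_funM => //.
  exact: measurable_cond_mean.
- exact: (measurable_fubini_F (integrable_mix B hfi)).
have h1 := ae_integrable1 (integrable_mix B fi).
apply: filterS h1 => x h1 _; rewrite /fubini_F/=.
under [RHS]eq_integral do rewrite depends_on_mixl// EFinM.
rewrite integralZl// EFinM; congr (_ * _)%E.
by rewrite /cond_mean /Rintegral fineK//; exact: integrable_fin_num.
Qed.

End mixing.

(** * Projective decomposition *)

Section projective.
Context {d' : measure_display} {E : measurableType d'} {R : realType}.
Notation S := (prod_space int E).
Variable nu : probability S R.
Hypothesis inv : mix_invariant nu.
Implicit Types (f : nat -> S -> R) (r c tau : R) (sigma : nat -> R).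

Definition upto (c : int) : int -> bool := fun i => i <= c.

(** For c <= b, the part of g due to the layer of innovations with index in
    ]c, b]. *)
Definition proj (b c : int) (g : S -> R) (x : S) : R :=
  cond_mean nu (upto b) g x - cond_mean nu (upto c) g x.

(** The layers ]c k, b k] follow one another, so the earlier projections are
    functions of the innovations up to c k, and given those the k-th one
    averages to zero. *)
Lemma proj_martingale_diff r f (b c : nat -> int) : 1 < r ->
  (forall k, exists a, norm_le nu r (f k) a) ->
  (forall k, c k <= b k) -> (forall j k, (j < k)%N -> b j <= c k) ->
  martingale_diff nu r (fun k => proj (b k) (c k) (f k)).
Proof.
move=> r1 nf cb bc k h ch nh past.
have hc : depends_on (upto (c k)) h.
  move=> x y xy; apply: past => i ik; rewrite /proj.
  have bi := bc _ _ ik; have ci := le_trans (cb i) bi.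
  congr (_ - _); apply: cond_mean_depends_on => j; rewrite /upto => ji;
    by apply/xy/(le_trans ji).
have hb : depends_on (upto (b k)) h.
  by apply: sub_depends_on hc => i /le_trans; apply.
have [a na] := nf k.
have rr0 : 0 < r / (r - 1) by apply: divr_gt0; lra.
have r0 : 0 < r by lra.
have cc : (r / (r - 1))^-1 + r^-1 = 1 by field; lra.
have r1' := ltW r1.
have HI g : norm_le nu r g a ->
    nu.-integrable setT (EFin \o (fun x => h x * g x)).
  by move=> ng; apply: norm_le_integrable (norm_le_hoelder rr0 r0 cc nh ng).
have mh := norm_le_measurable nh.
have fi := norm_le_integrable r1' na.
have Ib := HI _ (norm_le_cond_mean inv (upto (b k)) r1' na).
have Ic := HI _ (norm_le_cond_mean inv (upto (c k)) r1' na).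
rewrite /proj; under eq_Rintegral do rewrite mulrBr.
rewrite (RintegralB measurableT Ib Ic).
rewrite (cond_mean_orth inv mh hb fi (HI _ na)).
by rewrite (cond_mean_orth inv mh hc fi (HI _ na)) subrr.
Qed.

(** Every f_t is the telescoping sum of its projections on the L most recent
    layers of the filtration and of a remote part. For a fixed lag the
    projections are martingale differences, so each lag costs only the square
    root (or 1/r-th) power of the number of terms. *)
Lemma projective_max r : 1 < r -> exists2 C, 0 < C &
  forall f (cut : int -> int) N L sigma tau,
  {homo cut : i j / i <= j} ->
  (forall t : nat, depends_on (upto (cut t)) (f t)) ->
  (forall t, exists a, norm_le nu r (f t) a) ->
  (forall (t l : nat), (t < N)%N -> (l < L)%N ->
     norm_le nu r (proj (cut (t%:Z - l%:Z)) (cut (t%:Z - l.+1%:Z)) (f t)) (sigma l)) ->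
  (forall t, (t < N)%N ->
     norm_le nu r (cond_mean nu (upto (cut (t%:Z - L%:Z))) (f t)) tau) ->
  norm_le nu r (runmax f N)
    (C * (N%:R `^ Num.max 2^-1 r^-1 * \sum_(l < L) sigma l) + N%:R * tau).
Proof.
move=> r1; have [C C0 HC] := martingale_max nu r1; exists C => // f cut N L sigma tau.
move=> hcut fdep nf nproj nrest; have r1' := ltW r1; have r0 := lt_trans ltr01 r1.
pose D (l t : nat) := proj (cut (t%:Z - l%:Z)) (cut (t%:Z - l.+1%:Z)) (f t).
pose Z t := cond_mean nu (upto (cut (t%:Z - L%:Z))) (f t).
have tele t x : f t x = \sum_(l < L) D l t x + Z t x.
  rewrite /D /Z /proj; elim: {nproj nrest D Z} L => [|l IH].
    by rewrite big_ord0 add0r subr0 cond_mean_id.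
  by rewrite big_ord_recr/= -addrA subrK -IH.
have mD l : martingale_diff nu r (D l).
  apply: proj_martingale_diff => //.
  - by move=> k; apply: hcut; lia.
  - by move=> j k jk; apply: hcut; lia.
have n1 : norm_le nu r (fun x => \sum_(l < L) runmax (D l) N x)
    (\sum_(l < L) C * (N%:R `^ Num.max 2^-1 r^-1 * sigma l)).
  apply: norm_le_sum => // l _; apply: HC => // t tN; exact: nproj.
have n2 : norm_le nu r (fun x => \sum_(t < N) `|Z t x|) (\sum_(t < N) tau).
  by apply: norm_le_sum => // t _; apply/norm_le_abs/nrest.
have n3 := norm_leD r1' n1 n2.
rewrite -mulr_sumr -mulr_sumr sumr_const card_ord -[tau *+ N]mulr_natl in n3.
apply: norm_le_dom n3 => //.
  apply: measurable_bigmaxr => i _.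
  rewrite (_ : psum f i = fun x => \sum_(t < i) f t x)//.
  by apply: measurable_sum => t; have [a []] := nf t.
move=> x; rewrite (ger0_norm (runmax_ge0 _ _ _)) [leRHS]ger0_norm; last first.
  by rewrite addr_ge0// sumr_ge0// => l _; exact: runmax_ge0.
rewrite /runmax big_seq; apply: bigmax_le.
  by rewrite addr_ge0// sumr_ge0// => l _; exact: runmax_ge0.
move=> k; rewrite mem_index_iota => /andP[_ kN].
have -> : psum f k x = \sum_(l < L) psum (D l) k x + \sum_(t < k) Z t x.
  rewrite /psum; under eq_bigr do rewrite tele.
  by rewrite big_split/= exchange_big.
apply: (le_trans (ler_normD _ _)); apply: lerD.
  apply: (le_trans (ler_norm_sum _ _ _)); apply: ler_sum => l _.
  by apply: (le_bigmax_seq 0 k); rewrite ?mem_index_iota.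
apply: (le_trans (ler_norm_sum _ _ _)).
rewrite -!(big_mkord xpredT (fun t => `|Z t x|)).
rewrite [leRHS](big_cat_nat (n := k))//= lerDl; exact: sumr_ge0.
Qed.

End projective.

(** * Coupling with an independent remote past *)

Section norm_limits.
Context {d : measure_display} {T : measurableType d} {R : realType}.
Variable mu : probability T R.
Implicit Types (f g : T -> R) (r c a : R).

Lemma norm_le_addgt0 r f c : 0 < r -> 0 <= c ->
  (forall eta, 0 < eta -> norm_le mu r f (c + eta)) -> norm_le mu r f c.
Proof.
move=> r0 c0 H; have [mf _ _] := H 1 ltr01.
apply/norm_leP => //; apply/lee_addgt0Pr => eta eta0.
by rewrite -EFinD; apply/norm_leP => //; [rewrite addr_ge0// ltW|exact: H].
Qed.

Lemma norm_le_trunc r f c : 0 < r -> measurable_fun setT f -> 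
  (forall K : nat, norm_le mu r (fun x => Num.min `|f x| K%:R) c) -> norm_le mu r f c.
Proof.
move=> r0 mf H; have [_ c0 _] := H 0%N.
split; [exact: mf|exact: c0|].
pose F (n : nat) x := (`|Num.min `|f x| n%:R| `^ r)%:E.
have mF n : measurable_fun setT (F n).
  by apply: measurable_EFin_powR; have [] := H n.
have F0 n x : [set: T] x -> (0 <= F n x)%E by rewrite lee_fin powR_ge0.
have Fnd x : [set: T] x -> {homo F^~ x : n m / (n <= m)%N >-> (n <= m)%E}.
  move=> _ n m nm; rewrite lee_fin; apply: ge0_ler_powR; rewrite ?nnegrE ?(ltW r0)//.
  have M0 k : 0 <= Num.min `|f x| k%:R by rewrite le_min normr_ge0 ler0n.
  rewrite (ger0_norm (M0 n)) (ger0_norm (M0 m)).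
  by rewrite le_min !ge_min lexx ler_nat nm orbT.
have -> : (\int[mu]_x (`|f x| `^ r)%:E = \int[mu]_x (fun y => limn (F ^~ y)) x)%E.
  apply: eq_integral => x _; apply/esym/lim_near_cst => //.
  near=> n; rewrite /F (min_idPl _) ?normr_id//.
  by near: n; exact: nbhs_infty_ger.
rewrite (monotone_convergence mu measurableT mF F0 Fnd).
apply: lime_le.
  by apply: ereal_nondecreasing_is_cvgn => n m nm; apply: ge0_le_integral => //;
    [exact: F0|move=> x _; exact: Fnd].
by apply: nearW => n; have [] := H n.
Unshelve. all: by end_near. Qed.

Lemma norm_le_indic r (A : set T) a : 0 < r -> measurable A -> 0 <= a ->
  (mu A <= a%:E)%E -> norm_le mu r (\1_A : T -> R) (a `^ r^-1).
Proof.
move=> r0 mA a0 Aa; split; [exact: measurable_indic|exact: powR_ge0|].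
rewrite -powRrM mulVf ?gt_eqF// powRr1//.
rewrite (_ : (\int[mu]_x _)%E = mu A)//.
rewrite -[X in mu X]setIT -integral_indic//; apply: eq_integral => x _.
rewrite indicE; case: (x \in A); first by rewrite normr1 powR1.
by rewrite normr0 powR0 ?gt_eqF.
Qed.

(** Fatou's lemma for limits in probability: after truncation at K, an event of
    probability eps costs at most K eps^(1/r). *)
Lemma norm_le_in_measure r g c (G : nat -> T -> R) : 1 <= r ->
  measurable_fun setT g -> (forall l, norm_le mu r (G l) c) ->
  (forall eta eps, 0 < eta -> 0 < eps -> exists l,
    (mu [set x | eta < `|g x - G l x|]%R <= eps%:E)%E) ->
  norm_le mu r g c.
Proof.
move=> r1 mg nG HG; have r0 := lt_le_trans ltr01 r1.
have [_ c0 _] := nG 0%N.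
apply: norm_le_trunc => // K; apply: norm_le_addgt0 => // eta eta0.
have eta2 : 0 < eta / 2 by rewrite divr_gt0.
pose eps := (eta / 2 / K.+1%:R) `^ r.
have eps0 : 0 < eps by rewrite powR_gt0// divr_gt0.
have [l Hl] := HG _ _ eta2 eps0.
set A := [set x | _ < _]%R in Hl.
have mA : measurable A.
  apply: measurable_normr_gt; apply: measurable_funB => //.
  by have [] := nG l.
have nA := norm_leZ K.+1%:R (norm_le_indic r0 mA (ltW eps0) Hl).
have nE := norm_leD r1 (norm_leD r1 (norm_le_abs (nG l)) (norm_le_cst mu r (eta / 2))) nA.
have E : c + `|eta / 2| + `|K.+1%:R| * eps `^ r^-1 = c + eta.
  have e0 : 0 <= eta / 2 / K.+1%:R by rewrite divr_ge0// ltW.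
  rewrite /eps -powRrM mulfV ?gt_eqF// powRr1//.
  rewrite (gtr0_norm eta2) normr_nat.
  have -> : K.+1%:R * (eta / 2 / K.+1%:R) = eta / 2.
    by rewrite mulrC divfK// pnatr_eq0.
  by rewrite -addrA -splitr.
rewrite E in nE; apply: norm_le_dom nE => //.
  by apply: measurable_minr => //; exact: measurableT_comp.
move=> x; rewrite ger0_norm; last by rewrite le_min normr_ge0 ler0n.
apply: le_trans (ler_norm _).
have [xA|xA] := boolP (x \in A).
  rewrite indicE xA mulr1 ge_min; apply/orP; right.
  have : K%:R <= K.+1%:R :> R by rewrite ler_nat.
  by have := normr_ge0 (G l x); lra.
rewrite indicE (negbTE xA) mulr0 addr0 ge_min; apply/orP; left.
move: xA; rewrite notin_setE /A/= => /negP; rewrite -leNgt.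
have := ler_normD (g x - G l x) (G l x); rewrite subrK; lra.
Qed.

End norm_limits.

Section remote_past.
Context {d' : measure_display} {E : measurableType d'} {R : realType}.
Notation S := (prod_space int E).
Variable nu : probability S R.
Hypothesis inv : mix_invariant nu.

Definition tail_mix (l : nat) (z : S * S) : S := mix (upto (- l%:Z)) z.1 z.2.

Lemma measurable_tail l : measurable_fun setT (tail_mix l).
Proof. exact: measurable_mix. Qed.

Definition changed (A : set S) l : set (S * S) :=
  [set z | A (tail_mix l z) /\ ~ A z.2] `|` [set z | ~ A (tail_mix l z) /\ A z.2].

Lemma measurable_changed A l : measurable A -> measurable (changed A l).
Proof.
move=> mA; have m1 : measurable (tail_mix l @^-1` A).
  by rewrite -[X in measurable X]setTI; exact: measurable_tail.
have m2 : measurable (snd @^-1` A : set (S * S)).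
  by rewrite -[X in measurable X]setTI; exact: measurable_snd.
apply: measurableU; first exact: (measurableD m1 m2).
rewrite (_ : [set z | _] = (snd @^-1` A) `\` (tail_mix l @^-1` A)).
  exact: (measurableD m2 m1).
by apply/seteqP; split => z [].
Qed.

Lemma measure_tail A l : measurable A -> ((nu \x nu) (tail_mix l @^-1` A) = nu A)%E.
Proof.
move=> mA.
have mF : measurable_fun setT (fun z : S * S => (\1_A z.1)%:E : \bar R).
  by apply/measurable_EFinP; exact: measurableT_comp (measurable_indic mA) measurable_fst.
have F0 (z : S * S) : (0 <= (\1_A z.1)%:E :> \bar R)%E by rewrite lee_fin.
have := inv (upto (- l%:Z)) mF F0; rewrite (fubini_tonelli1 _ mF F0) /fubini_F/=.
under [in X in _ = X -> _]eq_integral do rewrite integral_cst//= probability_setT mule1.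
have -> : (\int[nu]_x (\1_A x)%:E = nu A)%E by rewrite integral_indic// setIT.
move=> <-; have m1 : measurable (tail_mix l @^-1` A).
  by rewrite -[X in measurable X]setTI; exact: measurable_tail.
transitivity (\int[nu \x nu]_z (\1_(tail_mix l @^-1` A) z)%:E)%E => //.
by rewrite integral_indic// setIT.
Qed.

Definition tail_stable (A : set S) : Prop := measurable A /\
  forall eps : R, 0 < eps -> exists l0, forall l, (l0 <= l)%N ->
    ((nu \x nu) (changed A l) <= eps%:E)%E.

Lemma tail_stable_uniform (F : nat -> set S) n (e : R) :
  (forall k, tail_stable (F k)) -> 0 < e -> exists l0, forall l, (l0 <= l)%N ->
  ((nu \x nu) (\big[setU/set0]_(k < n) changed (F k) l) <= e%:E)%E.
Proof.
move=> SF; have mC l k := measurable_changed l (SF k).1.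
elim: n e => [|n IH] e e0.
  by exists 0%N => l _; rewrite big_ord0 measure0 lee_fin ltW.
have e2 : 0 < e / 2 by rewrite divr_gt0.
have [l1 H1] := IH _ e2; have [_ /(_ _ e2)[l2 H2]] := SF n.
exists (maxn l1 l2) => l; rewrite geq_max => /andP[ll1 ll2].
have mU : measurable (\big[setU/set0]_(k < n) changed (F k) l).
  by apply: bigsetU_measurable => k _; exact: mC.
rewrite big_ord_recr/=; apply: le_trans (measureU2 _ mU (mC l n)) _.
by rewrite [e]splitr EFinD; apply: leeD; [exact: H1|exact: H2].
Qed.

(** A countable union is approximated in measure by a finite one. *)
Lemma tail_stable_bigcup (F : nat -> set S) :
  (forall n, tail_stable (F n)) -> tail_stable (\bigcup_n F n).
Proof.
move=> SF; have mF n : measurable (F n) by have [] := SF n.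
have mUF : measurable (\bigcup_n F n) by exact: bigcupT_measurable.
split=> // eps eps0; have e3 : 0 < eps / 3 by rewrite divr_gt0.
pose U n := \big[setU/set0]_(k < n) F k.
have mU n : measurable (U n) by exact: bigsetU_measurable.
pose D n := (\bigcup_n F n) `\` U n.
have mD n : measurable (D n) by exact: measurableD.
have [n Dn] : exists n, (nu (D n) <= (eps / 3)%:E)%E.
  have cvgU : nu (D n) @[n --> \oo] --> nu set0.
    have -> : set0 = \bigcap_n D n.
      apply/seteqP; split => // x Dx; have [[n _ Fnx] _] := Dx 0%N I.
      by have [_] := Dx n.+1 I; apply; rewrite /U big_ord_recr; right.
    apply: nonincreasing_cvg_mu => //.
    - by apply: (le_lt_trans (probability_le1 _ _)); rewrite ?ltry.
    - exact: bigcapT_measurable.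
    - move=> a b ab; apply/subsetPset; apply: setDS.
      exact: subset_bigsetU.
  rewrite measure0 in cvgU.
  have e3' : (0 < (eps / 3)%:E)%E by rewrite lte_fin.
  have [n _ Hn] := cvgU _ (open_ereal_lt' e3').
  by exists n; apply/ltW; exact: (Hn n (leqnn n)).
have [l0 Hl0] := tail_stable_uniform n SF e3.
exists l0 => l ll0.
pose W := \big[setU/set0]_(k < n) changed (F k) l.
have mW : measurable W by apply: bigsetU_measurable => k _; exact: measurable_changed.
have m1 : measurable (tail_mix l @^-1` D n).
  by rewrite -[X in measurable X]setTI; exact: measurable_tail.
have m2 : measurable (snd @^-1` D n : set (S * S)).
  by rewrite -[X in measurable X]setTI; exact: measurable_snd.
have WE : W = \bigcup_(k < n) changed (F k) l by rewrite bigcup_mkord.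
have sub : changed (\bigcup_n F n) l `<=` W `|` (tail_mix l @^-1` D n) `|` snd @^-1` D n.
  have key (u v : S) : (\bigcup_n F n) u -> ~ (\bigcup_n F n) v -> ~ D n u ->
      exists2 k, (k < n)%N & F k u /\ ~ F k v.
    move=> Fu Fv Du; have : U n u by apply: contrapT => Uu; apply: Du.
    rewrite /U -bigcup_mkord => -[k kn Fku]; exists k => //; split => // Fkv.
    by apply: Fv; exists k.
  move=> z [[Fu Fv]|[Fu Fv]].
    have [Du|Du] := pselect (D n (tail_mix l z)); first by left; right.
    have [k kn [Fku Fkv]] := key _ _ Fu Fv Du; left; left.
    by rewrite WE; exists k => //; left.
  have [Du|Du] := pselect (D n z.2); first by right.
  have [k kn [Fku Fkv]] := key _ _ Fv Fu Du; left; left.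
  by rewrite WE; exists k => //; right.
have mC : measurable (changed (\bigcup_n F n) l) by exact: measurable_changed.
apply: (le_trans (le_measure _ _ _ sub)); rewrite ?inE//.
  by apply: measurableU => //; exact: measurableU.
have -> : eps = eps / 3 + eps / 3 + eps / 3 by field.
rewrite !EFinD; apply: (le_trans (measureU2 _ _ _)) => //; first exact: measurableU.
apply: leeD; last first.
  apply: le_trans Dn; suff <- : ((nu \x nu) (snd @^-1` D n) = nu (D n))%E by [].
  rewrite (_ : snd @^-1` D n = setT `*` D n); last first.
    by apply/seteqP; split => z //= [].
  rewrite product_measure1E// -[RHS]mul1e; congr (_ * _)%E.
  exact: probability_setT.
apply: (le_trans (measureU2 _ _ _)) => //.
apply: leeD; last first.
  apply: le_trans Dn; suff <- : ((nu \x nu) (tail_mix l @^-1` D n) = nu (D n))%E by [].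
  exact: measure_tail.
exact: Hl0.
Qed.

Lemma tail_stable_setC A : tail_stable A -> tail_stable (~` A).
Proof.
move=> [mA HA]; split; first exact: measurableC.
move=> eps /HA[l0 Hl0]; exists l0 => l /Hl0; suff -> : changed (~` A) l = changed A l by [].
apply/seteqP; split => z [[h1 h2]|[h1 h2]].
- by right; split => //; exact: contrapT.
- by left; split => //; exact: contrapT.
- by right; split => //; exact.
- by left; split => //; exact.
Qed.

(** The sets insensitive to a change of the remote past form a sigma-algebra
    that contains the cylinders. This approximation of arbitrary events by
    cylinders is what underlies Kolmogorov's zero-one law. *)
Lemma tail_stable_measurable A : measurable A -> tail_stable A.
Proof.
move: A; apply: smallest_sub; first split.
- split; first exact: measurable0.
  move=> eps eps0; exists 0%N => l _.
  rewrite (_ : changed set0 l = set0) ?measure0 ?lee_fin ?ltW//.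
  by apply/seteqP; split => z // [[]|[]].
- by move=> A HA; rewrite setTD; exact: tail_stable_setC.
- exact: tail_stable_bigcup.
move=> _ [i _ [B mB <-]]; rewrite setTI; split.
  rewrite -[X in measurable X]setTI; exact: measurable_coord.
move=> eps eps0; exists (`|i|.+1)%N => l il.
rewrite (_ : changed _ l = set0) ?measure0 ?lee_fin ?ltW//.
have E0 z : tail_mix l z i = z.2 i.
  by rewrite /tail_mix /mix /upto ifF//; apply/negbTE; rewrite -ltNge; lia.
by apply/seteqP; split => z // [[h1 h2]|[h1 h2]];
  [apply: h2; move: h1|apply: h1; move: h2]; rewrite /preimage/= E0.
Qed.

(** Off an event where |f| is large, a jump of f is seen by one of finitely many
    of its level sets. *)
Lemma tail_in_measure (f : S -> R) : nu.-integrable setT (EFin \o f) ->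
  forall eta eps : R, 0 < eta -> 0 < eps -> exists l0, forall l, (l0 <= l)%N ->
  ((nu \x nu) [set z | eta < `|f (tail_mix l z) - f z.2|]%R <= eps%:E)%E.
Proof.
move=> fi eta eps eta0 eps0; have mf : measurable_fun setT f.
  by have /integrableP[/measurable_EFinP] := fi.
pose c := fine (\int[nu]_x `|(f x)%:E|)%E.
have c0 : 0 <= c by apply: fine_ge0; exact: integral_ge0.
have n1 : norm_le nu 1 f c.
  split; [exact: mf|exact: c0|rewrite powRr1// fineK].
    by under eq_integral do rewrite powRr1//.
  by have /integrableP[_] := fi; rewrite ge0_fin_numE//; exact: integral_ge0.
pose K := 2 * (c + 1) / eps.
have K0 : 0 < K by rewrite /K divr_gt0// mulr_gt0//; lra.
(* A jump of size eta over a value in [-K, K] crosses a point of the grid of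
   step eta / 2. *)
pose s := eta / 2; have s0 : 0 < s by rewrite divr_gt0.
pose n := (Num.truncn (2 * K / s)).+3.
pose q (j : nat) : R := - K - s + j%:R * s.
have crossing u v : eta < `|u - v| -> `|v| <= K ->
    exists2 j, (j < n)%N & (u <= q j) != (v <= q j).
  move=> uv vK; have := vK; rewrite ler_norml => /andP[Kv vK'].
  have vK0 : 0 <= (v + K) / s by rewrite divr_ge0 ?(ltW s0)//; lra.
  pose j := Num.truncn ((v + K) / s).
  have jn : (j.+2 < n)%N.
    rewrite /n !ltnS; apply: le_truncn; rewrite ler_pM2r ?invr_gt0//; lra.
  have /andP[j1 j2] := truncn_itv vK0.
  rewrite -/j ler_pdivlMr// in j1; rewrite -/j ltr_pdivrMr// -natr1 mulrDl mul1r in j2.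
  have es : eta = s + s by rewrite /s -splitr.
  have [vu|uv'] := leP v u.
    exists j.+2 => //; rewrite ger0_norm ?subr_ge0// in uv.
    have -> : (v <= q j.+2) = true.
      by rewrite /q -!natr1 !mulrDl mul1r; lra.
    suff -> : (u <= q j.+2) = false by [].
    by apply/negbTE; rewrite -ltNge /q -!natr1 !mulrDl mul1r; lra.
  exists j; first exact: (ltn_trans (ltnSn _) (ltn_trans (ltnSn _) jn)).
  rewrite distrC ger0_norm ?subr_ge0 ?(ltW uv')// in uv.
  have -> : (u <= q j) = true by rewrite /q; lra.
  suff -> : (v <= q j) = false by [].
  by apply/negbTE; rewrite -ltNge /q; lra.
pose F j := [set x | f x <= q j].
have mF j : measurable (F j).
  rewrite /F -[X in measurable X]setTI; exact: measurable_fun_ler.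
have e2 : 0 < eps / 2 by rewrite divr_gt0.
have [l0 Hl0] := tail_stable_uniform n (fun k => tail_stable_measurable (mF k)) e2.
exists l0 => l ll0.
pose W := \big[setU/set0]_(k < n) changed (F k) l.
have WE : W = \bigcup_(k < n) changed (F k) l by rewrite bigcup_mkord.
have mW : measurable W by apply: bigsetU_measurable => k _; exact: measurable_changed.
pose V := [set z : S * S | (K < `|f z.2|)%R].
have mV : measurable V by apply: measurable_normr_gt; exact: measurableT_comp.
have mA : measurable [set z : S * S | eta < `|f (tail_mix l z) - f z.2|].
  apply: measurable_normr_gt; apply: measurable_funB.
    exact: measurableT_comp mf (measurable_tail l).
  exact: measurableT_comp.
have sub : [set z : S * S | eta < `|f (tail_mix l z) - f z.2|] `<=` W `|` V.
  move=> z /= ez; have [Kz|zK] := ltP K `|f z.2|; [by right|left].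
  have [j jn] := crossing _ _ ez zK; rewrite WE => H; exists j => //.
  rewrite /changed /F/=; have [uq|uq] := boolP (f (tail_mix l z) <= q j).
    by left; split => //; apply/negP; move: H; rewrite uq; case: (_ <= _).
  by right; split; [exact/negP|move: H; rewrite (negbTE uq); case: (_ <= _)].
apply: (le_trans (le_measure _ _ _ sub)); rewrite ?inE//; first exact: measurableU.
apply: (le_trans (measureU2 _ mW mV)).
rewrite [eps]splitr EFinD; apply: leeD.
  exact: Hl0.
have n2 := norm_le_mix inv pred0 n1.
apply: (le_trans (norm_le_markov ltr01 K0 n2)); rewrite lee_fin.
have cK : 0 <= c / K by rewrite divr_ge0// ltW.
rewrite (powRr1 cK). rewrite ler_pdivrMr// /K.
have -> : eps / 2 * (2 * (c + 1) / eps) = c + 1 by field; rewrite gt_eqF.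
lra.
Qed.

End remote_past.

Section coupling.
Context {d' : measure_display} {E : measurableType d'} {R : realType}.
Notation S := (prod_space int E).
Variable nu : probability S R.
Hypothesis inv : mix_invariant nu.
Variables (p : R) (p1 : 1 <= p) (g : S -> R) (t : int) (dl : nat -> R).
Hypothesis gi : nu.-integrable setT (EFin \o g).
Hypothesis coupled_le : forall k : nat, norm_le (nu \x nu)%E p
  (fun z => g z.1 - g (mix (fun i => i != t - k%:Z) z.1 z.2)) (dl k).

(** Telescoping over the coordinates: exchanging the two copies beyond the
    current coordinate turns each step into the replacement of a single
    innovation. *)
Lemma coupling_finite (k l : nat) : norm_le (nu \x nu)%E p
  (fun z => g (mix (upto (t - k%:Z)) z.1 z.2) -
            g (mix (upto (t - k%:Z - l%:Z)) z.1 z.2))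
  (\sum_(i < l) dl (k + i)%N).
Proof.
elim: l => [|l IH].
  rewrite big_ord0; apply: (@norm_le_eq _ _ _ _ _ _ (fun=> 0)).
    by move=> z; rewrite subr0 subrr.
  exact: norm_le0 (lt_le_trans ltr01 p1).
rewrite big_ord_recr/=.
have H := norm_le_mix_pair inv (upto (t - k%:Z - l%:Z)) (coupled_le (k + l)).
apply: norm_le_eq (norm_leD p1 IH H) => z /=.
rewrite addrA subrK; congr (_ - g _); apply/funext => i; rewrite /mix /upto.
have -> : t - (k + l)%N%:Z = t - k%:Z - l%:Z by lia.
have -> : t - k%:Z - l.+1%:Z = t - k%:Z - l%:Z - 1 by lia.
move: (t - k%:Z - l%:Z) => b; case: (eqVneq i b) => [->|ib] /=.
  by rewrite lexx ifF//; lia.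
by congr (if _ then _ else _); lia.
Qed.

(** Replacing the whole remote past costs no more than replacing its
    coordinates one at a time. *)
Lemma coupling_remote (k : nat) (th : R) :
  (forall l, \sum_(i < l) dl (k + i)%N <= th) -> norm_le (nu \x nu)%E p
  (fun z => g (mix (upto (t - k%:Z)) z.1 z.2) - g z.2) th.
Proof.
move=> Hth; have p0 : 0 < p := lt_le_trans ltr01 p1.
have mg : measurable_fun setT g by have /integrableP[/measurable_EFinP] := gi.
apply: (norm_le_in_measure (G := fun l z => g (mix (upto (t - k%:Z)) z.1 z.2) -
            g (mix (upto (t - k%:Z - l%:Z)) z.1 z.2))) => //.
- apply: measurable_funB; last exact: measurableT_comp.
  exact: measurableT_comp mg (measurable_mix _).
- by move=> l; apply: norm_leW (coupling_finite k l).
move=> eta eps eta0 eps0; have [l0 Hl0] := tail_in_measure inv gi eta0 eps0.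
have [l [l1 [l01 E1]]] : exists l l1 : nat, (l0 <= l1)%N /\ t - k%:Z - l%:Z = - l1%:Z.
  move: (t - k%:Z) => b; exists (l0 + absz b)%N, (absz ((l0 + absz b)%N%:Z - b)); lia.
exists l.
apply: le_trans (Hl0 l1 l01).
suff E1' z : g (mix (upto (t - k%:Z)) z.1 z.2) - g z.2 -
    (g (mix (upto (t - k%:Z)) z.1 z.2) - g (mix (upto (t - k%:Z - l%:Z)) z.1 z.2)) =
    g (tail_mix l1 z) - g z.2 by under eq_set do rewrite E1'.
by rewrite /tail_mix -E1 opprB addrC addrA subrK.
Qed.

(** A projection on one layer is the conditional mean of the change caused by
    replacing one innovation. *)
Lemma norm_le_proj_lag (k : nat) :
  norm_le nu p (proj nu (t - k%:Z) (t - k.+1%:Z) g) (dl k).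
Proof.
apply: norm_le_cond_meanB => //.
have := coupling_finite k 1; rewrite big_ord1 addn0.
by rewrite (_ : t - k%:Z - 1%:Z = t - k.+1%:Z)//; lia.
Qed.

Lemma norm_le_cond_mean_remote (k : nat) (th : R) : \int[nu]_x g x = 0 ->
  (forall l, \sum_(i < l) dl (k + i)%N <= th) ->
  norm_le nu p (cond_mean nu (upto (t - k%:Z)) g) th.
Proof. by move=> g0 Hth; apply: norm_le_cond_mean0 => //; exact: coupling_remote. Qed.

End coupling.

(** * Short memory *)

Section covariance.
Context {d' : measure_display} {E : measurableType d'} {R : realType}.
Notation S := (prod_space int E).
Variable nu : probability S R.
Hypothesis inv : mix_invariant nu.

Lemma norm_le_pair_integrable p (f g : S -> R) a b : 2 <= p ->
  norm_le nu p f a -> norm_le nu p g b ->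
  nu.-integrable setT (EFin \o (fun x => f x * g x)) /\
  `|\int[nu]_x (f x * g x)| <= a * b.
Proof.
move=> p2 nf ng; have p0 : 0 < p by lra.
have p21 : 1 <= p / 2 by lra.
have nfg := norm_leM p0 nf ng.
by split; [exact: norm_le_integrable nfg|exact: norm_le_Rintegral nfg].
Qed.

Lemma proj_depends_on b c g : c <= b -> depends_on (upto b) (proj nu b c g).
Proof.
move=> cb x y xy; rewrite /proj; congr (_ - _);
  apply: cond_mean_depends_on => i ib; apply: xy => //.
exact: le_trans ib cb.
Qed.

Lemma norm_le_proj p b c (g : S -> R) a : 1 <= p -> norm_le nu p g a ->
  exists a', norm_le nu p (proj nu b c g) a'.
Proof.
by move=> p1 ng; exists (a + a); apply: norm_leB => //; exact: norm_le_cond_mean.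
Qed.

Lemma proj_orth p b c (g h : S -> R) a a' : 2 <= p -> c <= b ->
  norm_le nu p g a -> norm_le nu p h a' -> depends_on (upto c) h ->
  \int[nu]_x (h x * proj nu b c g x) = 0.
Proof.
move=> p2 cb ng nh hc; have p1 : 1 <= p by lra.
have hb : depends_on (upto b) h.
  by apply: sub_depends_on hc => i /le_trans; apply.
have fi := norm_le_integrable p1 ng; have mh := norm_le_measurable nh.
have [i0 _] := norm_le_pair_integrable p2 nh ng.
have [ib _] := norm_le_pair_integrable p2 nh (norm_le_cond_mean inv (upto b) p1 ng).
have [ic _] := norm_le_pair_integrable p2 nh (norm_le_cond_mean inv (upto c) p1 ng).
rewrite /proj; under eq_Rintegral do rewrite mulrBr.
rewrite (RintegralB measurableT ib ic).
by rewrite (cond_mean_orth inv mh hb fi i0) (cond_mean_orth inv mh hc fi i0) subrr.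
Qed.

(** Projections on a layer are self-adjoint and idempotent. *)
Lemma proj_selfadjoint p b c (g h : S -> R) a a' : 2 <= p -> c <= b ->
  norm_le nu p g a -> norm_le nu p h a' ->
  \int[nu]_x (h x * proj nu b c g x) =
  \int[nu]_x (proj nu b c h x * proj nu b c g x).
Proof.
move=> p2 cb ng nh; have p1 : 1 <= p by lra.
have [a'' nPg] := norm_le_proj b c p1 ng.
have nhb := norm_le_cond_mean inv (upto b) p1 nh.
have nhc := norm_le_cond_mean inv (upto c) p1 nh.
have [ib _] := norm_le_pair_integrable p2 nhb nPg.
have [ic _] := norm_le_pair_integrable p2 nhc nPg.
have [i0 _] := norm_le_pair_integrable p2 nPg nh.
have -> : \int[nu]_x (proj nu b c h x * proj nu b c g x) =
    \int[nu]_x (cond_mean nu (upto b) h x * proj nu b c g x -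
               cond_mean nu (upto c) h x * proj nu b c g x).
  by apply: eq_Rintegral => x _; rewrite -mulrBl.
rewrite (RintegralB measurableT ib ic).
rewrite [X in _ - X](proj_orth p2 cb ng nhc) ?subr0; last first.
  exact: cond_mean_depends_on.
under eq_Rintegral do rewrite mulrC.
under [RHS]eq_Rintegral do rewrite mulrC.
rewrite (cond_mean_orth inv (norm_le_measurable nPg)) //.
- exact: proj_depends_on.
- exact: norm_le_integrable nh.
Qed.

End covariance.

Section short_memory_bounds.
Context {d' : measure_display} {E : measurableType d'} {R : realType}.
Notation S := (prod_space int E).
Variable nu : probability S R.
Hypothesis inv : mix_invariant nu.
Variables (X : nat -> S -> R) (p A K0 : R) (dl th : nat -> R).

(** The dependence structure of the process: dl and th dominate the physical
    dependence measure and its tail sums. *)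
Record short_memory : Prop := ShortMemory {
  sm_p : 2 < p;
  sm_A : 1 < A;
  sm_K0 : 0 <= K0;
  sm_dep : forall t, (0 < t)%N -> depends_on (upto t%:Z) (X t);
  sm_int : forall t, (0 < t)%N -> nu.-integrable setT (EFin \o X t);
  sm_mean : forall t, (0 < t)%N -> \int[nu]_x X t x = 0;
  sm_coupled : forall t k, (0 < t)%N -> norm_le (nu \x nu)%E p
    (fun z => X t z.1 - X t (mix (fun i => i != t%:Z - k%:Z) z.1 z.2)) (dl k);
  sm_tail : forall k l, \sum_(i < l) dl (k + i)%N <= th k;
  sm_decay : forall k, th k <= K0 * k.+1%:R `^ (- A) }.

Hypothesis sm : short_memory.

Lemma dl_ge0 k : 0 <= dl k.
Proof. by have [] := sm_coupled sm k (ltn0Sn 0). Qed.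

Lemma th_ge0 k : 0 <= th k.
Proof. by have := sm_tail sm k 0; rewrite big_ord0. Qed.

Let p1 : 1 <= p. Proof. by have := sm_p sm; lra. Qed.
Let p2 : 2 <= p. Proof. exact: ltW (sm_p sm). Qed.
Let p0 : 0 < p. Proof. by have := sm_p sm; lra. Qed.

(** X_t is its own conditional mean given the innovations up to time t. *)
Lemma norm_le_X t : (0 < t)%N -> norm_le nu p (X t) (th 0).
Proof.
move=> t0; have := norm_le_cond_mean_remote inv p1 (sm_int sm t0)
  (fun k => sm_coupled sm k t0) (sm_mean sm t0) (sm_tail sm 0).
by rewrite subr0 (cond_mean_id nu (sm_dep sm t0)).
Qed.

Lemma decay_mul k : k%:R * th k <= K0.
Proof.
have K00 := sm_K0 sm; have A1 := sm_A sm.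
apply: (@le_trans _ _ (k.+1%:R * th k)).
  by rewrite ler_wpM2r ?th_ge0// ler_nat.
apply: (@le_trans _ _ (k.+1%:R * (K0 * k.+1%:R `^ (- A)))).
  by rewrite ler_wpM2l//; exact: (sm_decay sm).
rewrite mulrCA ler_piMr// powRN ler_pdivrMr ?powR_gt0// mul1r.
by rewrite le1r_powR ?ler1n// ltW.
Qed.

Definition seg a b x : R := \sum_(a.+1 <= i < b.+1) X i x.

Lemma segE a n x : seg a (a + n) x = psum (fun i => X (a + i).+1) n x.
Proof.
rewrite /seg /psum -addSn -{1}[a.+1]add0n big_addn addnC addnK big_mkord.
by apply: eq_bigr => i _; rewrite addnC.
Qed.

Lemma seg_nil a b x : (b <= a)%N -> seg a b x = 0.
Proof. by move=> ba; rewrite /seg big_geq. Qed.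

Lemma seg_cat a b c x : (a <= b)%N -> (b <= c)%N ->
  seg a c x = seg a b x + seg b c x.
Proof. by move=> ab bc; rewrite /seg (big_cat_nat (n := b.+1)). Qed.

Lemma seg_runmax a N b x : (a <= b)%N -> (b <= a + N)%N ->
  `|seg a b x| <= runmax (fun i => X (a + i).+1) N x.
Proof.
move=> ab bN; rewrite -{1}(subnKC ab) segE.
have : (b - a <= N)%N by rewrite leq_subLR.
move: (b - a)%N => k kN; rewrite /runmax.
by apply: (le_bigmax_seq 0 k); rewrite ?mem_index_iota.
Qed.

(** With as many layers as terms, the remote parts add up to N th(N), which is
    bounded because A > 1, and the layers contribute sqrt(N) th(0). *)
Lemma norm_le_runmax_X : exists2 C, 0 < C & forall a N,
  norm_le nu p (runmax (fun i => X (a + i).+1) N) (C * N%:R `^ 2^-1).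
Proof.
have p1' : 1 < p by have := sm_p sm; lra.
have [C C0 HC] := projective_max inv p1'.
have th0 := th_ge0 0; have K00 := sm_K0 sm.
exists (C * (th 0 + 1) + K0).
  by rewrite ltr_wpDr// mulr_gt0//; lra.
move=> a N; pose cut (i : int) : int := i + a.+1%:Z.
have := HC (fun i => X (a + i).+1) cut N N dl (th N).
have Hcut : {homo cut : i j / i <= j} by move=> i j ij; rewrite /cut lerD2r.
have Hdep (t : nat) : depends_on (upto (cut t)) (X (a + t).+1).
  by have := sm_dep sm (ltn0Sn (a + t)); congr (depends_on (upto _)); rewrite /cut; lia.
have cutE (t l : nat) : cut (t%:Z - l%:Z) = (a + t).+1%:Z - l%:Z.
  by rewrite /cut; lia.
move=> /(_ Hcut Hdep) H.
have {}H := H (fun t => ex_intro _ _ (norm_le_X (ltn0Sn (a + t)))).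
apply: norm_leW (H _ _); [exact: p0| | |].
- rewrite (max_idPl _); last by rewrite lef_pV2 ?posrE//.
  rewrite mulrDl; apply: lerD.
    rewrite (mulrC (N%:R `^ _)) mulrA ler_wpM2r ?powR_ge0// ler_pM2l//.
    by have := sm_tail sm 0 N; lra.
  have [->|N0] := posnP N; first by rewrite mul0r mulr_ge0 ?powR_ge0.
  apply: (le_trans (decay_mul N)).
  by rewrite ler_peMr// -[leLHS](powRr0 N%:R) ler_powR ?ler1n ?invr_ge0.
- move=> t l tN lN; rewrite !cutE.
  exact: (norm_le_proj_lag inv p1 (sm_int sm (ltn0Sn _))
    (fun k => sm_coupled sm k (ltn0Sn (a + t))) l).
- move=> t tN; rewrite cutE.
  exact: (norm_le_cond_mean_remote inv p1 (sm_int sm (ltn0Sn _))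
    (fun k => sm_coupled sm k (ltn0Sn (a + t))) (sm_mean sm (ltn0Sn _)) (sm_tail sm N)).
Qed.

Lemma telescope_proj t L x : (0 < t)%N ->
  X t x = \sum_(k < L) proj nu (t%:Z - k%:Z) (t%:Z - k.+1%:Z) (X t) x +
    cond_mean nu (upto (t%:Z - L%:Z)) (X t) x.
Proof.
move=> t0; elim: L => [|l IH].
  by rewrite big_ord0 add0r subr0 (cond_mean_id nu (sm_dep sm t0)).
by rewrite big_ord_recr/= -addrA subrK -IH.
Qed.

Lemma norm_le_proj_X t k : (0 < t)%N ->
  norm_le nu p (proj nu (t%:Z - k%:Z) (t%:Z - k.+1%:Z) (X t)) (dl k).
Proof.
move=> t0; exact: (norm_le_proj_lag inv p1 (sm_int sm t0)
  (fun k => sm_coupled sm k t0) k).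
Qed.

(** Layers later than s do not correlate with X_s, and on the remaining ones
    X_s may be replaced by its own projection. *)
Lemma covariance_le s h L : (0 < s)%N ->
  `|\int[nu]_x (X s x * X (s + h)%N x)| <=
  \sum_(i < L) dl (h + i)%N * dl i + th 0 * th (h + L)%N.
Proof.
move=> s0; have t0 : (0 < s + h)%N by rewrite addn_gt0 s0.
have nXs := norm_le_X s0; have nXt := norm_le_X t0.
pose Q k := proj nu ((s + h)%N%:Z - k%:Z) ((s + h)%N%:Z - k.+1%:Z) (X (s + h)%N).
have nQ k : norm_le nu p (Q k) (dl k) by exact: norm_le_proj_X.
pose Z := cond_mean nu (upto ((s + h)%N%:Z - (h + L)%N%:Z)) (X (s + h)%N).
have nZ : norm_le nu p Z (th (h + L)%N).
  exact: (norm_le_cond_mean_remote inv p1 (sm_int sm t0)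
    (fun k => sm_coupled sm k t0) (sm_mean sm t0) (sm_tail sm _)).
have EX x : X s x * X (s + h)%N x =
    \sum_(k < h + L) X s x * Q k x + X s x * Z x.
  by rewrite {1}(telescope_proj (h + L) x t0) mulrDr mulr_sumr.
have iQ k : nu.-integrable setT (EFin \o (fun x => X s x * Q k x)).
  by have [] := norm_le_pair_integrable p2 nXs (nQ k).
have [iZ bZ] := norm_le_pair_integrable p2 nXs nZ.
have [iS eS] := Rintegral_sum_ord (n := (h + L)%N) (fun k _ => iQ k).
under eq_Rintegral do rewrite EX.
rewrite (RintegralD measurableT iS iZ) eS.
apply: (le_trans (ler_normD _ _)); apply: lerD => //.
rewrite big_split_ord/= big1 ?add0r; last first.
  move=> k _; apply: (proj_orth inv p2 _ nXt nXs); first by lia.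
  apply: sub_depends_on (sm_dep sm s0) => i; rewrite /upto; have := ltn_ord k; lia.
apply: (le_trans (ler_norm_sum _ _ _)); apply: ler_sum => i _.
rewrite /Q (proj_selfadjoint inv p2 _ nXt nXs); last by lia.
have e1 : (s + h)%N%:Z - (h + i)%N%:Z = s%:Z - i%:Z by lia.
have e2 : (s + h)%N%:Z - (h + i).+1%N%:Z = s%:Z - i.+1%:Z by lia.
have nP := norm_le_proj_X i s0.
rewrite mulrC; have [_] := norm_le_pair_integrable p2 nP (nQ (h + i)%N).
by rewrite /Q e1 e2.
Qed.

End short_memory_bounds.

(** * Bias of the running variance *)

Section bias.
Context {d' : measure_display} {E : measurableType d'} {R : realType}.
Notation S := (prod_space int E).
Variable nu : probability S R.
Hypothesis inv : mix_invariant nu.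
Variables (X : nat -> S -> R) (p A K0 : R) (dl th : nat -> R).
Hypothesis sm : short_memory nu X p A K0 dl th.

Local Notation seg := (seg X).

Let p1 : 1 <= p. Proof. by have := sm_p sm; lra. Qed.
Let p2 : 2 <= p. Proof. exact: ltW (sm_p sm). Qed.

Lemma norm_le_seg a b : exists c, norm_le nu p (seg a b) c.
Proof.
have [ab|ba] := leqP a b; last first.
  exists 0; apply: (@norm_le_eq _ _ _ _ _ _ (fun=> 0)).
    by move=> x; rewrite seg_nil// ltnW.
  by apply: norm_le0; exact: lt_le_trans p1.
exists ((b - a)%N%:R * th 0).
apply: (@norm_le_eq _ _ _ _ _ _ (psum (fun i => X (a + i).+1) (b - a))).
  by move=> x; rewrite -segE subnKC.
apply: (norm_le_psum p1 (N := b - a)) => // i _.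
exact: (norm_le_X inv sm).
Qed.

Lemma seg0E u x : seg 0 u x = \sum_(i < u) X i.+1 x.
Proof. by rewrite -{1}[u]add0n segE. Qed.

(** Summed over s <= u, the bounds on the covariances of X_t and X_s factor into
    a product of two tails; the remote term vanishes as the number M of layers
    grows. *)
Lemma covariance_seg t u : (u < t)%N ->
  `|\int[nu]_x (X t x * seg 0 u x)| <= th 0 * th (t - u)%N.
Proof.
move=> ut; have t0 : (0 < t)%N by exact: leq_ltn_trans ut.
have nXt := norm_le_X inv sm t0.
have iX (k : nat) : (k < u)%N -> nu.-integrable setT (EFin \o (fun x => X t x * X k.+1 x)).
  by move=> _; have [] := norm_le_pair_integrable p2 nXt (norm_le_X inv sm (ltn0Sn k)).
have [_ eS] := Rintegral_sum_ord iX.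
have -> : \int[nu]_x (X t x * seg 0 u x) = \int[nu]_x (\sum_(k < u) X t x * X k.+1 x).
  by apply: eq_Rintegral => x _; rewrite seg0E mulr_sumr.
rewrite eS; apply: (le_trans (ler_norm_sum _ _ _)).
have th0 := th_ge0 sm 0.
apply/ler_addgt0Pr => eps eps0.
pose M := (Num.truncn (u%:R * (th 0 * K0) / eps)).+1.
have M0 : 0 < M%:R :> R by rewrite ltr0n.
have HM : u%:R * (th 0 * (K0 / M%:R)) <= eps.
  have K00 := sm_K0 sm.
  have := truncnS_gt (u%:R * (th 0 * K0) / eps); rewrite -/M => /ltW.
  rewrite ler_pdivrMr// => H.
  by rewrite !mulrA ler_pdivrMr// (mulrC eps) -(mulrA u%:R).
have step (k : 'I_u) : `|\int[nu]_x (X t x * X k.+1 x)| <=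
    \sum_(i < M) dl (t - k.+1 + i)%N * dl i + th 0 * (K0 / M%:R).
  have := covariance_le inv sm (t - k.+1)%N M (ltn0Sn k).
  have -> : (k.+1 + (t - k.+1))%N = t by have := ltn_ord k; lia.
  under eq_Rintegral do rewrite mulrC.
  move=> /le_trans; apply; rewrite lerD2l ler_wpM2l//.
  rewrite ler_pdivlMr// mulrC; apply: le_trans (decay_mul sm (t - k.+1 + M)).
  by rewrite ler_wpM2r ?(th_ge0 sm)// ler_nat leq_addl.
apply: (le_trans (ler_sum _ (fun k _ => step k))).
rewrite big_split/= sumr_const card_ord -[X in _ + X]mulr_natl; apply: lerD HM.
rewrite exchange_big/=.
apply: (@le_trans _ _ (\sum_(i < M) th (t - u) * dl i)).
  apply: ler_sum => i _; rewrite -mulr_suml ler_wpM2r ?(dl_ge0 sm)//.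
  rewrite (reindex_inj rev_ord_inj)/=.
  apply: le_trans (sm_tail sm (t - u) (i + u)).
  rewrite big_split_ord/= -[leLHS]add0r; apply: lerD.
    by apply: sumr_ge0 => j _; exact: (dl_ge0 sm).
  rewrite le_eqVlt; apply/orP; left; apply/eqP; apply: eq_bigr => j _.
  by congr dl; have := ltn_ord j; lia.
rewrite -mulr_sumr mulrC ler_wpM2r ?(th_ge0 sm)//.
by have := sm_tail sm 0 M.
Qed.

Variable m : nat.
Hypothesis m0 : (0 < m)%N.

(** Blocks of full length; block 0 is empty. *)
Definition blk a x : R := seg (a.-1 * m) (a * m) x.

Definition blk_sq a x : R := blk a.+1 x ^+ 2 + 2 * blk a x * blk a.+1 x.

Definition partial_sq k j x : R :=
  seg (k * m) j x ^+ 2 + 2 * blk k x * seg (k * m) j x.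

Lemma blk0 x : blk 0 x = 0. Proof. by rewrite /blk seg_nil. Qed.

Lemma blkS a x : blk a.+1 x = seg (a * m) (a.+1 * m) x. Proof. by []. Qed.

Lemma running_varE n j x : (j <= n)%N ->
  running_var X m n j x = \sum_(a < j %/ m) blk_sq a x + partial_sq (j %/ m) j x.
Proof.
move=> jn; set k := (j %/ m)%N.
have km : (k * m <= n)%N by apply: leq_trans jn; exact: leq_trunc_div.
have bE a : (a <= k)%N -> block X m n a x = blk a x.
  move=> ak; rewrite /block /blk /seg (minn_idPl _)//.
  by apply: leq_trans km; rewrite leq_mul2r ak orbT.
have rE : remainder X m j x = seg (k * m) j x.
  rewrite /remainder; case: ifPn => [mj|//].
  by rewrite seg_nil// /k divnK.
rewrite /running_var -/k rE (bE k)// /partial_sq addrA; congr (_ + _ + _).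
rewrite /block_var.
have {}bE : {in [pred a | (a <= k)%N], forall a, block X m n a x = blk a x}.
  by move=> a; rewrite inE; exact: bE.
elim: {jn rE km} k bE => [|k IH] bE.
  by rewrite !big_geq// big_ord0 mulr0 addr0.
rewrite big_ord_recr/= -IH; last by move=> a; rewrite inE => ak; apply: bE; rewrite inE leqW.
rewrite (big_nat_recr k.+1)//= /blk_sq (bE k.+1) ?inE//.
case: k {IH} bE => [|k] bE.
  by rewrite !big_geq//= blk0; ring.
rewrite [X in _ + 2 * X = _](big_nat_recr k.+1)//= (bE k.+1) ?inE// (bE k.+2) ?inE//.
by ring.
Qed.

(** The square of the partial sum differs from the running variance by the
    products of blocks that are not neighbours. *)
Lemma sq_running_var k j x : (k * m <= j)%N ->
  seg 0 j x ^+ 2 - (\sum_(a < k) blk_sq a x + partial_sq k j x) =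
  2 * (\sum_(b < k) blk b.+1 x * seg 0 (b.-1 * m) x +
       seg (k * m) j x * seg 0 (k.-1 * m) x).
Proof.
elim: k j => [|k IH] j kj.
  by rewrite !big_ord0 /partial_sq blk0 !mul0n (@seg_nil _ _ _ _ 0 0)//; ring.
have km : (k * m <= k.+1 * m)%N by rewrite leq_mul2r leqnSn orbT.
have := IH _ km; rewrite /partial_sq -blkS.
rewrite (seg_cat X x (leq0n (k.+1 * m)) kj) !big_ord_recr/= /blk_sq.
rewrite (seg_cat X x (leq0n (k * m)) km) -blkS; lra.
Qed.

Lemma norm_le_blk a : exists c, norm_le nu p (blk a) c.
Proof. exact: norm_le_seg. Qed.

Lemma integrable_segM a b a' b' :
  nu.-integrable setT (EFin \o (fun x => seg a b x * seg a' b' x)).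
Proof.
have [c nc] := norm_le_seg a b; have [c' nc'] := norm_le_seg a' b'.
by have [] := norm_le_pair_integrable p2 nc nc'.
Qed.

Lemma th_le_pow k : (m <= k)%N -> th k <= K0 * m%:R `^ (- A).
Proof.
move=> mk; have A0 : 0 <= A by have := sm_A sm; lra.
apply: (le_trans (sm_decay sm k)); rewrite ler_wpM2l ?(sm_K0 sm)//.
rewrite !powRN lef_pV2 ?posrE ?powR_gt0 ?ltr0n//.
by apply: ge0_ler_powR; rewrite ?nnegrE// ler_nat (leq_trans mk).
Qed.

(** A gap of length m between the segments makes every tail at most
    K0 m^(-A). *)
Lemma covariance_segs a b u : (u = 0)%N \/ (u + m <= a)%N -> (a <= b)%N ->
  `|\int[nu]_x (seg a b x * seg 0 u x)| <= (b - a)%N%:R * (th 0 * (K0 * m%:R `^ (- A))).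
Proof.
have B0 : 0 <= th 0 * (K0 * m%:R `^ (- A)).
  by rewrite !mulr_ge0 ?(th_ge0 sm) ?(sm_K0 sm) ?powR_ge0.
case=> [->|uma] ab.
  under eq_Rintegral do rewrite (@seg_nil _ _ _ _ 0 0)// mulr0.
  by rewrite Rintegral_cst// mul0r normr0 mulr_ge0.
have [c nc] := norm_le_seg 0 u.
have iX (k : nat) : (k < b - a)%N ->
    nu.-integrable setT (EFin \o (fun x => X (a + k).+1 x * seg 0 u x)).
  by move=> _; have [] := norm_le_pair_integrable p2 (norm_le_X inv sm (ltn0Sn (a + k))) nc.
have [_ eS] := Rintegral_sum_ord iX.
have -> : \int[nu]_x (seg a b x * seg 0 u x) =
    \int[nu]_x (\sum_(k < b - a) X (a + k).+1 x * seg 0 u x).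
  by apply: eq_Rintegral => x _; rewrite -{1}(subnKC ab) segE mulr_suml.
rewrite eS; apply: (le_trans (ler_norm_sum _ _ _)).
set Bd := th 0 * _ in B0 *.
have -> : (b - a)%N%:R * Bd = \sum_(k < b - a) Bd by rewrite sumr_const card_ord mulr_natl.
apply: ler_sum => k _.
apply: le_trans (covariance_seg _) _; first by lia.
by rewrite ler_wpM2l ?(th_ge0 sm)// th_le_pow//; lia.
Qed.

Lemma integrable_partial_sq k j : nu.-integrable setT (EFin \o partial_sq k j).
Proof.
rewrite (_ : partial_sq k j = fun x => seg (k * m) j x * seg (k * m) j x +
    2 * (blk k x * seg (k * m) j x)); last first.
  by apply/funext => x; rewrite /partial_sq -expr2 mulrA.
exact: (integrableD measurableT (integrable_segM (k * m) j (k * m) j)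
  (integrableZl measurableT 2 (integrable_segM (k.-1 * m) (k * m) (k * m) j))).
Qed.

Lemma integrable_blk_sq a : nu.-integrable setT (EFin \o blk_sq a).
Proof.
rewrite (_ : blk_sq a = fun x => blk a.+1 x * blk a.+1 x +
    2 * (blk a x * blk a.+1 x)); last first.
  by apply/funext => x; rewrite /blk_sq -expr2 mulrA.
exact: (integrableD measurableT
  (integrable_segM (a * m) (a.+1 * m) (a * m) (a.+1 * m))
  (integrableZl measurableT 2 (integrable_segM (a.-1 * m) (a * m) (a * m) (a.+1 * m)))).
Qed.

(** Blocks that are not neighbours are separated by at least m times, so each of
    the j times contributes O(m^(-A)). *)
Lemma bias_le k j : (k * m <= j)%N ->
  `|\int[nu]_x (\sum_(a < k) blk_sq a x + partial_sq k j x) -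
    \int[nu]_x (seg 0 j x ^+ 2)| <=
  2 * (th 0 * K0) * (j%:R * m%:R `^ (- A)).
Proof.
move=> kj; pose F b x := blk b.+1 x * seg 0 (b.-1 * m) x.
have iF (b : nat) : (b < k)%N -> nu.-integrable setT (EFin \o F b).
  by move=> _; exact: integrable_segM.
have [iS eS] := Rintegral_sum_ord iF.
have iV (b : nat) : (b < k)%N -> nu.-integrable setT (EFin \o blk_sq b).
  by move=> _; exact: integrable_blk_sq.
have [iVS _] := Rintegral_sum_ord iV.
have iT := integrableD measurableT iVS (integrable_partial_sq k j).
have i2 : nu.-integrable setT (EFin \o (fun x => seg 0 j x ^+ 2)).
  by have := integrable_segM 0 j 0 j; congr (_.-integrable _ _).
have iR : nu.-integrable setT (EFin \o (fun x => seg (k * m) j x * seg 0 (k.-1 * m) x)).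
  exact: integrable_segM.
rewrite distrC -(RintegralB measurableT i2 iT).
under eq_Rintegral do rewrite sq_running_var//.
rewrite (RintegralZl 2 measurableT (integrableD measurableT iS iR)).
rewrite (RintegralD measurableT iS iR) eS normrM normr_nat -!mulrA ler_pM2l//.
set Bd := th 0 * (K0 * m%:R `^ (- A)).
have -> : th 0 * (K0 * (j%:R * m%:R `^ (- A))) = (\sum_(b < k) m%:R * Bd) + (j - k * m)%N%:R * Bd.
  rewrite sumr_const card_ord -[(m%:R * Bd) *+ k]mulr_natl (mulrA k%:R) -mulrDl -natrM -natrD.
  by rewrite subnKC// /Bd; ring.
have lastP : (k.-1 * m = 0)%N \/ (k.-1 * m + m <= k * m)%N.
  by case: (k) => [|k'] /=; [left|right; rewrite mulSn addnC].
apply: (le_trans (ler_normD _ _)); apply: lerD; last first.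
  exact: covariance_segs.
apply: (le_trans (ler_norm_sum _ _ _)); apply: ler_sum => b _.
have -> : m%:R = (b.+1 * m - b * m)%N%:R :> R by rewrite mulSn addnK.
apply: covariance_segs; last by rewrite leq_mul2r leqnSn orbT.
by case: (nat_of_ord b) => [|b'] /=; [left|right; rewrite mulSn addnC].
Qed.

End bias.

(** * Fluctuation of the running variance *)

Section power_sums.
Context {R : realType}.
Implicit Types (A x y : R).

(** Comparison with the integral of t^(-A), through exp and ln. *)
Lemma powR_opp_increment A x : 1 < A -> 0 < x ->
  (A - 1) * (x + 1) `^ (- A) <= x `^ (1 - A) - (x + 1) `^ (1 - A).
Proof.
move=> A1 x0; have y0 : 0 < x + 1 by lra.
have E : x `^ (1 - A) = (x + 1) `^ (1 - A) * expR ((A - 1) * - ln (x / (x + 1))).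
  rewrite /powR !gt_eqF// -expRD; congr expR.
  by rewrite ln_div ?posrE//; ring.
have l1 : (x + 1)^-1 <= - ln (x / (x + 1)).
  rewrite lerNr; have -> : x / (x + 1) = 1 + - (x + 1)^-1 by field; rewrite gt_eqF.
  by apply: le_ln1Dx; rewrite ltrN2 invf_lt1//; lra.
have l2 : 1 + (A - 1) * (x + 1)^-1 <= expR ((A - 1) * - ln (x / (x + 1))).
  apply: le_trans (expR_ge1Dx _); rewrite lerD2l ler_wpM2l//; lra.
have E2 : (x + 1) `^ (- A) = (x + 1) `^ (1 - A) * (x + 1)^-1.
  rewrite (_ : 1 - A = - A + 1); last by ring.
  rewrite powRD; last by rewrite (gt_eqF y0) implybT.
  by rewrite powRr1 ?(ltW y0)// mulfK// gt_eqF.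
rewrite E E2; have := powR_ge0 (x + 1) (1 - A); nra.
Qed.

Lemma power_sum_bounded A : 1 < A ->
  exists2 Z, 0 <= Z & forall n, \sum_(i < n) i.+1%:R `^ (- A) <= Z.
Proof.
move=> A1; exists (1 + (A - 1)^-1); first by rewrite addr_ge0// invr_ge0; lra.
have Am : 0 < A - 1 by lra.
suff H n : (A - 1) * \sum_(i < n.+1) i.+1%:R `^ (- A) <= (A - 1) + 1 - n.+1%:R `^ (1 - A).
  case=> [|n]; first by rewrite big_ord0 addr_ge0// invr_ge0; lra.
  rewrite -(ler_pM2l Am); apply: (le_trans (H n)).
  by rewrite mulrDr mulr1 divff ?gt_eqF// gerBl powR_ge0.
elim: n => [|n IH]; first by rewrite big_ord_recr big_ord0/= !powR1; lra.
rewrite big_ord_recr/= mulrDr.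
have := @powR_opp_increment A n.+1%:R A1 (ltr0Sn _ _); rewrite natr1; lra.
Qed.

End power_sums.

Section fluctuation.
Context {d' : measure_display} {E : measurableType d'} {R : realType}.
Notation S := (prod_space int E).
Variable nu : probability S R.
Hypothesis inv : mix_invariant nu.
Variables (X : nat -> S -> R) (p A K0 : R) (dl th : nat -> R).
Hypothesis sm : short_memory nu X p A K0 dl th.

Local Notation seg := (seg X).
Local Notation blk := (blk X).
Local Notation blk_sq := (blk_sq X).

Let p0 : 0 < p. Proof. by have := sm_p sm; lra. Qed.
Let p1 : 1 <= p. Proof. by have := sm_p sm; lra. Qed.
Let q0 : 0 < p / 2. Proof. by have := sm_p sm; lra. Qed.
Let q1 : 1 < p / 2. Proof. by have := sm_p sm; lra. Qed.

Lemma coupling_seg (c : int) a b B : c <= a%:Z ->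
  (forall t, (a < t)%N -> (t <= b)%N -> th (absz (t%:Z - c)) <= B) ->
  0 <= B ->
  norm_le (nu \x nu)%E p
    (fun z => seg a b (mix (upto c) z.1 z.2) - seg a b z.2) ((b - a)%N%:R * B).
Proof.
move=> ca HB B0.
have [ab|ba] := leqP a b; last first.
  rewrite (_ : (b - a)%N = 0%N) ?mul0r; last by lia.
  apply: (@norm_le_eq _ _ _ _ _ _ (fun=> 0)); last exact: norm_le0.
  by move=> z; rewrite !seg_nil ?subrr// ltnW.
pose F (k : nat) (z : S * S) := X (a + k).+1 (mix (upto c) z.1 z.2) - X (a + k).+1 z.2.
apply: (@norm_le_eq _ _ _ _ _ _ (psum F (b - a))).
  by move=> z; rewrite -{1 2}(subnKC ab) !segE /psum -sumrB.
apply: (norm_le_psum p1 (N := (b - a)%N)) => // k kab.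
have t0 : (0 < (a + k).+1)%N by [].
have := coupling_remote inv p1 (sm_int sm t0)
  (fun k => sm_coupled sm k t0) (sm_tail sm (absz ((a + k).+1%:Z - c))).
have -> : (a + k).+1%:Z - (absz ((a + k).+1%:Z - c))%:Z = c by lia.
apply: norm_leW => //; apply: HB; lia.
Qed.

Variable m : nat.
Hypothesis m0 : (0 < m)%N.
Variable beta : R.
Hypothesis blk_le : forall a, norm_le nu p (blk m a) beta.

Definition blk_dev a x : R := blk_sq m a x - \int[nu]_y blk_sq m a y.

Lemma norm_le_blk_sq a : norm_le nu (p / 2) (blk_sq m a) (3 * beta ^+ 2).
Proof.
have n1 := norm_leM p0 (blk_le a.+1) (blk_le a.+1).
have n2 := norm_leZ 2 (norm_leM p0 (blk_le a) (blk_le a.+1)).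
have := norm_leD (ltW q1) n1 n2; rewrite normr_nat.
have -> : beta * beta + 2 * (beta * beta) = 3 * beta ^+ 2 by ring.
by apply: norm_le_eq => x; rewrite /blk_sq -expr2 mulrA.
Qed.

Lemma norm_le_blk_dev a : norm_le nu (p / 2) (blk_dev a) (6 * beta ^+ 2).
Proof.
have n1 := norm_le_blk_sq a.
have n2 := norm_le_cst nu (p / 2) (\int[nu]_y blk_sq m a y).
apply: norm_leW (norm_leB (ltW q1) n1 n2) => //.
have := norm_le_Rintegral (ltW q1) n1; lra.
Qed.

(** The deviation of index a involves the blocks a and a + 1, hence the
    innovations up to time (a + 1) m. *)
Definition cut (i : int) : int := (i + 1) * m%:Z.

(** The cut is at time (a - l - 2) m and the two blocks start at (a - 1) m or
    later, so that the remote past is at least (l + 1) m times away. The m terms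
    of a block change by m ((l + 1) m)^(-A) in total, at most (l + 1)^(-A). *)
Lemma coupling_blk (l a b : nat) : (b = a \/ b = a.+1) ->
  norm_le (nu \x nu)%E p
    (fun z => blk m b (mix (upto (cut (a%:Z - (l + 3)%N%:Z))) z.1 z.2) - blk m b z.2)
    (K0 * l.+1%:R `^ (- A)).
Proof.
move=> ba; have A1 := sm_A sm; have K00 := sm_K0 sm.
have B0 : 0 <= K0 * (l.+1 * m)%N%:R `^ (- A) by rewrite mulr_ge0 ?powR_ge0.
have bl : b.-1%:Z * m%:Z >= cut (a%:Z - (l + 3)%N%:Z) + (l.+1 * m)%N%:Z.
  by rewrite /cut PoszM -mulrDl ler_wpM2r//; lia.
have := @coupling_seg (cut (a%:Z - (l + 3)%N%:Z)) (b.-1 * m)%N (b * m)%N _ _ _ B0.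
move=> H; apply: norm_leW (H _ _) => //.
- have lm : (b * m - b.-1 * m <= m)%N by rewrite -mulnBl; case: (b) => [|b'] /=; lia.
  apply: (@le_trans _ _ (m%:R * (K0 * (l.+1 * m)%N%:R `^ (- A)))).
    by rewrite ler_wpM2r// ler_nat.
  rewrite mulrCA ler_wpM2l// natrM powRM// mulrCA ler_piMr ?powR_ge0//.
  by rewrite powRN ler_pdivrMr ?powR_gt0 ?ltr0n// mul1r le1r_powR ?ler1n// ltW.
- by move: bl; rewrite PoszM; lia.
move=> t t1 t2; apply: (le_trans (sm_decay sm _)); rewrite ler_wpM2l//.
rewrite !powRN lef_pV2 ?posrE ?powR_gt0 ?ltr0n ?muln_gt0 ?m0//.
apply: ge0_ler_powR; rewrite ?nnegrE//; first by lra.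
rewrite ler_nat; move: bl; rewrite -!PoszM; lia.
Qed.

(** The change of a product is controlled by the change of one factor times the
    norm of the other. *)
Lemma coupling_blk_dev (l a : nat) : norm_le nu (p / 2)
  (cond_mean nu (upto (cut (a%:Z - (l + 3)%N%:Z))) (blk_dev a))
  (6 * beta * (K0 * l.+1%:R `^ (- A))).
Proof.
have n6 := norm_le_blk_dev a; have n3 := norm_le_blk_sq a.
have di := norm_le_integrable (ltW q1) n6.
have si := norm_le_integrable (ltW q1) n3.
apply: norm_le_cond_mean0 => //; first exact: ltW.
  have ci : nu.-integrable setT (EFin \o (fun=> \int[nu]_y blk_sq m a y)).
    exact: finite_measure_integrable_cst.
  rewrite /blk_dev (RintegralB measurableT si ci) Rintegral_cst//.
  by rewrite (_ : fine (nu setT) = 1) ?mulr1 ?subrr// probability_setT.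
have nB1u := norm_le_mix inv (upto (cut (a%:Z - (l + 3)%N%:Z))) (blk_le a.+1).
have nB1v := norm_le_mix inv pred0 (blk_le a.+1).
have nB0v := norm_le_mix inv pred0 (blk_le a).
have nD0 := coupling_blk l (or_introl (erefl a)).
have nD1 := coupling_blk l (or_intror (erefl a.+1)).
have N1 := norm_leM p0 nD1 (norm_leD p1 nB1u nB1v).
have N2 := norm_leZ 2 (norm_leD (ltW q1) (norm_leM p0 nD0 nB1u) (norm_leM p0 nB0v nD1)).
have := norm_leD (ltW q1) N1 N2; rewrite normr_nat.
set eta := K0 * _.
have -> : eta * (beta + beta) + 2 * (eta * beta + beta * eta) = 6 * beta * eta by ring.
apply: norm_le_eq => z; rewrite /blk_dev /blk_sq /= !mix_pred0; ring.
Qed.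

Lemma blk_depends_on a : depends_on (upto (a * m)%N%:Z) (blk m a).
Proof.
move=> x y xy; apply: eq_big_nat => i /andP[i1 i2].
have i0 : (0 < i)%N by exact: leq_trans i1.
apply: (sm_dep sm i0) => j ji; apply: xy; apply: (le_trans ji); lia.
Qed.

Lemma blk_dev_depends_on (a : nat) : depends_on (upto (cut a)) (blk_dev a).
Proof.
move=> x y xy; rewrite /blk_dev /blk_sq.
have E1 : blk m a.+1 x = blk m a.+1 y.
  by apply: blk_depends_on => i ia; apply: xy; apply: le_trans ia _; rewrite /cut; lia.
have E0 : blk m a x = blk m a y.
  apply: blk_depends_on => i ia; apply: xy; apply: (le_trans ia).
  by rewrite /cut PoszM ler_wpM2r//; lia.
by rewrite E1 E0.
Qed.

End fluctuation.

Section running_variance_bound.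
Context {d' : measure_display} {E : measurableType d'} {R : realType}.
Notation S := (prod_space int E).
Variable nu : probability S R.
Hypothesis inv : mix_invariant nu.
Variables (X : nat -> S -> R) (p A K0 : R) (dl th : nat -> R).
Hypothesis sm : short_memory nu X p A K0 dl th.

Local Notation seg := (seg X).

Let p0 : 0 < p. Proof. by have := sm_p sm; lra. Qed.
Let p2 : 2 <= p. Proof. exact: ltW (sm_p sm). Qed.
Let q0 : 0 < p / 2. Proof. by have := sm_p sm; lra. Qed.
Let q1 : 1 < p / 2. Proof. by have := sm_p sm; lra. Qed.

Lemma sqrt_le_nat n : (n%:R : R) `^ 2^-1 <= n%:R.
Proof.
have [->|n0] := posnP n; first by rewrite powR0// invr_neq0.
by rewrite -[leRHS]powRr1// ler_powR ?ler1n// invf_le1// ler1n.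
Qed.

Lemma sqr_sqrt_nat n : ((n%:R : R) `^ 2^-1) ^+ 2 = n%:R.
Proof. by rewrite powR12_sqrt// sqr_sqrtr. Qed.

(** The conditional means of a block deviation at lags 0, 1 and 2 cost m each,
    and the one at lag l + 3 costs sqrt(m) (l + 1)^(-A), which is summable over l
    because A > 1. *)
Lemma blk_dev_max : p <= 4 -> exists2 C, 0 <= C & forall m K, (0 < m)%N ->
  norm_le nu (p / 2) (runmax (blk_dev nu X m) K) (C * (K%:R `^ (2 / p) * m%:R)).
Proof.
move=> p4; have [C1 C10 HC1] := norm_le_runmax_X inv sm.
have [C2 C20 HC2] := projective_max inv q1.
have [Z Z0 HZ] := power_sum_bounded (sm_A sm).
have K00 := sm_K0 sm; have A1 := sm_A sm.
exists (C2 * (2 * (18 * C1 ^+ 2 + 6 * C1 * K0 * Z)) + 6 * C1 * K0).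
  by rewrite addr_ge0 ?mulr_ge0 ?addr_ge0 ?mulr_ge0 ?exprn_ge0 ?(ltW C10) ?(ltW C20).
move=> m K m0; set beta := C1 * m%:R `^ 2^-1.
have beta0 : 0 <= beta by rewrite mulr_ge0 ?powR_ge0// ltW.
have blk_le a : norm_le nu p (blk X m a) beta.
  have [c nc] := norm_le_blk inv sm m a.
  apply: norm_le_dom (HC1 (a.-1 * m)%N m) => //; first by have [] := nc.
  move=> x; rewrite (ger0_norm (runmax_ge0 _ _ _)); apply: seg_runmax.
    by rewrite leq_mul2r leq_pred orbT.
  by case: (a) => [|a'] /=; rewrite ?mul0n// mulSn addnC.
have beta2 : beta ^+ 2 = C1 ^+ 2 * m%:R by rewrite exprMn sqr_sqrt_nat.
have betam : beta <= C1 * m%:R by rewrite ler_pM2l// sqrt_le_nat.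
have [->|K_gt0] := posnP K.
  rewrite powR0; last by rewrite gt_eqF// divr_gt0.
  rewrite mul0r mulr0; apply: (@norm_le_eq _ _ _ _ _ _ (fun=> 0)); last exact: norm_le0.
  by move=> x; rewrite runmax0.
pose rho l : R := if (l < 3)%N then 6 * beta ^+ 2 else 6 * beta * (K0 * (l - 2)%N%:R `^ (- A)).
have rho0 l : 0 <= rho l.
  rewrite /rho; case: ifP => _; first by rewrite mulr_ge0// exprn_ge0.
  by rewrite mulr_ge0// mulr_ge0// powR_ge0.
have nrho (a l : nat) : norm_le nu (p / 2)
    (cond_mean nu (upto (cut m (a%:Z - l%:Z))) (blk_dev nu X m a)) (rho l).
  rewrite /rho; case: ltnP => l3.
    exact: (norm_le_cond_mean inv (upto (cut m (a%:Z - l%:Z))) (ltW q1)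
      (norm_le_blk_dev sm blk_le a)).
  have := coupling_blk_dev inv sm m0 blk_le (l - 3) a.
  have e1 : (l - 3 + 3)%N = l := subnK l3.
  have e2 : (l - 3).+1 = (l - 2)%N by rewrite -subSn// subSS.
  by rewrite e1 e2.
have srho n : \sum_(l < n) rho l <= 18 * beta ^+ 2 + 6 * beta * K0 * Z.
  apply: (@le_trans _ _ (\sum_(l < 3 + n) rho l)).
    rewrite -!(big_mkord xpredT rho) (big_cat_nat (leq0n n) (leq_addl 3 n))/=.
    by rewrite lerDl sumr_ge0.
  rewrite (@big_split_ord _ _ _ 3 n)/=; apply: lerD.
    by rewrite !big_ord_recr big_ord0/= /rho/=; lra.
  have -> : \sum_(i < n) rho (3 + i)%N = 6 * beta * K0 * \sum_(i < n) i.+1%:R `^ (- A).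
    rewrite mulr_sumr; apply: eq_bigr => i _.
    have -> : rho (3 + i)%N = 6 * beta * (K0 * i.+1%:R `^ (- A)).
      rewrite /rho; case: ltnP => [|_]; first by rewrite ltnNge leq_addr.
      by congr (_ * (_ * _%:R `^ _)); rewrite add3n subSS subSS subn0.
    by rewrite mulrA.
  by rewrite ler_wpM2l// mulr_ge0// mulr_ge0.
pose L := (K + 3)%N.
have := HC2 (blk_dev nu X m) (cut m) K L (fun l => rho l + rho l.+1) (rho L).
have Hcut : {homo cut m : i j / i <= j}.
  by move=> i j ij; rewrite /cut ler_wpM2r// lerD2r.
move=> /(_ Hcut) H.
have {}H := H (fun t => blk_dev_depends_on sm m0 (a := t)).
have {}H := H (fun t => ex_intro _ _ (norm_le_blk_dev sm blk_le t)).
have H1 t l : (t < K)%N -> (l < L)%N -> norm_le nu (p / 2)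
    (proj nu (cut m (t%:Z - l%:Z)) (cut m (t%:Z - l.+1%:Z)) (blk_dev nu X m t))
    (rho l + rho l.+1).
  by move=> _ _; apply: (norm_leB (ltW q1)); exact: nrho.
apply: (norm_leW q0 _ (H H1 (fun t _ => nrho t L))).
have p40 : (p / 2)^-1 = 2 / p by rewrite invf_div.
rewrite (max_idPr _); last by rewrite lef_pV2 ?posrE//; lra.
rewrite p40; set k := K%:R `^ (2 / p).
have k1 : 1 <= k.
  by rewrite /k -[leLHS](powRr0 K%:R) ler_powR ?ler1n// divr_ge0// ltW.
have m1 : 1 <= m%:R :> R by rewrite ler1n.
have sum_le : \sum_(l < L) (rho l + rho l.+1) <=
    2 * (18 * C1 ^+ 2 + 6 * C1 * K0 * Z) * m%:R.
  have s1 := srho L; have := srho L.+1; rewrite big_ord_recl/= => s2.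
  have := rho0 0%N => r0; rewrite big_split/=.
  have : 6 * beta * K0 * Z <= 6 * (C1 * m%:R) * K0 * Z.
    by rewrite ler_wpM2r// ler_wpM2r// ler_pM2l.
  move: s1 s2; rewrite beta2 /bump/=; set b := 6 * beta * K0 * Z; lra.
have rho_le : K%:R * rho L <= 6 * C1 * K0 * m%:R.
  rewrite /rho ifF; last by rewrite ltnNge leq_addl.
  have -> : (L - 2)%N = K.+1 by rewrite /L addn3 subSS subSS subn0.
  have KA : K%:R * K.+1%:R `^ (- A) <= 1 :> R.
    rewrite powRN ler_pdivrMr ?powR_gt0// mul1r.
    apply: (@le_trans _ _ K.+1%:R); first by rewrite ler_nat.
    by rewrite le1r_powR ?ler1n// ltW.
  have -> : K%:R * (6 * beta * (K0 * K.+1%:R `^ (- A))) =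
    6 * beta * K0 * (K%:R * K.+1%:R `^ (- A)) by ring.
  apply: (@le_trans _ _ (6 * beta * K0)).
    by rewrite ler_piMr// mulr_ge0// mulr_ge0.
  have -> : 6 * beta * K0 = 6 * (beta * K0) by ring.
  have -> : 6 * C1 * K0 * m%:R = 6 * (C1 * m%:R * K0) by ring.
  by rewrite ler_pM2l// ler_wpM2r.
have k0 : 0 <= k := le_trans ler01 k1.
rewrite mulrDl; apply: lerD.
  by rewrite -[leRHS]mulrA ler_pM2l// [leRHS]mulrCA ler_wpM2l.
have C6 : 0 <= 6 * C1 * K0 by rewrite mulr_ge0// mulr_ge0// ltW.
apply: (le_trans rho_le); rewrite ler_wpM2l//.
by rewrite ler_peMl.
Qed.

Definition var_sum j : R := \int[nu]_x (seg 0 j x ^+ 2).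

Lemma var_sum_ge0 j : 0 <= var_sum j.
Proof. by apply: Rintegral_ge0 => x _; exact: sqr_ge0. Qed.

Lemma var_sum_le : exists2 C, 0 <= C & forall j, var_sum j <= C * j%:R.
Proof.
have [C C0 HC] := norm_le_runmax_X inv sm.
exists (C ^+ 2); first exact: sqr_ge0.
move=> j; have [c nc] := norm_le_seg inv sm 0 j.
have n1 : norm_le nu p (seg 0 j) (C * j%:R `^ 2^-1).
  apply: norm_le_dom (HC 0%N j) => //; first by have [] := nc.
  by move=> x; rewrite (ger0_norm (runmax_ge0 _ _ _)); exact: seg_runmax.
have [_] := norm_le_pair_integrable p2 n1 n1.
rewrite -expr2 exprMn sqr_sqrt_nat; apply: le_trans.
apply: le_trans (ler_norm _); rewrite le_eqVlt; apply/orP; left; apply/eqP.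
by apply: eq_Rintegral => x _; rewrite expr2.
Qed.

(** With K = floor(n/m) blocks, K m <= n and 2/p >= 1/2 give
    K^(2/p) m <= n^(2/p) m^(1-2/p) <= n^(2/p) m^(1/2). *)
Lemma block_count_le n m : p <= 4 -> (0 < m)%N ->
  (n %/ m)%N%:R `^ (2 / p) * m%:R <= n%:R `^ (2 / p) * m%:R `^ 2^-1.
Proof.
move=> p4 m0; have pp : 0 <= 2 / p by rewrite divr_ge0// ltW.
have m1 : 1 <= m%:R :> R by rewrite ler1n.
have mE : m%:R = m%:R `^ (2 / p) * m%:R `^ (1 - 2 / p) :> R.
  rewrite -powRD; last by rewrite pnatr_eq0 -lt0n m0 implybT.
  by rewrite addrC subrK powRr1.
rewrite {1}mE mulrA -powRM//; apply: ler_pM; rewrite ?powR_ge0//.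
  apply: (ge0_ler_powR pp); rewrite ?nnegrE ?mulr_ge0//.
  by rewrite -natrM ler_nat leq_trunc_div.
rewrite ler_powR//.
have : 2^-1 <= 2 / p by rewrite ler_pdivlMr//; lra.
lra.
Qed.

Lemma block_count_succ_le n m : p <= 4 -> (0 < m)%N -> (0 < n)%N ->
  (n %/ m).+1%:R `^ (2 / p) * (minn m n)%:R <=
  2 * (n%:R `^ (2 / p) * m%:R `^ 2^-1).
Proof.
move=> p4 m0 n0; have pp : 0 <= 2 / p by rewrite divr_ge0// ltW.
have pp1 : 2 / p <= 1 by rewrite ler_pdivrMr// mul1r.
have half : 2^-1 <= 2 / p by rewrite ler_pdivlMr//; lra.
have [mn|nm] := leqP m n.
  have K1 : (0 < n %/ m)%N by rewrite divn_gt0.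
  apply: (@le_trans _ _ (2 * ((n %/ m)%N%:R `^ (2 / p) * m%:R))); last first.
    by rewrite ler_pM2l// block_count_le.
  rewrite mulrA ler_wpM2r//.
  apply: (@le_trans _ _ ((2 * (n %/ m)%N%:R) `^ (2 / p))).
    apply: (ge0_ler_powR pp); rewrite ?nnegrE ?mulr_ge0//.
    by rewrite -natrM ler_nat; lia.
  rewrite powRM// ler_wpM2r ?powR_ge0//.
  by rewrite -[leRHS]powRr1// ler_powR// ler1n.
rewrite divn_small// powR1 mul1r.
have nE : n%:R = n%:R `^ 2^-1 * n%:R `^ 2^-1 :> R by rewrite -expr2 sqr_sqrt_nat.
rewrite {1}nE; have le1 : n%:R `^ 2^-1 * n%:R `^ 2^-1 <=
    n%:R `^ (2 / p) * m%:R `^ 2^-1 :> R.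
  apply: ler_pM; rewrite ?powR_ge0//; first by rewrite ler_powR// ler1n.
  by apply: ge0_ler_powR; rewrite ?nnegrE// ler_nat ltnW.
by apply: (le_trans le1); rewrite ler_peMl ?mulr_ge0 ?powR_ge0// ler1n.
Qed.

(** The incomplete last block: its contribution is dominated by the square of
    the largest partial sum within any block. *)
Lemma partial_sq_max : p <= 4 -> exists2 C, 0 <= C & forall n m,
  (0 < m)%N -> (0 < n)%N -> exists G : S -> R,
  norm_le nu (p / 2) G (C * (n%:R `^ (2 / p) * m%:R `^ 2^-1)) /\
  forall j x, (j <= n)%N -> `|partial_sq X m (j %/ m) j x| <= G x.
Proof.
move=> p4; have [C C0 HC] := norm_le_runmax_X inv sm.
exists (3 * (C ^+ 2 * 2)); first by rewrite mulr_ge0// mulr_ge0// sqr_ge0.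
move=> n m m0 n0; pose N := minn m n; pose K := (n %/ m)%N.
pose M k := runmax (fun i => X (k * m + i).+1) N.
pose H x := \big[Num.max/0]_(k <- iota 0 K.+1) `|M k x|.
have nH : norm_le nu p H ((\sum_(k <- iota 0 K.+1) (C * N%:R `^ 2^-1) `^ p) `^ p^-1).
  by apply: norm_le_max => // k _; exact: HC.
have MH k x : (k <= K)%N -> M k x <= H x.
  move=> kK; apply: (le_trans (ler_norm _)).
  by apply: (le_bigmax_seq 0 k); rewrite ?mem_iota.
have H0 x : 0 <= H x by apply: le_trans (MH 0%N x _); rewrite ?runmax_ge0.
exists (fun x => 3 * (H x * H x)); split.
  have := norm_leZ 3 (norm_leM p0 nH nH); rewrite normr_nat; apply: norm_leW => //.
  rewrite -[leRHS]mulrA ler_pM2l// -(mulrA (C ^+ 2) 2).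
  have B0 : 0 <= C * N%:R `^ 2^-1 by rewrite mulr_ge0 ?powR_ge0// ltW.
  have -> : \sum_(k <- iota 0 K.+1) (C * N%:R `^ 2^-1) `^ p = K.+1%:R * (C * N%:R `^ 2^-1) `^ p.
    by rewrite big_const_seq count_predT size_iota iter_addr_0 mulr_natl.
  rewrite powRM ?powR_ge0// -powRrM mulfV ?gt_eqF// powRr1// -expr2 exprMn exprMn.
  rewrite sqr_sqrt_nat.
  have -> : (K.+1%:R `^ p^-1) ^+ 2 = K.+1%:R `^ (2 / p) :> R.
    by rewrite -powR_mulrn ?powR_ge0// -powRrM mulrC.
  rewrite [leLHS]mulrCA; apply: ler_wpM2l; first exact: sqr_ge0.
  exact: block_count_succ_le.
move=> j x jn; rewrite /partial_sq; set k := (j %/ m)%N.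
have kK : (k <= K)%N by exact: leq_div2r.
have kj : (k * m <= j)%N by exact: leq_trunc_div.
have jE := divn_eq j m; have jm := ltn_pmod j m0.
have s1 : `|seg (k * m) j x| <= H x.
  apply: le_trans (MH k x kK); apply: seg_runmax => //.
  by rewrite /N; lia.
have s2 : `|blk X m k x| <= H x.
  case: (posnP k) => [->|k0]; first by rewrite blk0 normr0.
  apply: le_trans (MH k.-1 x (leq_trans (leq_pred _) kK)).
  have kE : (k * m = k.-1 * m + m)%N by rewrite -{1}(prednK k0) mulSn addnC.
  apply: seg_runmax; first by rewrite leq_mul2r leq_pred orbT.
  by rewrite /N kE leq_add2l leq_min leqnn; lia.
apply: (le_trans (ler_normD _ _)); rewrite normrX !normrM normr_nat expr2.
have h1 : `|seg (k * m) j x| * `|seg (k * m) j x| <= H x * H x by exact: ler_pM.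
have h2 : `|blk X m k x| * `|seg (k * m) j x| <= H x * H x by exact: ler_pM.
by rewrite -mulrA; lra.
Qed.

(** The error splits into the sum of the block deviations, the incomplete block,
    the mean of the latter, and the bias. *)
Theorem running_var_max : p <= 4 -> exists2 C, 0 <= C & forall n m,
  (0 < m)%N -> (0 < n)%N ->
  norm_le nu (p / 2)
    (fun x => \big[Num.max/0]_(1 <= j < n.+1)
                `|running_var X m n j x - var_sum j|)
    (C * (n%:R `^ (2 / p) * m%:R `^ 2^-1 + n%:R * m%:R `^ (- A))).
Proof.
move=> p4; have [C1 C10 H1] := blk_dev_max p4.
have [C2 C20 H2] := partial_sq_max p4.
have B0 : 0 <= 2 * (th 0 * K0).
  by rewrite mulr_ge0// mulr_ge0 ?(th_ge0 sm) ?(sm_K0 sm).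
exists (C1 + C2 + C2 + 2 * (th 0 * K0)); first by rewrite !addr_ge0.
move=> n m m0 n0; set a := n%:R `^ (2 / p) * m%:R `^ 2^-1.
set b := n%:R * m%:R `^ (- A).
have a0 : 0 <= a by rewrite mulr_ge0 ?powR_ge0.
have b0 : 0 <= b by rewrite mulr_ge0 ?powR_ge0.
pose K := (n %/ m)%N.
have [G [nG HG]] := H2 n m m0 n0; rewrite -/a in nG.
have nV := H1 m K m0.
have nc := norm_le_cst nu (p / 2) (C2 * a + 2 * (th 0 * K0) * b).
have nT := norm_leD (ltW q1) (norm_leD (ltW q1) nV nG) nc.
have c0 : 0 <= C2 * a + 2 * (th 0 * K0) * b.
  exact: addr_ge0 (mulr_ge0 C20 a0) (mulr_ge0 B0 b0).
rewrite (ger0_norm c0) in nT.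
have err j x : (j <= n)%N -> `|running_var X m n j x - var_sum j| <=
    runmax (blk_dev nu X m) K x + G x + (C2 * a + 2 * (th 0 * K0) * b).
  move=> jn; pose k := (j %/ m)%N.
  have kK : (k <= K)%N by exact: leq_div2r.
  have kj : (k * m <= j)%N by exact: leq_trunc_div.
  have iP := integrable_partial_sq inv sm m k j.
  have iV (i : nat) : (i < k)%N -> nu.-integrable setT (EFin \o blk_sq X m i).
    by move=> _; exact: (integrable_blk_sq inv sm).
  have [iVS eVS] := Rintegral_sum_ord iV.
  have bias := bias_le inv sm m0 kj; rewrite -/(var_sum j) in bias.
  rewrite (RintegralD measurableT iVS iP) eVS in bias.
  have nP : norm_le nu (p / 2) (partial_sq X m k j) (C2 * a).
    apply: norm_le_dom nG => //.
      by have /integrableP[/measurable_EFinP] := iP.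
    by move=> y; apply: (le_trans (HG j y jn)); exact: ler_norm.
  have mP := norm_le_Rintegral (ltW q1) nP.
  have psE : psum (blk_dev nu X m) k x =
      \sum_(i < k) blk_sq X m i x - \sum_(i < k) \int[nu]_y blk_sq X m i y.
    by rewrite /psum /blk_dev sumrB.
  have psle : `|psum (blk_dev nu X m) k x| <= runmax (blk_dev nu X m) K x.
    by rewrite /runmax; apply: (le_bigmax_seq 0 k); rewrite ?mem_index_iota.
  rewrite (running_varE X m x jn) -/k.
  have Gx := HG j x jn; rewrite -/k in Gx.
  have jb : j%:R * m%:R `^ (- A) <= b by rewrite ler_wpM2r ?powR_ge0// ler_nat.
  have bias' := le_trans bias (ler_wpM2l B0 jb).
  have -> : \sum_(i < k) blk_sq X m i x + partial_sq X m k j x - var_sum j =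
    psum (blk_dev nu X m) k x + partial_sq X m k j x - \int[nu]_y partial_sq X m k j y +
    (\sum_(i < k) \int[nu]_y blk_sq X m i y + \int[nu]_y partial_sq X m k j y - var_sum j).
    by rewrite psE; ring.
  apply: (le_trans (ler_normD _ _)); rewrite [leRHS]addrA; apply: lerD; last exact: bias'.
  apply: (le_trans (ler_normB _ _)); apply: lerD; last exact: mP.
  exact: le_trans (ler_normD _ _) (lerD psle Gx).
apply: (norm_leW q0 (c := C1 * (K%:R `^ (2 / p) * m%:R) + C2 * a +
    (C2 * a + 2 * (th 0 * K0) * b))).
  have Ka : C1 * (K%:R `^ (2 / p) * m%:R) <= C1 * a.
    by rewrite ler_wpM2l//; exact: block_count_le.
  have : 0 <= (C1 + C2 + C2) * b by rewrite mulr_ge0// !addr_ge0.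
  have : 0 <= 2 * (th 0 * K0) * a by rewrite mulr_ge0.
  by move: Ka; set t := 2 * (th 0 * K0); lra.
apply: norm_le_dom nT => //.
  apply: (measurable_bigmaxr (F := fun j x => running_var X m n j x - var_sum j)) => j.
  rewrite mem_index_iota => /andP[_ jn]; apply: measurable_funB => //.
  rewrite (_ : running_var X m n j = fun x =>
     \sum_(i < j %/ m) blk_sq X m i x + partial_sq X m (j %/ m) j x); last first.
    by apply/funext => x; rewrite (running_varE X m (n := n))// -ltnS.
  apply: measurable_funD.
    apply: measurable_sum => i.
    by have /integrableP[/measurable_EFinP] := integrable_blk_sq inv sm m i.
  by have /integrableP[/measurable_EFinP] := integrable_partial_sq inv sm m (j %/ m) j.
move=> x; rewrite ger0_norm; last first.
  by elim/big_ind: _ => // u v u0 v0; rewrite le_max u0.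
rewrite big_seq; apply: (le_trans _ (ler_norm _)); apply: bigmax_le.
  have G0 : 0 <= G x by apply: le_trans (HG 0%N x (leq0n n)).
  by rewrite addr_ge0// addr_ge0// runmax_ge0.
by move=> j; rewrite mem_index_iota => /andP[_ jn]; exact: err.
Qed.

End running_variance_bound.

(** * The law of the innovations *)

Section law.
Context {d d' : measure_display} {Omega : measurableType d} {T : measurableType d'}.
Context {R : realType} (P : probability Omega R).
Variables (f : Omega -> T) (mf : measurable_fun setT f).

Let f_mfun : {mfun Omega >-> T} := HB.pack f (isMeasurableFun.Build _ _ _ _ f mf).

Definition law : probability T R := distribution P f_mfun.

Lemma lawE (A : set T) : law A = P (f @^-1` A).
Proof. by []. Qed.

Lemma ge0_integral_law (g : T -> \bar R) : measurable_fun setT g ->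
  (forall x, 0 <= g x)%E -> (\int[law]_x g x = \int[P]_w g (f w))%E.
Proof. by move=> mg g0; rewrite /law ge0_integral_distribution. Qed.

Lemma norm_le_law r (g : T -> R) c : measurable_fun setT g ->
  norm_le law r g c <-> norm_le P r (g \o f) c.
Proof.
move=> mg; have E : (\int[law]_x (`|g x| `^ r)%:E = \int[P]_w (`|g (f w)| `^ r)%:E)%E.
  rewrite ge0_integral_law//; first exact: measurable_EFin_powR.
split=> -[_ c0 H].
  by split; [exact: measurableT_comp|exact: c0|rewrite -E].
by split; [exact: mg|exact: c0|rewrite E].
Qed.

Lemma integrable_law (g : T -> R) : measurable_fun setT g ->
  P.-integrable setT (EFin \o (g \o f)) -> law.-integrable setT (EFin \o g).
Proof.
move=> mg /integrableP[_ H]; apply/integrableP; split; first exact/measurable_EFinP.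
rewrite ge0_integral_law//; apply: measurableT_comp => //; exact/measurable_EFinP.
Qed.

Lemma integral_law (g : T -> R) : measurable_fun setT g ->
  (\int[law]_x (g x)%:E = \int[P]_w (g (f w))%:E)%E.
Proof.
move=> mg; have mg' : measurable_fun setT (EFin \o g) by exact/measurable_EFinP.
rewrite integralE [RHS]integralE; congr (_ - _)%E.
  rewrite ge0_integral_law//; last exact: measurable_funepos.
  by apply: eq_integral => x _; rewrite !funeposE.
rewrite ge0_integral_law//; last exact: measurable_funeneg.
by apply: eq_integral => x _; rewrite !funenegE.
Qed.

End law.

Section cylinders.
Context {d' : measure_display} {E : measurableType d'} {R : realType} {I : eqType}.

Definition cylinder (s : seq I) (A : I -> set E) : set (prod_space I E) :=
  \bigcap_(i in [set` s]) ((fun x : prod_space I E => x i) @^-1` A i).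

Lemma measurable_cylinder s A : (forall i, measurable (A i)) ->
  measurable (cylinder s A).
Proof.
move=> mA; apply: fin_bigcap_measurable; first exact: finite_seq.
move=> i _; rewrite -[X in measurable X]setTI.
exact: measurable_coord.
Qed.

(** Cylinders are stable under intersection and generate the sigma-algebra. *)
Lemma cylinder_unique (m1 m2 : probability (prod_space I E) R) :
  (forall s A, uniq s -> (forall i, measurable (A i)) ->
    m1 (cylinder s A) = m2 (cylinder s A)) ->
  forall B, measurable B -> m1 B = m2 B.
Proof.
move=> m12 B mB.
pose G : set (set (prod_space I E)) := [set C | exists s A,
  [/\ uniq s, forall i, measurable (A i) & C = cylinder s A]].
have GT : G setT.
  exists [::], (fun=> setT); split => //.
  by apply/seteqP; split.
apply: (measure_unique G (fun=> setT)) => //.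
- apply/seteqP; split => C.
    apply: smallest_sub; first exact: smallest_sigma_algebra.
    move=> _ [i _ [D mD <-]]; apply: sub_sigma_algebra.
    exists [:: i], (fun=> D); split => //.
    rewrite setTI; apply/seteqP; split => x /=.
      by move=> Dx j /=; rewrite inE => /eqP ->.
    by apply; rewrite /= inE.
  apply: smallest_sub; first exact: sigma_algebra_measurable.
  by move=> _ [s [A [_ mA ->]]]; exact: measurable_cylinder.
- move=> _ _ [s [A [us mA ->]]] [t [A' [ut mA' ->]]].
  pose C i : set E := (if i \in s then A i else setT) `&` (if i \in t then A' i else setT).
  exists (undup (s ++ t)), C; split; first exact: undup_uniq.
    by move=> i; apply: measurableI; case: ifP.
  apply/seteqP; split => x /=.
    move=> [sx tx] i _; split => /=.
      by case: ifPn => // si; exact: sx.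
    by case: ifPn => // ti; exact: tx.
  move=> Cx; split=> i /= i_s.
    have [] := Cx i _; first by rewrite /= mem_undup mem_cat i_s.
    by rewrite i_s.
  have [] := Cx i _; first by rewrite /= mem_undup mem_cat i_s orbT.
  by rewrite i_s.
- by apply/seteqP; split => // x _; exists 0%N.
- by move=> _ [s [A [us mA ->]]]; exact: m12.
- by move=> k; apply: (le_lt_trans (probability_le1 _ _)); rewrite ?ltry.
Qed.

End cylinders.

Section iid_law.
Context {d d' : measure_display} {Omega : measurableType d} {E : measurableType d'}.
Context {R : realType} (P : probability Omega R) (Y : int + int -> Omega -> E).
Hypothesis iidY : iid P Y.
Notation S := (prod_space int E).

Let mY i : measurable_fun setT (Y i). Proof. by have [] := iidY. Qed.

Definition copy1 w : S := fun i => Y (inl i) w.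
Definition copy2 w : S := fun i => Y (inr i) w.
Definition both w : prod_space (int + int) E := fun k => Y k w.

Lemma measurable_copy1 : measurable_fun setT copy1.
Proof. by apply: measurable_to_prod => i; exact: mY. Qed.

Lemma measurable_copy2 : measurable_fun setT copy2.
Proof. by apply: measurable_to_prod => i; exact: mY. Qed.

Definition relabel (B : int -> bool) (k : int + int) : int + int :=
  match k with
  | inl i => if B i then inl i else inr i
  | inr i => if B i then inr i else inl i
  end.

Lemma relabelK B : involutive (relabel B).
Proof. by case=> i /=; case: ifPn => Bi /=; rewrite ?Bi ?(negbTE Bi). Qed.

Definition both_relabel B w : prod_space (int + int) E := fun k => Y (relabel B k) w.

Lemma measurable_both_relabel B : measurable_fun setT (both_relabel B).
Proof. by apply: measurable_to_prod => i; exact: mY. Qed.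

Lemma measurable_both : measurable_fun setT both.
Proof. by apply: measurable_to_prod => i; exact: mY. Qed.

(** An i.i.d. family is exchangeable, and relabelling permutes its indices. *)
Lemma law_relabel B C : measurable C ->
  law P (measurable_both_relabel B) C = law P measurable_both C.
Proof.
move=> mC; apply: (cylinder_unique (m1 := law P (measurable_both_relabel B))
  (m2 := law P measurable_both) _ mC) => s A us mA.
rewrite [LHS]lawE [RHS]lawE.
have [_ idY indY] := iidY.
transitivity (\prod_(k <- s) P (Y k @^-1` A k))%E; last first.
  by rewrite -indY//; congr (P _); rewrite /cylinder preimage_bigcap.
have us' : uniq (map (relabel B) s) by rewrite map_inj_uniq//; exact: inv_inj (relabelK B).
have mA' k : measurable (A (relabel B k)) by [].
transitivity (P (\bigcap_(k in [set` map (relabel B) s]) (Y k @^-1` A (relabel B k)))).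
  congr (P _); apply/seteqP; split => w /=.
    move=> H k /= /mapP[j js ->]; rewrite relabelK.
    exact: H.
  by move=> H k /= ks; have := H _ (map_f (relabel B) ks); rewrite relabelK.
rewrite (indY _ (fun k => A (relabel B k)))// big_map; apply: eq_bigr => k _.
by rewrite relabelK; exact: idY.
Qed.

Definition nu : probability S R := law P measurable_copy1.

Definition unfold (z : S * S) : prod_space (int + int) E :=
  fun k => match k with inl i => z.1 i | inr i => z.2 i end.

Definition refold (x : prod_space (int + int) E) : S * S :=
  (fun i => x (inl i), fun i => x (inr i)).

Lemma measurable_unfold : measurable_fun setT unfold.
Proof.
apply: measurable_to_prod => -[i|i].
  exact: measurableT_comp (measurable_coord i) measurable_fst.
exact: measurableT_comp (measurable_coord i) measurable_snd.
Qed.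

Lemma measurable_refold : measurable_fun setT refold.
Proof.
apply: measurable_fun_pair; apply: measurable_to_prod => i; exact: measurable_coord.
Qed.

(** The two copies are independent with the same law: the indices of a cylinder
    split between them. *)
Lemma law_unfold C : measurable C ->
  law (nu \x nu)%E measurable_unfold C = law P measurable_both C.
Proof.
move=> mC; apply: (cylinder_unique (m1 := law (nu \x nu)%E measurable_unfold)
  (m2 := law P measurable_both) _ mC) => s A us mA.
rewrite [LHS]lawE [RHS]lawE.
have [_ idY indY] := iidY.
transitivity (\prod_(k <- s) P (Y k @^-1` A k))%E; last first.
  by rewrite -indY//; congr (P _); rewrite /cylinder preimage_bigcap.
pose left (k : int + int) := if k is inl i then Some i else None.
pose right (k : int + int) := if k is inr i then Some i else None.
have m1 l i : (i \in pmap left l) = (inl i \in l).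
  by elim: l => //= -[j|j] l IH; rewrite /= !inE IH.
have m2 l i : (i \in pmap right l) = (inr i \in l).
  by elim: l => //= -[j|j] l IH; rewrite /= !inE IH.
pose s1 := pmap left s; pose s2 := pmap right s.
have u1 : uniq s1.
  rewrite /s1; move: us; elim: (s) => //= -[j|j] l IH /andP[jl ul]; last exact: IH.
  by rewrite /= IH// andbT m1.
have u2 : uniq s2.
  rewrite /s2; move: us; elim: (s) => //= -[j|j] l IH /andP[jl ul]; first exact: IH.
  by rewrite /= IH// andbT m2.
have -> : unfold @^-1` cylinder s A =
    cylinder s1 (fun i => A (inl i)) `*` cylinder s2 (fun i => A (inr i)).
  apply/seteqP; split => -[x y] /=.
    by move=> H; split=> i /= is_; [apply: (H (inl i)); rewrite /= -m1|apply: (H (inr i)); rewrite /= -m2].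
  by move=> [H1 H2] [i|i] /= ik; [apply: H1; rewrite /= m1|apply: H2; rewrite /= m2].
transitivity (nu (cylinder s1 (fun i => A (inl i))) *
    nu (cylinder s2 (fun i => A (inr i))))%E.
  by apply: product_measure1E; exact: measurable_cylinder.
have c1 : nu (cylinder s1 (fun i => A (inl i))) = (\prod_(i <- s1) P (Y (inl i) @^-1` A (inl i)))%E.
  have u1' : uniq (map inl s1 : seq (int + int)) by rewrite map_inj_uniq// => a b [].
  rewrite /nu lawE; have := indY _ A u1' mA; rewrite big_map => <-; congr (P _).
  apply/seteqP; split => w /= H.
    by move=> _ /= /mapP[i is1 ->]; exact: H.
  by move=> i /= is1; apply: (H (inl i)); rewrite /= map_f.
have c2 : nu (cylinder s2 (fun i => A (inr i))) = (\prod_(i <- s2) P (Y (inr i) @^-1` A (inr i)))%E.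
  have u2' : uniq (map inl s2 : seq (int + int)) by rewrite map_inj_uniq// => a b [].
  pose A' (k : int + int) := if k is inl i then A (inr i) else setT.
  have mA' k : measurable (A' k) by case: k => i /=.
  rewrite /nu lawE.
  transitivity (\prod_(i <- s2) P (Y (inl i) @^-1` A (inr i)))%E; last first.
    by apply: eq_bigr => i _; exact: idY.
  have := indY _ A' u2' mA'; rewrite big_map => <-; congr (P _).
  apply/seteqP; split => w /= H.
    by move=> _ /= /mapP[i is1 ->]; exact: H.
  by move=> i /= is1; apply: (H (inl i)); rewrite /= map_f.
rewrite c1 c2 /s1 /s2; elim: (s) => [|[i|i] l IH]; first by rewrite !big_nil mule1.
  by rewrite /= !big_cons -IH muleA.
by rewrite /= !big_cons -IH muleCA.
Qed.

Lemma integral_both (F : S * S -> \bar R) : measurable_fun setT F ->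
  (forall z, 0 <= F z)%E ->
  (\int[nu \x nu]_z F z = \int[P]_w F (copy1 w, copy2 w))%E.
Proof.
move=> mF F0; have mF' := measurableT_comp mF measurable_refold.
transitivity (\int[law (nu \x nu)%E measurable_unfold]_x (F \o refold) x)%E.
  rewrite ge0_integral_law//; last by move=> x; exact: F0.
  by apply: eq_integral => -[x y] _.
transitivity (\int[law P measurable_both]_x (F \o refold) x)%E.
  by apply: eq_measure_integral => C mC _; exact: law_unfold.
by rewrite ge0_integral_law//; last by move=> x; exact: F0.
Qed.

Lemma iid_mix_invariant : mix_invariant nu.
Proof.
move=> B F mF F0.
have mF' := measurableT_comp mF measurable_refold.
rewrite integral_both//; last exact: measurableT_comp mF (measurable_mix_pair B).
rewrite integral_both//.
transitivity (\int[law P (measurable_both_relabel B)]_x (F \o refold) x)%E.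
  rewrite ge0_integral_law//; last by move=> x; exact: F0.
  apply: eq_integral => w _; congr F; congr (_, _); apply/funext => i;
    by rewrite /mix /both_relabel /=; case: (B i).
transitivity (\int[law P measurable_both]_x (F \o refold) x)%E.
  by apply: eq_measure_integral => C mC _; exact: law_relabel.
by rewrite ge0_integral_law//; last by move=> x; exact: F0.
Qed.

End iid_law.

(** * The causal process *)

Lemma limn_esup_le_near (R : realType) (u : nat -> \bar R) (l : \bar R) :
  (\forall n \near \oo, (u n <= l)%E) -> (limn_esup u <= l)%E.
Proof.
move=> [N _ HN]; rewrite limn_esup_lim; apply: lime_le; first exact: is_cvg_esups.
exists N => // n /= Nn; apply: ge_ereal_sup => _ [k /= nk <-].
by apply: HN; exact: leq_trans nk.
Qed.

Section causal_process.
Context {d d' : measure_display} {Omega : measurableType d}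
  {E : measurableType d'} {R : realType}.
Variables (P : probability Omega R) (e e' : int -> Omega -> E)
  (g : nat -> past_space E -> R) (p A : R).
Let Y (s : int + int) := match s with inl i => e i | inr i => e' i end.
Hypothesis iid_e : iid P Y.
Hypothesis g_meas : forall t, (1 <= t)%N -> measurable_fun setT (g t).
Hypothesis X_int : forall t, (1 <= t)%N ->
  P.-integrable setT (EFin \o causal g e t).
Hypothesis X_mean0 : forall t, (1 <= t)%N -> ('E_P[causal g e t] = 0)%E.
Hypothesis p_gt2 : 2 < p.
Hypothesis A_gt1 : 1 < A.
Hypothesis Theta0_fin : (Theta P g e e' p 0 < +oo)%E.
Hypothesis Theta_decay : (ereal_sup [set (((i.+1)%:R `^ A)%:E * Theta P g e e' p i)%E
                              | i in [set: nat]] < +oo)%E.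
Notation S := (prod_space int E).
Let X := causal g e.
Let nuY := nu iid_e.

(** The process on the space of two-sided sequences, where coordinates can be
    replaced by independent ones. *)
Definition on_space t (x : S) : R := g t (fun k : nat => x (t%:Z - k%:Z)).

Lemma measurable_on_space t : (1 <= t)%N -> measurable_fun setT (on_space t).
Proof.
move=> t1; apply: measurableT_comp (g_meas t1) _.
by apply: measurable_to_prod => k; exact: measurable_coord.
Qed.

Lemma measurable_causal t : (1 <= t)%N -> measurable_fun setT (causal g e t).
Proof.
move=> t1.
exact: measurableT_comp (measurable_on_space t1) (measurable_copy1 iid_e).
Qed.

Lemma coupled_on_space t k w : coupled g e e' t k w =
  on_space t (mix (fun i => i != t%:Z - k%:Z) (copy1 Y w) (copy2 Y w)).
Proof.
congr (g t); apply/funext => j; rewrite /mix /copy1 /copy2 /=.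
by have [->|jk] := eqVneq j k; [rewrite eqxx|rewrite ifT//; lia].
Qed.

Local Notation delta := (delta P g e e' p).
Local Notation Theta := (Theta P g e e' p).

Lemma delta_ge0 k : (0 <= delta k)%E.
Proof.
apply: le_trans (ereal_sup_ubound _); last by exists 1%N.
exact: Lnorm_ge0.
Qed.

Lemma sum_delta_le k l : (\sum_(k <= i < k + l) delta i <= Theta k)%E.
Proof. by apply: nneseries_lim_ge => n _ _; exact: delta_ge0. Qed.

Lemma delta_fin k : delta k \is a fin_num.
Proof.
rewrite ge0_fin_numE ?delta_ge0//; apply: le_lt_trans Theta0_fin.
apply: le_trans (sum_delta_le 0 k.+1); rewrite add0n big_nat_recr//=.
by rewrite leeDr// sume_ge0// => i _; exact: delta_ge0.
Qed.

Lemma Theta_ge0 k : (0 <= Theta k)%E.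
Proof. by have := sum_delta_le k 0; rewrite addn0 big_geq. Qed.

Lemma Theta_fin k : Theta k \is a fin_num.
Proof.
rewrite ge0_fin_numE ?Theta_ge0// ltey; apply/eqP => Tk.
suff : (+oo < +oo :> \bar R)%E by rewrite ltxx.
apply: le_lt_trans Theta_decay; apply: ereal_sup_ubound; exists k => //.
by rewrite Tk gt0_muley// lte_fin powR_gt0.
Qed.

Definition decay_const : R := fine (ereal_sup [set (((i.+1)%:R `^ A)%:E * Theta i)%E
                              | i in [set: nat]]).

Lemma decay_fin : ereal_sup [set (((i.+1)%:R `^ A)%:E * Theta i)%E
                              | i in [set: nat]] \is a fin_num.
Proof.
rewrite ge0_fin_numE//; apply: le_trans (ereal_sup_ubound _); last by exists 0%N.
by rewrite mule_ge0 ?Theta_ge0// lee_fin powR_ge0.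
Qed.

Lemma decay_const_ge0 : 0 <= decay_const.
Proof.
apply: fine_ge0; apply: le_trans (ereal_sup_ubound _); last by exists 0%N.
by rewrite mule_ge0 ?Theta_ge0// lee_fin powR_ge0.
Qed.

Lemma fine_Theta_le k : fine (Theta k) <= decay_const * k.+1%:R `^ (- A).
Proof.
rewrite powRN ler_pdivlMr ?powR_gt0// mulrC -lee_fin EFinM fineK ?Theta_fin//.
rewrite /decay_const fineK ?decay_fin//.
by apply: ereal_sup_ubound; exists k.
Qed.

Lemma sum_fine_delta_le k l : \sum_(i < l) fine (delta (k + i)) <= fine (Theta k).
Proof.
rewrite -lee_fin fineK ?Theta_fin//; apply: le_trans (sum_delta_le k l).
rewrite -sumEFin -{2}[k]addn0 addnC big_addn addnC addnK big_mkord le_eqVlt.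
apply/orP; left; apply/eqP; apply: eq_bigr => i _.
by rewrite fineK ?delta_fin// addnC.
Qed.

Lemma coupled_le_delta t k : (1 <= t)%N ->
  norm_le P p (fun w => causal g e t w - coupled g e e' t k w) (fine (delta k)).
Proof.
move=> t1; have p0 : 0 < p by have := p_gt2; lra.
apply/norm_leP => //.
- apply: measurable_funB; first exact: measurable_causal.
  have -> : coupled g e e' t k = on_space t \o
      (fun w => mix (fun i => i != t%:Z - k%:Z) (copy1 Y w) (copy2 Y w)).
    by apply/funext => w; exact: coupled_on_space.
  apply: measurableT_comp (measurable_on_space t1) _.
  exact: (measurableT_comp (measurable_mix (fun i => i != t%:Z - k%:Z))
    (measurable_fun_pair (measurable_copy1 iid_e) (measurable_copy2 iid_e))).
- by apply: fine_ge0; exact: delta_ge0.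
rewrite fineK ?delta_fin//.
by apply: ereal_sup_ubound; exists t.
Qed.

Lemma coupled_le_space t k : (1 <= t)%N -> norm_le (nuY \x nuY)%E p
  (fun z => on_space t z.1 - on_space t (mix (fun i => i != t%:Z - k%:Z) z.1 z.2))
  (fine (delta k)).
Proof.
move=> t1; have [_ c0 H] := coupled_le_delta k t1.
have mG : measurable_fun setT (fun z : S * S =>
    on_space t z.1 - on_space t (mix (fun i => i != t%:Z - k%:Z) z.1 z.2)).
  apply: measurable_funB; first exact: measurableT_comp (measurable_on_space t1) _.
  exact: measurableT_comp (measurable_on_space t1) (measurable_mix _).
split; [exact: mG|exact: c0|apply: le_trans H].
rewrite (integral_both iid_e (measurable_EFin_powR p mG)); last first.
  by move=> z; rewrite lee_fin powR_ge0.
by under [leRHS]eq_integral do rewrite coupled_on_space.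
Qed.

(** Only moments up to order 4 matter for the rate, so p may be lowered to 4. *)
Lemma causal_short_memory : short_memory nuY on_space (Num.min p 4) A decay_const
  (fun k => fine (delta k)) (fun k => fine (Theta k)).
Proof.
have mX t : (0 < t)%N -> measurable_fun setT (on_space t) by exact: measurable_on_space.
split => //.
- by rewrite lt_min p_gt2 ltr_nat.
- exact: decay_const_ge0.
- by move=> t t0 x y xy; congr (g t); apply/funext => k; apply: xy; rewrite /upto; lia.
- by move=> t t0; apply: integrable_law; [exact: mX|exact: X_int].
- move=> t t0; rewrite /Rintegral /nuY /nu integral_law; last exact: mX.
  by have := X_mean0 t0; rewrite unlock => ->.
- move=> t k t0; apply: norm_le_exp (coupled_le_space k t0).
    by rewrite lt_min ltr0n andbT; have := p_gt2; lra.
  by rewrite ge_min lexx.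
- by move=> k l; exact: sum_fine_delta_le.
- by move=> k; exact: fine_Theta_le.
Qed.

Let q : R := Num.min p 4.

Definition varS (i : nat) : R :=
  fine ('E_P[(fun w => partial_sum X i w ^+ 2)%R])%E.

Lemma varSE i : varS i = var_sum nuY on_space i.
Proof.
have [c [ms _ _]] := norm_le_seg (iid_mix_invariant iid_e) causal_short_memory 0 i.
have m2 : measurable_fun setT (fun x => seg on_space 0 i x ^+ 2).
  rewrite (_ : (fun x => _) = seg on_space 0 i \* seg on_space 0 i).
    exact: measurable_funM.
  by apply/funext => x; rewrite expr2.
rewrite /varS /var_sum /Rintegral unlock; congr fine.
rewrite (integral_law P (measurable_copy1 iid_e) m2).
by [].

Qed.

Lemma varS_ge0 i : 0 <= varS i.
Proof. by rewrite varSE; exact: var_sum_ge0. Qed.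

Lemma varS_le : exists2 C, 0 <= C & forall i, varS i <= C * i%:R.
Proof.
have [C C0 HC] := var_sum_le (iid_mix_invariant iid_e) causal_short_memory.
by exists C => // i; rewrite varSE.
Qed.

Lemma min_rate : 2 / q = Num.max (2 / p) (1 / 2).
Proof.
have p2 := p_gt2; rewrite /q; have [p4|p4] := leP p 4.
  by rewrite max_l// ler_pdivlMr; lra.
have -> : 2 / 4 = 1 / 2 :> R by lra.
by rewrite max_r// ler_pdivrMr; lra.
Qed.

Lemma running_var_max_causal : exists2 C, 0 <= C & forall n m,
  (0 < m)%N -> (0 < n)%N ->
  norm_le P (q / 2)
    (fun w => \big[Num.max/0]_(1 <= i < n.+1) `|running_var X m n i w - varS i|)
    (C * (n%:R `^ Num.max (2 / p) (1 / 2) * m%:R `^ (1 / 2) +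
          n%:R * m%:R `^ (- A))).
Proof.
have q4 : q <= 4 by rewrite /q ge_min lexx orbT.
have [C C0 HC] :=
  running_var_max (iid_mix_invariant iid_e) causal_short_memory q4.
exists C => // n m m0 n0; have H := HC n m m0 n0.
have mf := norm_le_measurable H.
have := (norm_le_law P (measurable_copy1 iid_e) _ _ mf).1 H.
rewrite -/q min_rate div1r; apply: norm_le_eq => w /=.
by apply: eq_bigr => i _; rewrite varSE.
Qed.

(** Markov's inequality with the exponent q/2, which is at least one. *)
Lemma running_var_tight (eps : R) : 0 < eps -> exists2 M, 0 <= M & forall n m,
  (0 < m)%N -> (0 < n)%N ->
  (P [set w | M * (n%:R `^ Num.max (2 / p) (1 / 2) * m%:R `^ (1 / 2) +
                   n%:R * m%:R `^ (- A)) <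
              `|\big[Num.max/0]_(1 <= i < n.+1)
                  `|running_var X m n i w - varS i| |]%R <= eps%:E)%E.
Proof.
move=> eps0; have [C C0 HC] := running_var_max_causal.
have q1 : 1 < q / 2.
  by rewrite ltr_pdivlMr// mul1r lt_min p_gt2/= ltr_nat.
pose a : R := Num.min eps 1.
have a0 : 0 < a by rewrite lt_min eps0/=.
have a1 : a <= 1 by rewrite ge_min lexx orbT.
have C1 : 0 < C + 1 by rewrite ltr_wpDl.
exists ((C + 1) / a) => [|n m m0 n1]; first by rewrite ltW// divr_gt0.
set r := (_ `^ _ * _ + _); have r0 : 0 < r.
  by rewrite addr_gt0// mulr_gt0// ?powR_gt0 ?ltr0n.
have t0 : 0 < (C + 1) / a * r by rewrite mulr_gt0// divr_gt0.
have q0 : 0 < q / 2 by exact: lt_trans ltr01 q1.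
have rC : C * r <= (C + 1) * r by rewrite ler_wpM2r ?lerDl// ltW.
have H := norm_leW q0 rC (HC n m m0 n1).
apply: le_trans (norm_le_markov q0 t0 H) _.
rewrite lee_fin; have -> : (C + 1) * r / ((C + 1) / a * r) = a.
  by field; rewrite !gt_eqF.
apply: (@le_trans _ _ a); last by rewrite ge_min lexx.
by apply: ge1r_powR; rewrite ?a0// ltW.
Qed.

Lemma running_var_rate (m : nat -> nat) : (forall n, (0 < m n)%N) ->
  bigO_prob P
    (fun n w => \big[Num.max/0]_(1 <= i < n.+1)
                  `|running_var X (m n) n i w - varS i|)
    (fun n => n%:R `^ Num.max (2 / p) (1 / 2) * (m n)%:R `^ (1 / 2) +
              n%:R * (m n)%:R `^ (- A)).
Proof.
move=> m0 eps eps0; have [M _ HM] := running_var_tight eps0.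
exists M; apply: limn_esup_le_near; exists 1%N => // n /= n1.
exact: HM.
Qed.

End causal_process.

(** * Modulus of continuity of Brownian motion *)

Section normal_tail.
Context {R : realType}.

(** The density with standard deviation [s] is at most
    2 exp(- 3 a^2 / (8 s^2)) times the density with standard deviation [2 s]
    outside [-a, a], and the latter has total mass one. *)
Lemma normal_tail (s a : R) : 0 < s -> 0 <= a ->
  (normal_prob 0 s [set x | a < `|x|]%R <=
   (2 * expR (- (3 / 8 * (a / s) ^+ 2)))%:E)%E.
Proof.
move=> s0 a0; pose c := 2 * expR (- (3 / 8 * (a / s) ^+ 2)).
have s2 : 0 < 2 * s by rewrite mulr_gt0.
have c0 : 0 <= c by rewrite mulr_ge0// expR_ge0.
have mA : measurable [set x : R | a < `|x|] by exact: measurable_normr_gt.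
have mpdf t : measurable_fun [set: R] (fun x => (normal_pdf 0 t x)%:E).
  by apply/measurable_EFinP; exact: measurable_normal_pdf.
have mc : measurable_fun [set: R] (fun x => c%:E * (normal_pdf 0 (2 * s) x)%:E)%E.
  apply/measurable_EFinP; apply: measurable_funM; first exact: measurable_cst.
  exact: measurable_normal_pdf.
have sq : Num.sqrt ((2 * s) ^+ 2 * pi *+ 2) = 2 * Num.sqrt (s ^+ 2 * pi *+ 2).
  by rewrite exprMn -mulrA -mulrnAr sqrtrM ?sqr_ge0// sqrtr_sqr ger0_norm//.
have H x : a < `|x| -> normal_pdf 0 s x <= c * normal_pdf 0 (2 * s) x.
  move=> ax; rewrite !normal_pdfE ?gt_eqF// /normal_peak sq invfM /normal_fun.
  rewrite !subr0 /c; set k := (Num.sqrt _)^-1.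
  have k0 : 0 <= k by rewrite invr_ge0 sqrtr_ge0.
  set E1 := expR _; set E2 := expR _; set E3 := expR _.
  have -> : 2 * E2 * (2^-1 * k * E3) = k * (E2 * E3) by field.
  rewrite ler_wpM2l// /E1 /E2 /E3 -expRD ler_expR.
  have -> : - x ^+ 2 / (s ^+ 2 *+ 2) = - (3 / 8 * (x / s) ^+ 2) +
     - x ^+ 2 / ((2 * s) ^+ 2 *+ 2).
    by field; rewrite gt_eqF.
  rewrite lerD2r lerN2 ler_wpM2l ?divr_ge0// !expr_div_n.
  rewrite ler_wpM2r ?invr_ge0 ?sqr_ge0// -(real_normK (num_real x)).
  by rewrite lerXn2r// ?nnegrE// ltW.
rewrite /normal_prob.
apply: (@le_trans _ _ (\int[lebesgue_measure]_(x in [set x : R | a < `|x|]%R)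
    (c%:E * (normal_pdf 0 (2 * s) x)%:E))%E).
  apply: ge0_le_integral => //.
  - by move=> x _; rewrite lee_fin normal_pdf_ge0.
  - by apply: measurable_funS (mpdf s).
  - by apply: measurable_funS mc.
apply: (@le_trans _ _ (\int[lebesgue_measure]_x
    (c%:E * (normal_pdf 0 (2 * s) x)%:E))%E).
  apply: ge0_subset_integral => //.
  by move=> x _; rewrite -EFinM lee_fin mulr_ge0// normal_pdf_ge0.
have n0 x : [set: R] x -> (0 <= (normal_pdf 0 (2 * s) x)%:E)%E.
  by move=> _; rewrite lee_fin normal_pdf_ge0.
rewrite ge0_integralZl; [|exact: measurableT|exact: mpdf|exact: n0|by rewrite lee_fin].
by rewrite integral_normal_pdf mule1.
Qed.

End normal_tail.

Section dyadic_chaining.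
Context {R : realType}.

(** Sequential continuity on the closed half-line, the form in which path
    continuity composes with scaling and with random times. *)
Definition seq_continuous (f : R -> R) := forall (u : nat -> R) (l : R),
  (forall n, 0 <= u n) -> 0 <= l -> u @ \oo --> l -> f (u n) @[n --> \oo] --> f l.

Lemma within_seq_continuous (f : R -> R) :
  {within `[0, +oo[, continuous f} -> seq_continuous f.
Proof.
move=> /subspace_continuousP fc u l u0 l0 ul.
have /fc fl : `[0, +oo[%classic l by rewrite /= in_itv/= l0.
apply: (cvg_comp u f _ fl) => V /= Vl.
have H : \forall n \near \oo, `[0, +oo[%classic (u n) -> V (u n) := ul _ Vl.
rewrite /nbhs /=; apply: (filterS _ H) => n /=; apply; rewrite in_itv/= u0//.
Qed.

Definition dyadic j (u : R) : R := (Num.truncn (u * 2 ^+ j))%:R / 2 ^+ j.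

Lemma dyadic_ge0 j u : 0 <= dyadic j u.
Proof. by rewrite divr_ge0. Qed.

Lemma dyadic_le j u : 0 <= u -> dyadic j u <= u.
Proof.
move=> u0; rewrite ler_pdivrMr ?exprn_gt0//.
by have /andP[] := truncn_itv (mulr_ge0 u0 (exprn_ge0 j (ler0n R 2))).
Qed.

Lemma dyadic_ge j u : 0 <= u -> u - 2^-1 ^+ j <= dyadic j u.
Proof.
move=> u0; have e0 : 0 < 2 ^+ j :> R by rewrite exprn_gt0.
have /andP[_ a2] := truncn_itv (mulr_ge0 u0 (ltW e0)).
rewrite ler_pdivlMr// exprVn mulrBl mulVf ?gt_eqF// lerBlDr.
by rewrite natr1 ltW.
Qed.

Lemma dyadic_cvg u : 0 <= u -> dyadic n u @[n --> \oo] --> u.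
Proof.
move=> u0; apply: (@squeeze_cvgr _ _ _ _ (fun n => u - 2^-1 ^+ n) (fun=> u)).
- by apply: nearW => n; rewrite dyadic_ge// dyadic_le.
- rewrite -[X in _ --> X]subr0; apply: cvgB; first exact: cvg_cst.
  by apply: cvg_expr; rewrite ger0_norm ?invr_ge0// invf_lt1// ltr1n.
- exact: cvg_cst.
Qed.

Lemma truncn_double (x : R) : 0 <= x -> exists2 b : nat, (b < 2)%N &
  Num.truncn (2 * x) = (2 * Num.truncn x + b)%N.
Proof.
move=> x0; have /andP[a1 a2] := truncn_itv x0.
have x20 : 0 <= 2 * x by rewrite mulr_ge0.
have /andP[b1 b2] := truncn_itv x20.
have c1 : (2 * Num.truncn x <= Num.truncn (2 * x))%N.
  rewrite -ltnS -(ltr_nat R) natrM; apply: le_lt_trans b2.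
  by rewrite ler_pM2l.
have c2 : (Num.truncn (2 * x) < 2 * Num.truncn x + 2)%N.
  rewrite -(ltr_nat R) natrD natrM; apply: le_lt_trans b1 _.
  by rewrite -addn1 natrD in a2; lra.
exists (Num.truncn (2 * x) - 2 * Num.truncn x)%N; last by rewrite subnKC.
by rewrite ltn_subLR.
Qed.


Variables (f : R -> R) (N : nat) (D : R).
Hypothesis fc : seq_continuous f.
Hypothesis D0 : 0 <= D.
Hypothesis step : forall j i, (i < N * 2 ^ j)%N ->
  `|f (i.+1%:R / 2 ^+ j) - f (i%:R / 2 ^+ j)| <= D * (4 / 5) ^+ j.

(** Refining by one level moves the approximating point by at most one step of
    the finer grid, so that the increments form a geometric series. *)
Lemma dyadic_path j u : 0 <= u <= N%:R ->
  `|f (dyadic j u) - f (dyadic 0 u)| <= 4 * D * (1 - (4 / 5) ^+ j).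
Proof.
move=> /andP[u0 uN]; elim: j => [|j IH]; first by rewrite subrr normr0 expr0 subrr mulr0.
have y0 : 0 <= u * 2 ^+ j by rewrite mulr_ge0// exprn_ge0.
have [b b2 E] := truncn_double y0.
have [/= x1 _] := andP (truncn_itv (mulr_ge0 u0 (exprn_ge0 j.+1 (ler0n R 2)))).
have E1 : 2 * (u * 2 ^+ j) = u * 2 ^+ j.+1 by rewrite exprS mulrCA.
rewrite E1 in E; set k := Num.truncn (u * 2 ^+ j) in E *.
have E2 : dyadic j u = (2 * k)%N%:R / 2 ^+ j.+1.
  by rewrite /dyadic -/k exprS natrM -mulf_div mulfV ?mul1r// pnatr_eq0.
have S1 : `|f (dyadic j.+1 u) - f (dyadic j u)| <= D * (4 / 5) ^+ j.+1.
  rewrite {1}/dyadic E2 E; move: b2 E; case: b => [|[|//]] _ E.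
    by rewrite addn0 subrr normr0 mulr_ge0// exprn_ge0// divr_ge0.
  rewrite addn1; apply: step; rewrite -(ler_nat R) -addn1 -E.
  rewrite natrM natrX; apply: le_trans x1 _.
  by rewrite ler_wpM2r// exprn_ge0.
rewrite -(subrKA (f (dyadic j u))); apply: le_trans (ler_normD _ _) _.
apply: le_trans (lerD S1 IH) _; rewrite le_eqVlt; apply/orP; left; apply/eqP.
by rewrite exprS; field.
Qed.

Lemma dyadic_limit u : 0 <= u <= N%:R -> `|f u - f (dyadic 0 u)| <= 4 * D.
Proof.
move=> uN; have /andP[u0 _] := uN.
have c : `|f (dyadic j u) - f (dyadic 0 u)| @[j --> \oo] --> `|f u - f (dyadic 0 u)|.
  apply: cvg_norm; apply: cvgB; last exact: cvg_cst.
  by apply: fc (dyadic_cvg u0) => // n; exact: dyadic_ge0.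
rewrite -(cvg_lim _ c)//; apply: limr_le; first exact: cvgP c.
apply: nearW => j; apply: le_trans (dyadic_path j uN) _.
by rewrite ler_piMr ?mulr_ge0// lerBlDr lerDl exprn_ge0// divr_ge0.
Qed.

(** Two points at distance at most one have integer parts that are equal or
    consecutive, which costs D, and each point is reached from its integer part
    by refining the dyadic approximation, which costs 4 D. *)
Lemma modulus_of_steps u v : 0 <= u <= N%:R -> 0 <= v <= N%:R ->
  `|u - v| <= 1 -> `|f u - f v| <= 9 * D.
Proof.
wlog uv : u v / u <= v.
  move=> H uN vN d; have [uv|/ltW vu] := leP u v; first exact: H.
  by rewrite distrC; apply: H => //; rewrite distrC.
move=> uN vN d; have /andP[u0 _] := uN; have /andP[v0 v1] := vN.
have S0 : `|f (dyadic 0 v) - f (dyadic 0 u)| <= D.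
  rewrite /dyadic expr0 !mulr1 !divr1.
  have /andP[a1 a2] := truncn_itv u0; have /andP[b1 b2] := truncn_itv v0.
  set k := Num.truncn u in a1 a2 *; set l := Num.truncn v in b1 b2 *.
  have kl : (k <= l)%N by rewrite -ltnS -(ltr_nat R); lra.
  have lk : (l <= k.+1)%N.
    rewrite -ltnS -(ltr_nat R) -addn1 natrD.
    by move: d; rewrite ler_distl => /andP[d1 d2]; lra.
  move: kl; rewrite leq_eqVlt => /predU1P[<-|kl]; first by rewrite subrr normr0.
  have -> : l = k.+1 by apply/eqP; rewrite eqn_leq lk.
  have kN : (k < N * 2 ^ 0)%N by rewrite expn0 muln1; apply: leq_trans kl _; rewrite -(ler_nat R); lra.
  by have := step kN; rewrite !expr0 !divr1 mulr1.
have -> : f u - f v = (f u - f (dyadic 0 u)) - (f v - f (dyadic 0 v))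
   - (f (dyadic 0 v) - f (dyadic 0 u)) by ring.
apply: le_trans (ler_normB _ _) _.
have := ler_normB (f u - f (dyadic 0 u)) (f v - f (dyadic 0 v)).
have := dyadic_limit uN; have := dyadic_limit vN; lra.
Qed.

End dyadic_chaining.

Section brownian_modulus.
Context {d : measure_display} {Omega : measurableType d} {R : realType}.
Variables (P : probability Omega R) (B : R -> Omega -> R).
Hypothesis hB : brownian P B.

Lemma brownian_seq_continuous w : seq_continuous (fun t => B t w).
Proof. by case: hB => _ H _ _; have [_ /within_seq_continuous] := H w. Qed.

Lemma brownian_tail s t a : 0 <= s -> s < t -> 0 <= a ->
  (P [set w | a < `|B t w - B s w|]%R <=
   (2 * expR (- (3 / 8 * (a ^+ 2 / (t - s)))))%:E)%E.
Proof.
move=> s0 st a0; have ts : 0 < t - s by rewrite subr_gt0.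
case: hB => _ _ H _.
have mA : measurable [set x : R | a < `|x|] by exact: measurable_normr_gt.
have := H s t s0 st _ mA; rewrite /preimage /= => ->.
have v0 : 0 < Num.sqrt (t - s) by rewrite sqrtr_gt0.
apply: le_trans (normal_tail v0 a0) _.
by rewrite expr_div_n sqr_sqrtr// ltW.
Qed.

Lemma measurable_brownian t : 0 <= t -> measurable_fun setT (B t).
Proof. by case: hB => H _ _ _; exact: H. Qed.

Lemma measurable_increment s t a : 0 <= s -> 0 <= t ->
  measurable [set w | a < `|B t w - B s w|].
Proof.
move=> s0 t0; apply: measurable_normr_gt.
by apply: measurable_funB; exact: measurable_brownian.
Qed.

Variables (h L : R) (N : nat).
Hypotheses (h0 : 0 < h) (L1 : 1 <= L).
(** The constants 6 and 4/5 make the Gaussian exponent at level j at least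
    L + 3 j. *)
Let D := 6 * Num.sqrt (h * L).

Let D0 : 0 <= D. Proof. by rewrite mulr_ge0// sqrtr_ge0. Qed.

Definition bad_step j i : set Omega :=
  [set w | D * (4 / 5) ^+ j < `|B (h * (i.+1%:R / 2 ^+ j)) w - B (h * (i%:R / 2 ^+ j)) w|].

Lemma measurable_bad_step j i : measurable (bad_step j i).
Proof.
by apply: measurable_increment; rewrite mulr_ge0// ?divr_ge0// ltW.
Qed.

(** The variance halves at each level while the squared threshold only shrinks
    by the factor 16/25, so the exponent grows geometrically with the level. *)
Lemma bad_step_le j i : (P (bad_step j i) <= (2 * (expR (- L) * 4^-1 ^+ j))%:E)%E.
Proof.
have e0 : 0 < 2 ^+ j :> R by rewrite exprn_gt0.
have s0 : 0 <= h * (i%:R / 2 ^+ j) by rewrite mulr_ge0// ?divr_ge0// ltW.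
have dE : h * (i.+1%:R / 2 ^+ j) - h * (i%:R / 2 ^+ j) = h / 2 ^+ j.
  by rewrite -mulrBr -mulrBl -natr1 addrAC subrr add0r mul1r.
have st : h * (i%:R / 2 ^+ j) < h * (i.+1%:R / 2 ^+ j).
  by rewrite -subr_gt0 dE divr_gt0.
have a0 : 0 <= D * (4 / 5) ^+ j by rewrite mulr_ge0// exprn_ge0// divr_ge0.
apply: le_trans (brownian_tail s0 st a0) _.
rewrite lee_fin ler_pM2l// dE.
have hL : 0 <= h * L by rewrite mulr_ge0// ltW// (lt_le_trans ltr01).
have -> : 3 / 8 * ((D * (4 / 5) ^+ j) ^+ 2 / (h / 2 ^+ j)) =
    27 / 2 * L * (32 / 25) ^+ j.
  have -> : 32 / 25 = (4 / 5) ^+ 2 * 2 :> R by field.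
  rewrite /D; move: (4 / 5) => r; rewrite !exprMn sqr_sqrtr//.
  set a1 := r ^+ j; set a2 := 2 ^+ j; move: (h0) e0; rewrite -/a2 => h1 e0'.
  by field; rewrite !gt_eqF.
have bern : 1 + j%:R * (7 / 25) <= (32 / 25) ^+ j :> R.
  elim: j {e0 s0 dE st a0} => [|j IH]; first by rewrite mul0r addr0 expr0.
  rewrite exprS -natr1; have : 0 <= j%:R :> R by []. 
  by move=> jj; nra.
have E4 : expR (- (L + 3 * j%:R)) <= expR (- L) * 4^-1 ^+ j.
  rewrite opprD expRD ler_wpM2l ?expR_ge0// expRN.
  rewrite mulrC -[expR _]/(expR (j%:R * 3)) expRM_natl exprVn lef_pV2 ?posrE ?exprn_gt0 ?expR_gt0//.
  by rewrite lerXn2r ?nnegrE ?expR_ge0//; apply: le_trans (expR_ge1Dx _); lra.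
apply: le_trans E4; rewrite ler_expR lerN2.
have : 27 / 2 * L * (1 + j%:R * (7 / 25)) <= 27 / 2 * L * (32 / 25) ^+ j.
  by rewrite ler_wpM2l// mulr_ge0// ?divr_ge0//; exact: le_trans L1.
apply: le_trans; have : 0 <= j%:R :> R by [].
move=> jj; have := L1; nra.
Qed.

Definition bad_level j : set Omega := \big[setU/set0]_(i < N * 2 ^ j) bad_step j i.

Lemma measurable_bad_level j : measurable (bad_level j).
Proof. by apply: bigsetU_measurable => i _; exact: measurable_bad_step. Qed.

Lemma bad_level_le j :
  (P (bad_level j) <= (2 * N%:R * expR (- L) * 2^-1 ^+ j)%:E)%E.
Proof.
apply: (@le_trans _ _ (\sum_(i < N * 2 ^ j) P (bad_step j i))%E).
  apply: content_subadditive => // [k _|]; first exact: measurable_bad_step.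
  exact: measurable_bad_level.
apply: (@le_trans _ _ (\sum_(i < N * 2 ^ j) (2 * (expR (- L) * 4^-1 ^+ j))%:E)%E).
  by apply: lee_sum => i _; exact: bad_step_le.
rewrite sumEFin lee_fin sumr_const card_ord -[leLHS]mulr_natl natrM natrX.
have -> : 4^-1 = 2^-1 * 2^-1 :> R by field.
rewrite exprMn exprVn; set a := 2 ^+ j.
have a0 : a != 0 by rewrite gt_eqF// exprn_gt0.
by rewrite le_eqVlt; apply/orP; left; apply/eqP; field.
Qed.

Definition bad_path : set Omega := \bigcup_j bad_level j.

Lemma measurable_bad_path : measurable bad_path.
Proof. by apply: bigcup_measurable => j _; exact: measurable_bad_level. Qed.

(** Level j has N 2^j steps, each exceptional with probability at most
    2 exp(- L) 4^(-j). *)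
Lemma bad_path_le : (P bad_path <= (4 * N%:R * expR (- L))%:E)%E.
Proof.
have mb j := measurable_bad_level j.
apply: le_trans (measure_sigma_subadditive P mb measurable_bad_path _) _ => //.
apply: lime_le; first by apply: is_cvg_nneseries => n _ _; exact: measure_ge0.
apply: nearW => n; set c := 2 * N%:R * expR (- L).
have c0 : 0 <= c by rewrite mulr_ge0 ?expR_ge0// mulr_ge0.
apply: (@le_trans _ _ (\sum_(0 <= j < n) (c * 2^-1 ^+ j)%:E)%E).
  by apply: lee_sum => j _; exact: bad_level_le.
rewrite sumEFin lee_fin.
have -> : 4 * N%:R * expR (- L) = c * 2 by rewrite /c; ring.
rewrite -mulr_sumr ler_wpM2l//.
suff -> : \sum_(0 <= j < n) 2^-1 ^+ j = 2 - 2 * 2^-1 ^+ n :> R.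
  by rewrite gerBl mulr_ge0// exprn_ge0// invr_ge0.
elim: n => [|n IH]; first by rewrite big_nil expr0; ring.
by rewrite big_nat_recr//= IH exprS; field.
Qed.

(** Rescaling time by h turns the steps of the path into those of a function on
    [0, N] to which chaining applies. *)
Lemma brownian_modulus w (s t : R) : ~ bad_path w ->
  0 <= s <= h * N%:R -> 0 <= t <= h * N%:R -> `|s - t| <= h ->
  `|B s w - B t w| <= 54 * Num.sqrt (h * L).
Proof.
move=> nb sN tN st.
have hK x : x = h * (x / h) by rewrite mulrC divfK// gt_eqF.
have scale x : 0 <= x <= h * N%:R -> 0 <= x / h <= N%:R.
  by move=> /andP[x0 xN]; rewrite divr_ge0 ?(ltW h0)//= ler_pdivrMr// mulrC.
have fc : seq_continuous (fun u => B (h * u) w).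
  move=> u l u0 l0 ul; apply: (@brownian_seq_continuous w (fun n => h * u n)).
  - by move=> n; rewrite mulr_ge0// ltW.
  - by rewrite mulr_ge0// ltW.
  - by apply: cvgM ul; exact: cvg_cst.
have steps j i : (i < N * 2 ^ j)%N ->
    `|B (h * (i.+1%:R / 2 ^+ j)) w - B (h * (i%:R / 2 ^+ j)) w| <= D * (4 / 5) ^+ j.
  move=> iN; rewrite leNgt; apply/negP => b; apply: nb; exists j => //.
  by rewrite /bad_level -bigcup_mkord; exists i.
have := modulus_of_steps fc D0 steps (scale s sN) (scale t tN).
rewrite -!hK -mulrBl normrM [ `|h^-1|]ger0_norm ?invr_ge0 ?(ltW h0)//.
rewrite ler_pdivrMr// mul1r => /(_ st).
by rewrite /D mulrA -natrM.
Qed.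

End brownian_modulus.

(** * Conditional probabilities *)

Section conditional_probability.
Context {d : measure_display} {Omega : measurableType d} {R : realType}.
Variables (P : probability Omega R) (F : set_system Omega) (A : set Omega).
Hypotheses (mF : F `<=` measurable) (mA : measurable A).

Let T := g_sigma_algebraType F.
Let toT (w : Omega) : T := w.

Let sub_sigma C : <<s F >> C -> measurable C.
Proof.
by apply: smallest_sub => //; exact: sigma_algebra_measurable.
Qed.

Let mtoT : measurable_fun setT toT.
Proof. by move=> _ C mC; rewrite setTI; exact: sub_sigma. Qed.

Let mu : probability T R := law P mtoT.

Let trace (C : set T) : \bar R := P (A `&` C).

Let trace0 : trace set0 = 0%E. Proof. by rewrite /trace setI0 measure0. Qed.

Let trace_fin C : measurable C -> trace C \is a fin_num.
Proof. by move=> mC; apply: fin_num_measure; apply: measurableI mA (sub_sigma mC). Qed.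

Let trace_sigma_additive : semi_sigma_additive trace.
Proof.
move=> G mG tG mUG; rewrite /trace setI_bigcupr.
apply: measure_semi_sigma_additive.
- by move=> n; apply: measurableI mA (sub_sigma (mG n)).
- exact: trivIset_setIl.
- by rewrite -setI_bigcupr; apply: measurableI mA (sub_sigma mUG).
Qed.

HB.instance Definition _ := isCharge.Build _ T R trace
  trace0 trace_fin trace_sigma_additive.

(** Conditional probabilities are Radon-Nikodym densities on the
    sub-sigma-algebra. *)
Lemma cond_prob_exists : exists q, is_cond_prob P F A q.
Proof.
pose nu : {charge set T -> \bar R} := trace.
have dom : nu `<< mu.
  apply/null_content_dominatesP => C mC muC.
  apply/eqP; rewrite eq_le measure_ge0 andbT -[leRHS]muC.
  apply: (@le_measure _ _ _ P); rewrite ?inE//.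
  - exact: measurableI mA (sub_sigma mC).
  - exact: sub_sigma.
pose f := Radon_Nikodym nu mu; pose q (w : T) := fine (f w).
have intf : mu.-integrable setT f := Radon_Nikodym_integrable dom.
have qE w : (q w)%:E = f w by rewrite fineK// Radon_Nikodym_fin_num.
have mf : measurable_fun setT f := measurable_int mu intf.
have mq : measurable_fun setT q.
  by apply: measurableT_comp mf => //; exact: fine_measurable.
have mqT : measurable_fun setT (EFin \o q) by apply/measurable_EFinP.
have intq : mu.-integrable setT (EFin \o q).
  by apply: eq_integrable intf => // w _; rewrite /= qE.
have intP : P.-integrable setT (EFin \o q).
  apply/integrableP; split; first exact: measurableT_comp mqT mtoT.
  move/integrableP : intq => [_]; rewrite ge0_integral_law//.
  exact: measurableT_comp.
exists q; split => // C mC.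
have -> : (\int[P]_(w in C) (q w)%:E = \int[mu]_(w in C) (q w)%:E)%E.
  symmetry; apply: (integral_pushforward mtoT mqT _ mC).
  by apply: integrableS intP => //; exact: sub_sigma.
under eq_integral do rewrite qE.
by rewrite -(Radon_Nikodym_integral dom mC).
Qed.

(** A conditional probability averages to P(A), so that a bound in probability
    passes to the conditional law by Markov's inequality. *)
Lemma cond_prob_markov q (eps : R) : 0 < eps -> is_cond_prob P F A q ->
  (P [set w | eps < q w]%R <= P A * (eps^-1)%:E)%E.
Proof.
move=> e0 [mq iq qE].
have mC : <<s F>> [set w | eps < q w].
  have : measurable [set w : T | eps < q w].
    by rewrite -[X in measurable X]setTI; apply: measurable_fun_ltr.
  by [].
have mC' := sub_sigma mC.
rewrite lee_pdivlMr//.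
apply: (@le_trans _ _ (P (A `&` [set w | eps < q w]))); last first.
  by apply: le_measure; rewrite ?inE//; exact: measurableI.
rewrite -qE// muleC -integral_cst//.
apply: le_integral => //.
- by apply: (integrableS measurableT) => //; exact: finite_measure_integrable_cst.
- exact: integrableS iq.
- by move=> w /= /set_mem /ltW; rewrite lee_fin.
Qed.

End conditional_probability.

(** * Brownian motion at random times *)

Section time_change.
Context {d : measure_display} {Omega : measurableType d} {R : realType}.
Variable P : probability Omega R.

Lemma measurable_truncn_eq (T : Omega -> R) k : measurable_fun setT T ->
  (forall w, 0 <= T w) -> measurable [set w | Num.truncn (T w) = k].
Proof.
move=> mT T0.
have -> : [set w | Num.truncn (T w) = k] =
    [set w | k%:R <= T w] `&` [set w | T w < k.+1%:R].
  apply/seteqP; split=> w /=.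
    by move=> <-; have /andP[] := truncn_itv (T0 w).
  by move=> [a b]; apply: truncn_def; rewrite a.
apply: measurableI; rewrite -[X in measurable X]setTI.
  exact: measurable_fun_ler.
exact: measurable_fun_ltr.
Qed.

(** A random time takes countably many values after dyadic rounding, and path
    continuity removes the rounding. *)
Lemma measurable_time_change (B : R -> Omega -> R) (T : Omega -> R) :
  brownian P B -> measurable_fun setT T -> (forall w, 0 <= T w) ->
  measurable_fun setT (fun w => B (T w) w).
Proof.
move=> hB mT T0.
apply: (measurable_fun_cvg (h := fun n w => B (dyadic n (T w)) w)); last first.
  move=> w _; apply: (brownian_seq_continuous hB) => //.
    by move=> n; exact: dyadic_ge0.
  exact: dyadic_cvg.
move=> n _ C mC; rewrite setTI.
have -> : (fun w => B (dyadic n (T w)) w) @^-1` C =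
    \bigcup_k ([set w | Num.truncn (T w * 2 ^+ n) = k] `&`
               B (k%:R / 2 ^+ n) @^-1` C).
  apply/seteqP; split=> w /=; first by exists (Num.truncn (T w * 2 ^+ n)).
  by move=> [k _ [<-]].
apply: bigcup_measurable => k _; apply: measurableI.
  apply: measurable_truncn_eq; first by apply: measurable_funM.
  by move=> w; rewrite mulr_ge0// exprn_ge0.
rewrite -[X in measurable X]setTI; exact: (measurable_brownian hB).
Qed.

Variables B1 B2 : R -> Omega -> R.
Hypotheses (hB1 : brownian P B1) (hB2 : brownian P B2).

(** Both paths vanish at time zero. *)
Lemma two_sidedE t w :
  two_sided B1 B2 t w = B1 (Num.max t 0) w + B2 (Num.max (- t) 0) w.
Proof.
have B10 : B1 0 w = 0 by case: hB1 => _ H _ _; have [] := H w.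
have B20 : B2 0 w = 0 by case: hB2 => _ H _ _; have [] := H w.
rewrite /two_sided; have [t0|t0] := leP 0 t.
  by rewrite [X in B2 X]max_r ?oppr_le0// B20 addr0.
by rewrite B10 add0r max_l// oppr_ge0 ltW.
Qed.

Lemma measurable_two_sided (T : Omega -> R) : measurable_fun setT T ->
  measurable_fun setT (fun w => two_sided B1 B2 (T w) w).
Proof.
move=> mT; under eq_fun do rewrite two_sidedE.
apply: measurable_funD; apply: measurable_time_change => //.
- exact: measurable_maxr.
- by move=> w; rewrite le_max lexx orbT.
- by apply: measurable_maxr => //; exact: measurableT_comp.
- by move=> w; rewrite le_max lexx orbT.
Qed.

Variables (h L : R) (N : nat).
Hypothesis h0 : 0 < h.

(** A negative time lies within [h] of a nonnegative one only if both are
    within [h] of the origin, where the two paths meet. *)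
Lemma two_sided_close w t v : ~ bad_path B1 h L N w -> ~ bad_path B2 h L N w ->
  0 <= v -> v + h <= h * N%:R -> `|t - v| <= h ->
  `|two_sided B1 B2 t w - B1 v w| <= 108 * Num.sqrt (h * L).
Proof.
move=> nb1 nb2 v0 vN; rewrite ler_distl => /andP[t1 t2].
have B20 : B2 0 w = 0 by case: hB2 => _ H _ _; have [] := H w.
have hv : h <= h * N%:R by apply: le_trans vN; rewrite lerDr.
have s0 : 0 <= Num.sqrt (h * L) by exact: sqrtr_ge0.
have m1 : `|B1 (Num.max t 0) w - B1 v w| <= 54 * Num.sqrt (h * L).
  apply: (brownian_modulus hB1 h0 nb1).
  - by rewrite le_max lexx orbT/= ge_max; apply/andP; split; lra.
  - by apply/andP; split; lra.
  - rewrite ler_distl; apply/andP; split; first by rewrite le_max; apply/orP; left.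
    by rewrite ge_max; apply/andP; split; lra.
have m2 : `|B2 (Num.max (- t) 0) w - B2 0 w| <= 54 * Num.sqrt (h * L).
  apply: (brownian_modulus hB2 h0 nb2).
  - by rewrite le_max lexx orbT/= ge_max; apply/andP; split; lra.
  - by apply/andP; split; lra.
  - rewrite subr0 ger0_norm ?le_max ?lexx ?orbT// ge_max; apply/andP; split; lra.
rewrite two_sidedE addrAC; apply: le_trans (ler_normD _ _) _.
rewrite B20 subr0 in m2; lra.
Qed.

End time_change.

Section measurability.
Context {d : measure_display} {Omega : measurableType d} {R : realType}.
Variable X : nat -> Omega -> R.
Hypothesis mX : forall t, (1 <= t)%N -> measurable_fun setT (X t).

Lemma measurable_sum_from a b :
  measurable_fun setT (fun w => \sum_(a.+1 <= i < b) X i w).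
Proof.
rewrite (_ : (fun w => _) = fun w => \sum_(i < b - a.+1) X (i + a.+1)%N w).
  by apply: measurable_sum => i; apply: mX; rewrite addnS ltnS.
by apply/funext => w; rewrite -[a.+1]add0n big_addn big_mkord.
Qed.

Lemma measurable_running_var m n j : measurable_fun setT (running_var X m n j).
Proof.
have mb a : measurable_fun setT (block X m n a) by exact: measurable_sum_from.
have mr : measurable_fun setT (remainder X m j).
  rewrite /remainder; have [_|_] := boolP (m %| j)%N; first exact: measurable_cst.
  exact: measurable_sum_from.
rewrite /running_var /block_var; apply: measurable_funD; last first.
  by apply: measurable_funM => //; apply: measurable_funM.
apply: measurable_funD; last exact: measurable_funX.
apply: measurable_funD.
  by apply: measurable_sum => a; exact: measurable_funX.
apply: measurable_funM => //; apply: measurable_sum => a.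
exact: measurable_funM.
Qed.

End measurability.

(** * From the estimation error to the Brownian gap *)

Section time_changed_brownian_motion.
Context {d : measure_display} {Omega : measurableType d} {R : realType}.
Variables (P : probability Omega R) (X : nat -> Omega -> R) (v : nat -> R).
Variables (p A : R) (m : nat -> nat) (B1 B2 : R -> Omega -> R).
Hypotheses (p_gt2 : 2 < p) (A_gt1 : 1 < A).
Hypothesis mX : forall t, (1 <= t)%N -> measurable_fun setT (X t).
Hypotheses (v_ge0 : forall i, 0 <= v i)
  (v_le : exists2 C : R, 0 <= C & forall i, v i <= C * i%:R).

Let gamma : R := Num.max (2 / p) (1 / 2).
Let dev n k w : R :=
  \big[Num.max/0]_(1 <= i < n.+1) `|running_var X k n i w - v i|.

Hypothesis tight : forall eps : R, 0 < eps -> exists2 M, 0 <= M & forall n k,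
  (0 < k)%N -> (0 < n)%N ->
  (P [set w | M * (n%:R `^ gamma * k%:R `^ (1 / 2) + n%:R * k%:R `^ (- A)) <
              `|dev n k w| ]%R <= eps%:E)%E.
Hypothesis m0 : forall n, (0 < m n)%N.
Let zeta : R := Num.min 1 (2 - 4 / p) / (1 + 2 * A).
Hypothesis m_order : same_order (fun n => (m n)%:R) (fun n => n%:R `^ zeta : R).
Hypotheses (hB1 : brownian P B1) (hB2 : brownian P B2).

Let A2 : 0 < 1 + 2 * A. Proof. by have := A_gt1; lra. Qed.

Lemma gamma_lt1 : gamma < 1.
Proof.
have p2 := p_gt2; have p0 : 0 < p by lra.
by rewrite /gamma gt_max; apply/andP; split; rewrite ltr_pdivrMr; lra.
Qed.

Lemma zetaE : zeta = 2 * (1 - gamma) / (1 + 2 * A).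
Proof.
rewrite /zeta; congr (_ / _); have p2 := p_gt2; have p0 : 0 < p by lra.
have E : 4 / p = 2 * (2 / p) by rewrite mulrA -natrM.
rewrite /gamma E; have [h|h] := leP (2 / p) (1 / 2).
  by rewrite min_l; lra.
by rewrite min_r; lra.
Qed.

(** The exponent zeta is chosen to give the two terms of the rate the same order. *)
Lemma rate_exponents_balance : gamma + zeta / 2 = 1 - A * zeta.
Proof. by rewrite zetaE; field; rewrite gt_eqF. Qed.

Let alpha : R := 1 - A * zeta.

Lemma alpha_gt0 : 0 < alpha.
Proof.
rewrite /alpha subr_gt0 zetaE mulrA ltr_pdivrMr//.
have g1 : 0 < gamma by rewrite /gamma lt_max; apply/orP; right; rewrite divr_gt0.
have := A_gt1; nra.
Qed.

Lemma block_rate_le : exists2 C, 0 <= C & \forall n \near \oo,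
  n%:R `^ gamma * (m n)%:R `^ (1 / 2) + n%:R * (m n)%:R `^ (- A) <= C * n%:R `^ alpha.
Proof.
have [c [C [c0 C0 [N _ HN]]]] := m_order.
exists (C `^ (1 / 2) + c `^ (- A)); first by rewrite addr_ge0// powR_ge0.
exists N.+1 => // n /= Nn; have n0 : (0 < n)%N by exact: leq_trans Nn.
have /andP[] := HN n (ltnW Nn).
have nR : 0 < n%:R :> R by rewrite ltr0n.
have z0 : 0 < n%:R `^ zeta :> R by rewrite powR_gt0.
rewrite ler_pdivlMr// ler_pdivrMr// => lo up.
rewrite mulrDl; apply: lerD.
  apply: (@le_trans _ _ (n%:R `^ gamma * (C * n%:R `^ zeta) `^ (1 / 2))).
    rewrite ler_wpM2l ?powR_ge0//.
    by rewrite ge0_ler_powR// ?nnegrE ?divr_ge0// mulr_ge0// ltW.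
  rewrite powRM ?powR_ge0 ?(ltW C0)// -powRrM mulrCA ler_wpM2l ?powR_ge0//.
  rewrite -powRD; last by apply/implyP => _; rewrite gt_eqF.
  have -> : gamma + zeta * (1 / 2) = alpha by rewrite /alpha -rate_exponents_balance; ring.
  exact: lexx.
have -> : c `^ (- A) * n%:R `^ alpha = n%:R * (c * n%:R `^ zeta) `^ (- A).
  rewrite powRM ?powR_ge0 ?(ltW c0)// -powRrM mulrCA.
  rewrite -{2}(powRr1 (ltW nR)) -powRD; last by apply/implyP => _; rewrite gt_eqF.
  by rewrite /alpha mulrN [zeta * A]mulrC.
rewrite ler_pM2l// !powRN lef_pV2 ?posrE ?powR_gt0 ?ltr0n ?m0 ?mulr_gt0//.
rewrite ge0_ler_powR// ?nnegrE ?mulr_ge0 ?(ltW c0) ?(ltW z0)//.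
by have := A_gt1; lra.
Qed.

Let Z n w : R := \big[Num.max/0]_(1 <= i < n.+1)
  `|two_sided B1 B2 (running_var X (m n) n i w) w - B1 (v i) w|.
Let r n : R := n%:R `^ (alpha / 2) * Num.sqrt (ln n%:R).

Lemma measurable_gap n M : measurable [set w | M * r n < `|Z n w|].
Proof.
apply: measurable_normr_gt; apply: measurable_bigmaxr => i _.
apply: measurable_funB.
  exact: (measurable_two_sided hB1 hB2 (measurable_running_var mX _ _ _)).
exact: (measurable_brownian hB1).
Qed.

Lemma bad_path_small (B : R -> Omega -> R) (h C eps : R) n : brownian P B ->
  0 < h -> 0 <= C -> 0 < eps -> (0 < n)%N -> 1 <= 2 * ln (n%:R : R) ->
  16 * (C + 2) / eps <= n%:R ->
  (P (bad_path B h (2 * ln n%:R) (Num.truncn (C * n%:R)).+2) <= (eps / 4)%:E)%E.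
Proof.
move=> hB h0 C0 e0 n0 L1 nbig.
have nR : 0 < n%:R :> R by rewrite ltr0n.
have n1 : 1 <= n%:R :> R by rewrite ler1n.
apply: le_trans (bad_path_le hB _ h0 L1) _; rewrite lee_fin.
have -> : - (2 * ln n%:R) = - ln n%:R + - ln n%:R :> R by ring.
rewrite expRD expRN lnK ?posrE//.
have /andP[tr _] := truncn_itv (mulr_ge0 C0 (ltW nR)).
have NC : (Num.truncn (C * n%:R)).+2%:R <= (C + 2) * n%:R :> R.
  by rewrite -addn2 natrD mulrDl; apply: lerD => //; rewrite ler_peMr.
apply: (@le_trans _ _ (4 * ((C + 2) * n%:R) * (n%:R^-1 * n%:R^-1))).
  by rewrite ler_wpM2r ?ler_wpM2l// mulr_ge0 ?invr_ge0// ltW.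
have -> : 4 * ((C + 2) * n%:R) * (n%:R^-1 * n%:R^-1) = 4 * (C + 2) / n%:R :> R.
  by field; rewrite gt_eqF.
rewrite ler_pdivrMr//; move: nbig; rewrite ler_pdivrMr//; lra.
Qed.

(** Off the exceptional paths, the gap is at most the modulus of continuity of
    Brownian motion at the scale of the estimation error. *)
Lemma gap_le n w (h L : R) N : 0 < h ->
  (forall i, (i <= n)%N -> v i + h <= h * N%:R) -> dev n (m n) w <= h ->
  ~ bad_path B1 h L N w -> ~ bad_path B2 h L N w ->
  Z n w <= 108 * Num.sqrt (h * L).
Proof.
move=> h0 vN dh nb1 nb2; rewrite /Z big_seq.
apply: bigmax_le => [|i]; first by rewrite mulr_ge0// sqrtr_ge0.
rewrite mem_index_iota => /andP[i1 iN].
apply: (two_sided_close hB1 hB2 h0 nb1 nb2 (v_ge0 i) (vN i iN)).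
apply: le_trans dh; rewrite /dev.
by apply: (le_bigmax_seq 0 i) => //; rewrite mem_index_iota i1.
Qed.

(** A horizon of order n is covered by O(n) intervals of length h >= 1, and
    L = 2 ln n makes the probability of an exceptional path O(1/n). *)
Lemma gap_tail (eps : R) : 0 < eps -> exists M, \forall n \near \oo,
  (P [set w | M * r n < `|Z n w|]%R <= eps%:E)%E.
Proof.
move=> e0; have e2 : 0 < eps / 2 by rewrite divr_gt0.
have [K K0 HK] := tight e2; have [C C0 HC] := v_le.
have [D D0 HD] := block_rate_le; pose H := K * D + 1.
have H1 : 1 <= H by rewrite lerDr mulr_ge0.
have H0 : 0 < H by exact: lt_le_trans H1.
exists (108 * Num.sqrt (2 * H)).
near=> n; have rate : n%:R `^ gamma * (m n)%:R `^ (1 / 2) +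
    n%:R * (m n)%:R `^ (- A) <= D * n%:R `^ alpha by near: n.
have n0 : (0 < n)%N by near: n; exists 1%N.
have nR : 0 < n%:R :> R by rewrite ltr0n.
have n1 : 1 <= n%:R :> R by rewrite ler1n.
have ln1 : 1 <= ln (n%:R : R).
  rewrite -[leLHS]expRK ler_ln ?posrE ?expR_gt0//.
  by near: n; exact: nbhs_infty_ger.
have L1 : 1 <= 2 * ln (n%:R : R) by lra.
have nbig : 16 * (C + 2) / eps <= n%:R.
  by near: n; exact: nbhs_infty_ger.
pose h := H * n%:R `^ alpha.
have na : 1 <= n%:R `^ alpha :> R.
  by rewrite -[leLHS](powRr0 n%:R) ler_powR// ltW// alpha_gt0.
have h1 : 1 <= h by rewrite -[leLHS]mulr1 ler_pM.
have h0 : 0 < h by exact: lt_le_trans h1.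
pose N := (Num.truncn (C * n%:R)).+2.
have b1 := bad_path_small hB1 h0 C0 e0 n0 L1 nbig.
have b2 := bad_path_small hB2 h0 C0 e0 n0 L1 nbig.
have vN i : (i <= n)%N -> v i + h <= h * N%:R.
  move=> iN; have vi : v i <= C * n%:R.
    by apply: le_trans (HC i) _; rewrite ler_wpM2l// ler_nat.
  have /andP[_ tr] := truncn_itv (mulr_ge0 C0 (ltW nR)).
  rewrite /N -addn1 natrD mulrDr mulr1 lerD2r.
  apply: (le_trans vi); apply: (le_trans (ltW tr)).
  by rewrite ler_peMl.
have sq : 108 * Num.sqrt (2 * H) * r n = 108 * Num.sqrt (h * (2 * ln n%:R)).
  rewrite -mulrA; congr (_ * _); rewrite /r.
  have -> : n%:R `^ (alpha / 2) = Num.sqrt (n%:R `^ alpha).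
    by rewrite -powR12_sqrt ?powR_ge0// -powRrM.
  rewrite -(sqrtrM _ (powR_ge0 _ _)) -sqrtrM; last by rewrite mulr_ge0// ltW.
  by congr Num.sqrt; rewrite /h; ring.
pose G := [set w | K * (n%:R `^ gamma * (m n)%:R `^ (1 / 2) +
   n%:R * (m n)%:R `^ (- A)) < `|dev n (m n) w|].
pose L := 2 * ln (n%:R : R).
have sub : [set w | 108 * Num.sqrt (2 * H) * r n < `|Z n w|] `<=`
    G `|` (bad_path B1 h L N `|` bad_path B2 h L N).
  move=> w /= Zw; have [Gw|nG] := pselect (G w); first by left.
  right; apply: contrapT => /not_orP[nb1 nb2].
  move: Zw; rewrite sq ltNge => /negP; apply.
  rewrite ger0_norm; last first.
    by rewrite /Z; elim/big_rec: _ => // i x _ x0; rewrite le_max x0 orbT.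
  apply: (@gap_le n w h _ N) => //.
  move: nG => /negP; rewrite -leNgt => /(le_trans (ler_norm _)) dG.
  apply: (le_trans dG); apply: (le_trans (ler_wpM2l K0 rate)).
  by rewrite /h mulrA ler_wpM2r ?powR_ge0// lerDl.
have mb B : brownian P B -> measurable (bad_path B h L N).
  by move=> hB; apply: (measurable_bad_path hB).
have mG : measurable G.
  apply: measurable_normr_gt; apply: measurable_bigmaxr => i _.
  by apply: measurable_funB => //; exact: measurable_running_var.
have m12 : measurable (bad_path B1 h L N `|` bad_path B2 h L N).
  by apply: measurableU; exact: mb.
apply: le_trans (le_measure P _ _ sub) _; rewrite ?inE.
- exact: measurable_gap.
- exact: measurableU.
apply: le_trans (measureU2 P mG m12) _.
have -> : eps%:E = ((eps / 2)%:E + ((eps / 4)%:E + (eps / 4)%:E))%E.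
  by rewrite -!EFinD; congr EFin; field.
apply: leeD; first exact: HK.
apply: le_trans (measureU2 P (mb _ hB1) (mb _ hB2)) _.
exact: leeD.
Unshelve. all: by end_near.
Qed.

(** The tail bound is applied at the level eps^2, one factor eps being spent in
    passing to the conditional probability. *)
Theorem cond_prob_gap : bigO_cond_prob P
  (fun n => process_events [set t | (1 <= t <= n)%N] X) Z r.
Proof.
move=> eps e0; have [M HM] := gap_tail (mulr_gt0 e0 e0).
have pX n : process_events [set t | (1 <= t <= n)%N] X `<=` measurable.
  move=> C [t /= /andP[t1 _]] [Y mY <-]; exact: mX.
have [q Hq] := choice (fun n => cond_prob_exists P (pX n) (measurable_gap n M)).
exists M, q; split => //; apply: limn_esup_le_near.
apply: filterS HM => n Hn.
apply: le_trans (cond_prob_markov (pX n) (measurable_gap n M) e0 (Hq n)) _.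
rewrite lee_pdivrMr//.
Qed.

End time_changed_brownian_motion.

(** * Consistency of the running variance *)

Theorem proposition3p1 (R : realType) (d d' : measure_display)
    (Omega : measurableType d) (E : measurableType d')
    (P : probability Omega R)
    (e e' : int -> Omega -> E) (g : nat -> past_space E -> R) (p A : R)
    (iid_e : iid P (fun s : int + int =>
                      match s with inl i => e i | inr i => e' i end))
    (g_meas : forall t, (1 <= t)%N -> measurable_fun setT (g t))
    (X_int : forall t, (1 <= t)%N ->
       P.-integrable setT (EFin \o causal g e t))
    (X_mean0 : forall t, (1 <= t)%N -> ('E_P[causal g e t] = 0)%E)
    (p_gt2 : 2 < p) (A_gt1 : 1 < A)
    (Theta0_fin : (Theta P g e e' p 0 < +oo)%E)
    (Theta_decay : (ereal_sup [set (((i.+1)%:R `^ A)%:E * Theta P g e e' p i)%E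
                              | i in [set: nat]] < +oo)%E) :
  let X := causal g e in
  let varS (i : nat) : R := fine ('E_P[(fun w => partial_sum X i w ^+ 2)%R])%E in
  let zeta1 : R := Num.min 1 (2 - 4 / p) / (1 + 2 * A) in
  forall m : nat -> nat, (forall n, (0 < m n)%N) ->
  bigO_prob P
    (fun n w => \big[Num.max/0]_(1 <= i < n.+1)
                  `|running_var X (m n) n i w - varS i|)
    (fun n => n%:R `^ Num.max (2 / p) (1 / 2) * (m n)%:R `^ (1 / 2) +
              n%:R * (m n)%:R `^ (- A))
  /\
  (same_order (fun n => (m n)%:R) (fun n => n%:R `^ zeta1 : R) ->
   forall B1 B2 : R -> Omega -> R,
   brownian P B1 -> brownian P B2 ->
   independent_systems P <<s process_events `[0, +oo[ B1 >>
                         <<s process_events `[0, +oo[ B2 >> ->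
   independent_systems P
     <<s process_events `[0, +oo[ B1 `|` process_events `[0, +oo[ B2 >>
     <<s process_events [set t | (1 <= t)%N] X >> ->
   bigO_cond_prob P
     (fun n => process_events [set t | (1 <= t <= n)%N] X)
     (fun n w => \big[Num.max/0]_(1 <= i < n.+1)
        `|two_sided B1 B2 (running_var X (m n) n i w) w - B1 (varS i) w|)
     (fun n => n%:R `^ ((1 - A * zeta1) / 2) * Num.sqrt (ln n%:R))).
Proof.
move=> X varS zeta1 m m0; split.
  exact: (running_var_rate iid_e g_meas X_int X_mean0 p_gt2 A_gt1
    Theta0_fin Theta_decay m0).
move=> m_order B1 B2 hB1 hB2 _ _.
apply: (cond_prob_gap p_gt2 A_gt1
  (measurable_causal iid_e g_meas)
  (varS_ge0 iid_e g_meas X_int X_mean0 p_gt2 A_gt1 Theta0_fin Theta_decay)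
  (varS_le iid_e g_meas X_int X_mean0 p_gt2 A_gt1 Theta0_fin Theta_decay)
  (running_var_tight iid_e g_meas X_int X_mean0 p_gt2 A_gt1 Theta0_fin
    Theta_decay) m0 m_order hB1 hB2).
Qed.
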